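(* Deligne's $p$-adic multiple zeta values satisfy the generalized double shuffle relations; precisely, $\Phi^p_{De}(A,-B)\in\underline{DMR}_0(\mathbb Q_p)$.
   Context: Let $p$ be a prime and $X=\mathbb P^1\setminus\{0,1,\infty\}$. The de Rham fundamental group of $X$ with tangential base point $\overrightarrow{01}$ is identified with the group-like elements with constant term $1$ of the noncommutative power series Hopf algebra $\mathbb Q\langle\langle A,B\rangle\rangle$ ($A$, $B$ corresponding to loops around $0$ and $1$), with coproduct $\Delta A=A\otimes1+1\otimes A$, $\Delta B=B\otimes1+1\otimes B$. The (inverse) Frobenius $\phi$ acts on $\mathbb Q_p\langle\langle A,B\rangle\rangle$ by $A\mapsto A/p$, $B\mapsto(\Phi^p_{De})^{-1}\frac{B}{p}\Phi^p_{De}$, where $\Phi^p_{De}$ is the unique group-like element of $\mathbb Q_p\langle\langle A,B\rangle\rangle$ with constant term $1$ whose coefficients of $B^n$ ($n\ge1$) vanish. Deligne's $p$-adic MZV $\zeta_p^{De}(n_1,\dots,n_m)$ is $(-1)^m$ times the coefficient of $A^{n_m-1}B\cdots A^{n_1-1}B$ in $\Phi^p_{De}$. For a field $k$ of characteristic $0$, $\underline{DMR}_0(k)$ (Racinet) is the set of $g=\sum_W c_WW\in k\langle\langle A,B\rangle\rangle$ ($W$ over words in $A,B$) such that: (i) $c_\emptyset=1$ and $c_A=c_B=0$; (ii) $\Delta g=g\otimes g$; (iii) letting $\pi_y:k\langle\langle A,B\rangle\rangle\to k\langle\langle y_1,y_2,\dots\rangle\rangle$ be the linear map sending words ending in $A$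 to $0$ and $A^{n_1-1}B\cdots A^{n_m-1}B$ to $y_{n_1}\cdots y_{n_m}$, letting $\Delta_*$ be the coproduct with $\Delta_*y_n=\sum_{i=0}^n y_i\otimes y_{n-i}$ ($y_0:=1$), and $g_*=\exp\big(-\sum_{n\ge1}\frac{(-1)^n}{n}c_{A^{n-1}B}y_1^n\big)\pi_y(g)$, one has $\Delta_*g_*=g_*\otimes g_*$. *)

(* Defs.v *)
From HB Require Import structures.
From mathcomp Require Import all_boot all_order all_algebra.
From mathcomp Require Import boolp classical_sets functions cardinality fsbigop.

Set Implicit Arguments.
Unset Strict Implicit.
Unset Printing Implicit Defensive.

Import Order.TTheory GRing.Theory Num.Theory.

Local Open Scope ring_scope.

(* [ncseries T R] is R<<T>>: noncommutative formal power series over the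
   alphabet T, a series being the function sending each word to its
   coefficient.  Multiplication is the Cauchy (concatenation) product, not the
   pointwise product of functions.

   R need not be commutative but letters always commute with coefficients, so
   that
   - [ncseries T (ncseries T K)] is the completed tensor square
     K<<T>> (x) K<<T>> with its usual algebra structure, the coefficient of
     u (x) v in F being [F u v];
   - [ncseries unit K], over a one-letter alphabet, is K[[w]], the coefficient
     of w^n being the value at [nseq n tt]. *)
Definition ncseries (T : choiceType) (R : nzRingType) : Type := seq T -> R.

Section NCSeriesRing.
Variables (T : choiceType) (R : nzRingType).

HB.instance Definition _ :=
  GRing.Zmodule.copy (ncseries T R) (seq T -> R).

Implicit Types f g h : ncseries T R.

Definition ncone : ncseries T R := fun w => (w == [::])%:R.

Definition ncmul f g : ncseries T R :=
  fun w => \sum_(i < (size w).+1) f (take i w) * g (drop i w).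

Lemma ncaddE f g w : (f + g) w = f w + g w. Proof. by []. Qed.

Lemma ncmulA : associative ncmul.
Proof.
move=> f g h; apply/funext => w; rewrite /ncmul.
under eq_bigr => i _ do rewrite mulr_sumr.
under [RHS]eq_bigr => i _ do rewrite mulr_suml.
pose F i j := f (take i w) * (g (drop i (take j w)) * h (drop j w)).
transitivity (\sum_(0 <= i < (size w).+1) \sum_(i <= j < (size w).+1) F i j).
  rewrite big_mkord; apply: eq_bigr => i _.
  have hi := ltn_ord i; rewrite ltnS in hi.
  rewrite -[X in \sum_(X <= _ < _) _]add0n big_addn subSn // size_drop big_mkord.
  apply: eq_bigr => j _; rewrite /F drop_drop take_drop.
  by [].
transitivity (\sum_(0 <= j < (size w).+1) \sum_(0 <= i < j.+1) F i j).
  transitivity (\sum_(0 <= i < (size w).+1)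
      \sum_(0 <= j < (size w).+1 | (i <= j)%N) F i j).
    by apply: eq_bigr => i _; rewrite (big_nat_widenl _ 0).
  rewrite (exchange_big_dep_nat xpredT) //=; apply: eq_big_nat => j /andP[_ hj].
  by rewrite [RHS](big_nat_widen _ _ (size w).+1).
rewrite big_mkord; apply: eq_bigr => j _.
have hj := ltn_ord j; rewrite ltnS in hj.
have E : size (take j w) = j by rewrite size_takel.
rewrite big_mkord E; apply: eq_bigr => i _.
by rewrite /F mulrA take_takel // -ltnS.
Qed.

Lemma ncmul1f : left_id ncone ncmul.
Proof.
move=> f; apply/funext => w; rewrite /ncmul big_ord_recl take0 drop0 mul1r.
rewrite big1 ?addr0 // => i _; rewrite /ncone -size_eq0 size_takel ?mul0r //.
exact: ltn_ord.
Qed.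

Lemma ncmulf1 : right_id ncone ncmul.
Proof.
move=> f; apply/funext => w; rewrite /ncmul big_ord_recr /= take_size drop_size.
rewrite mulr1 big1 ?add0r // => i _.
by rewrite /ncone -size_eq0 size_drop subn_eq0 leqNgt ltn_ord mulr0.
Qed.

Lemma ncmulDl : left_distributive ncmul +%R.
Proof.
move=> f g h; apply/funext => w; rewrite ncaddE /ncmul -big_split /=.
by apply: eq_bigr => i _; rewrite ncaddE mulrDl.
Qed.

Lemma ncmulDr : right_distributive ncmul +%R.
Proof.
move=> f g h; apply/funext => w; rewrite ncaddE /ncmul -big_split /=.
by apply: eq_bigr => i _; rewrite ncaddE mulrDr.
Qed.

Lemma ncone_neq0 : ncone != 0.
Proof.
apply/eqP => /(congr1 (fun f : ncseries T R => f [::])).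
by rewrite /ncone eqxx => /eqP; rewrite oner_eq0.
Qed.

HB.instance Definition _ := GRing.Zmodule_isNzRing.Build (ncseries T R)
  ncmulA ncmul1f ncmulf1 ncmulDl ncmulDr ncone_neq0.

End NCSeriesRing.

Section NCSeriesOps.
Variables (T : choiceType) (R : nzRingType).

Definition monom (u : seq T) : ncseries T R := fun w => (w == u)%:R.

Definition coefC (c : R) : ncseries T R := fun w => c *+ (w == [::]).

(* Only used for f with constant term 1: (1 - f)^k then vanishes on words of
   length < k, so this is the geometric series for f^-1. *)
Definition ncinv (f : ncseries T R) : ncseries T R :=
  fun w => \sum_(k < (size w).+1) ((1 - f) ^+ k) w.

End NCSeriesOps.

Section HopfAlgebras.
Variable K : fieldType.

(* Only used for f without constant term: f^k then vanishes on words of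
   length < k, so this is the full exponential series. *)
Definition ncexp (T : choiceType) (f : ncseries T K) : ncseries T K :=
  fun w => \sum_(k < (size w).+1) (f ^+ k) w / k`!%:R.

Definition tens (T : choiceType) (f g : ncseries T K) :
  ncseries T (ncseries T K) := fun u v => f u * g v.

(* The continuous algebra morphism K<<T>> -> K<<T>> (x) K<<T>> sending each
   letter l to d l.  For the two coproducts below, and fixed u and v, only
   finitely many words w contribute, so the finitely supported sum is the
   genuine one. *)
Definition coproduct (T : choiceType) (d : T -> ncseries T (ncseries T K))
    (f : ncseries T K) : ncseries T (ncseries T K) :=
  fun u v => \sum_(w \in [set: seq T]) f w * (\prod_(l <- w) d l) u v.

(* The alphabet {A, B}. *)
Definition lA : bool := false.
Definition lB : bool := true.

Definition DeltaAB : ncseries bool K -> ncseries bool (ncseries bool K) :=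
  coproduct (fun l => tens (monom K [:: l]) 1 + tens 1 (monom K [:: l])).

(* The alphabet {y_1, y_2, ...}: the letter y_n is encoded by n - 1, and
   y_0 = 1. *)
Definition yser (n : nat) : ncseries nat K :=
  if n is m.+1 then monom K [:: m] else 1.

Definition Deltast : ncseries nat K -> ncseries nat (ncseries nat K) :=
  coproduct (fun m => \sum_(i < m.+2) tens (yser i) (yser (m.+1 - i))).

(* The word A^(n_1 - 1) B ... A^(n_m - 1) B attached to y_(n_1) ... y_(n_m). *)
Definition wordAB (w : seq nat) : seq bool :=
  flatten [seq rcons (nseq k lA) lB | k <- w].

Definition pi_y (g : ncseries bool K) : ncseries nat K := fun w => g (wordAB w).

(* sum_(n >= 1) (-1)^n / n c_(A^(n-1) B) y_1^n; only n = size w can contribute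
   to the coefficient of w. *)
Definition corr (g : ncseries bool K) : ncseries nat K :=
  fun w => \sum_(1 <= n < (size w).+1)
    (-1) ^+ n / n%:R * g (rcons (nseq n.-1 lA) lB) * (yser 1 ^+ n) w.

Definition gstar (g : ncseries bool K) : ncseries nat K :=
  ncexp (- corr g) * pi_y g.

Definition DMR0 (g : ncseries bool K) : Prop :=
  [/\ [/\ g [::] = 1, g [:: lA] = 0 & g [:: lB] = 0],
      DeltaAB g = tens g g
    & Deltast (gstar g) = tens (gstar g) (gstar g)].

(* g(A, -B) *)
Definition negB (g : ncseries bool K) : ncseries bool K :=
  fun w => (-1) ^+ count_mem lB w * g w.

End HopfAlgebras.

(* (K, abs) is the field of p-adic numbers: the completion of rat for the
   p-adic absolute value.  All values of the latter are rational. *)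
Record is_padic_field (p : nat) (K : fieldType) (abs : K -> rat) : Prop := {
  padic_ge0 : forall x, 0 <= abs x;
  padic_eq0 : forall x, abs x = 0 <-> x = 0;
  padicM : forall x z, abs (x * z) = abs x * abs z;
  padicD : forall x z, abs (x + z) <= Num.max (abs x) (abs z);
  padic_p : abs p%:R = p%:R^-1;
  padic_dense : forall (x : K) (e : rat), 0 < e ->
    exists q : rat, abs (x - ratr q) < e;
  padic_complete : forall u : nat -> K,
    (forall e : rat, 0 < e -> exists N : nat, forall m n : nat,
        (N <= m)%N -> (N <= n)%N -> abs (u m - u n) < e) ->
    exists l : K, forall e : rat, 0 < e -> exists N : nat, forall n : nat,
        (N <= n)%N -> abs (u n - l) < e
}.

(* The crystalline Frobenius on the de Rham fundamental group of
   P^1 \ {0, 1, oo} with base point the tangent vector 01.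

   The universal unipotent connection is dG = (A dz/z + B dz/(z-1)) G.  The map
   F : z |-> z^p lifts Frobenius, and over the dagger space of P^1 minus the
   open residue disc ]1[ it respects the logarithmic poles at 0 and oo and fixes
   the tangent vector 01.  The inverse Frobenius is the continuous automorphism
   A |-> A', B |-> B' of K<<A,B>> for which the pull-back by F of the connection
   with residues A', B' is isomorphic to the universal one, through an
   overconvergent horizontal G which is the identity on fibres at the base
   point.  In other words
     dG = (A dz/z + B dz/(z-1)) G - G (A' F^*(dz/z) + B' F^*(dz/(z-1))),
     G(0) = 1,
   where all coefficients of G are overconvergent functions on P^1 \ ]1[.

   Functions on P^1 \ ]1[ are expanded in the coordinate w = 1/(z-1), for which
   P^1 \ ]1[ is the closed disc |w| <= 1; w = -1 at z = 0 and w = 0 at z = oo. *)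
Section Frobenius.
Variables (p : nat) (K : fieldType) (abs : K -> rat).

Definition powser : nzRingType := ncseries unit K.

Definition powser_of_poly (q : {poly K}) : powser := fun v => q`_(size v).

(* d/dw *)
Definition ddw (f : powser) : powser :=
  fun v => (size v).+1%:R * f (tt :: v).

(* Convergence on a disc of radius > 1. *)
Definition overconvergent (f : powser) : Prop :=
  exists r M : rat, 1 < r /\ forall n, abs (f (nseq n tt)) * r ^+ n <= M.

(* f takes the value c at z = 0, i.e. at w = -1. *)
Definition value_at_z0 (f : powser) (c : K) : Prop :=
  forall e : rat, 0 < e -> exists N : nat, forall n : nat, (N <= n)%N ->
    abs (\sum_(i < n) f (nseq i tt) * (-1) ^+ i - c) < e.

(* With Q = (w+1)^p - w^p, so that z = (w+1)/w and z^p - 1 = Q/w^p,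
     dz/z           = - dw / (w (w+1)),
     dz/(z-1)       = - dw / w,
     F^*(dz/z)      = - p dw / (w (w+1)),
     F^*(dz/(z-1))  = - p (w+1)^(p-1) dw / (w Q).
   The following are the numerators of these forms over the common denominator
   formden = w (w+1) Q. *)
Definition frobQ : {poly K} := ('X + 1) ^+ p - 'X ^+ p.
Definition formden : {poly K} := 'X * ('X + 1) * frobQ.
Definition form0 : {poly K} := - frobQ.
Definition form1 : {poly K} := - (('X + 1) * frobQ).
Definition Fform0 : {poly K} := - (p%:R * frobQ).
Definition Fform1 : {poly K} := - (p%:R * ('X + 1) ^+ p).

(* Coefficients in K[[w]]. *)
Definition polyC_nc (q : {poly K}) : ncseries bool powser :=
  coefC (powser_of_poly q).
Definition extend_scalars (f : ncseries bool K) : ncseries bool powser :=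
  fun u => coefC (f u).

Definition frobenius_horizontal (A' B' : ncseries bool K)
    (G : ncseries bool powser) : Prop :=
  polyC_nc formden * ((fun u => ddw (G u)) : ncseries bool powser) =
    (polyC_nc form0 * monom powser [:: lA]
     + polyC_nc form1 * monom powser [:: lB]) * G
    - G * (polyC_nc Fform0 * extend_scalars A'
           + polyC_nc Fform1 * extend_scalars B').

(* The inverse Frobenius is A |-> A', B |-> B'. *)
Definition is_inverse_frobenius (A' B' : ncseries bool K) : Prop :=
  exists G : ncseries bool powser,
    [/\ forall u, overconvergent (G u),
        forall u, value_at_z0 (G u) ((u == [::])%:R)
      & frobenius_horizontal A' B' G].

Definition is_PhiDe (Phi : ncseries bool K) : Prop :=
  [/\ Phi [::] = 1,
      DeltaAB Phi = tens Phi Phi,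
      forall n, (0 < n)%N -> Phi (nseq n lB) = 0
    & is_inverse_frobenius
        (coefC p%:R^-1 * monom K [:: lA])
        (ncinv Phi * (coefC p%:R^-1 * monom K [:: lB]) * Phi)].

End Frobenius.

(* Main.v *)
From mathcomp Require Import all_boot all_order all_algebra.
From mathcomp Require Import boolp classical_sets functions fsbigop.
From mathcomp Require Import zify ring lra.
Require Import Defs.

(* Write C = Phi^-1 B Phi, and let z = 0 be the base point.  Modulo the
   left ideal generated by A, the partial sums of the expansion at z = 0 of a
   solution of the universal connection are the truncated products
     H_N = (1 - (N-A)^-1 B) ... (1 - (1-A)^-1 B),
   whose images under pi_y, with B replaced by -B, are group-like for Delta_*:
   their coefficients are multiple harmonic sums.  The overconvergence of the
   Frobenius matrix G yields a sequence X_n, p-adically continuous and bounded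
   in n, such that modulo the same left ideal
     H_(pn+p-1) = X_n (1 - (pn-A)^-1 C) ... (1 - (p-A)^-1 C).
   By continuity the resulting recursion for X_n holds exactly, and
   Y_n = X_n Phi^-1 satisfies
     Y_n (1 - Phi (pn-A)^-1 Phi^-1 B) = H_(pn+p-1) H_(pn-1)^-1 Y_(n-1)
   and has no words ending in A.  Let v_n and phi be the images under pi_y of Y_n
   and Phi, with B replaced by -B.  The defect
     W_n = (v_n (x) v_n)^-1 Delta_* v_n
   is bounded in n, whereas its increments are polynomials in 1/n without
   constant term; hence it is constant and commutes with y_1 (x) 1 + 1 (x) y_1,
   which forces it to be supported on pairs of powers of y_1.  Since
   W_0 Delta_* phi = phi (x) phi, the coproduct is correct up to a factor in
   powers of y_1, and the exponential correction in gstar, which satisfies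
   Newton's identities, makes this factor trivial. *)

Set Implicit Arguments.
Unset Strict Implicit.
Unset Printing Implicit Defensive.

Import Order.TTheory GRing.Theory Num.Theory.

Local Open Scope ring_scope.

(** * Noncommutative power series *)

(** Solutions at the tangential base point carry a factor z^A on the right. Working modulo the left
    ideal generated by A removes it, at no cost for [pi_y], which ignores words ending in A. But
    such congruences survive left multiplication only, so the Frobenius product to the right of X_n
    cannot be cancelled. Exactness is recovered p-adically: the harmonic number H_(n+p^r) has
    absolute value p^r for large r, while X_(n+p^r) converges to X_n.

    Phi enters the recursion through Phi (pn-A)^(-1) Phi^(-1), which to first order is 1/(pn)
    whatever Phi is. As a polynomial in 1/n that is bounded along n = p^r is constant, the only
    information extracted is a commutator with y_1; this is why the coproduct is first obtained only
    up to powers of y_1. The vanishing of the coefficients of B^n in Phi settles this ambiguity.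

    Continuity of X_n rests on overconvergence. Rewriting the partial sums of G as a function of n
    costs a growth polynomial in k on the coefficient of w^k, and this is absorbed by a decay r^(-k)
    with r > 1. *)

Section NCSeries.
Variables (T : choiceType) (R : nzRingType).
Implicit Types (f g h : ncseries T R) (v w : seq T) (a b : T).

Definition lder a f : ncseries T R := fun w => f (a :: w).
Definition rder a f : ncseries T R := fun w => f (rcons w a).

Lemma ncP f g : (forall w, f w = g w) -> f = g.
Proof. by move=> h; apply/funext. Qed.

Lemma ncE f g w : (f * g) w = \sum_(i < (size w).+1) f (take i w) * g (drop i w).
Proof. by []. Qed.

Lemma ncD f g w : (f + g) w = f w + g w. Proof. by []. Qed.
Lemma ncN f w : (- f) w = - f w. Proof. by []. Qed.
Lemma ncB f g w : (f - g) w = f w - g w. Proof. by []. Qed.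
Lemma nc0 w : (0 : ncseries T R) w = 0. Proof. by []. Qed.
Lemma nc1 w : (1 : ncseries T R) w = (w == [::])%:R. Proof. by []. Qed.

Lemma nc_sum I (r : seq I) (P : pred I) (F : I -> ncseries T R) w :
  (\sum_(i <- r | P i) F i) w = \sum_(i <- r | P i) F i w.
Proof. by elim/big_rec2: _ => // i x y _ <-. Qed.

Lemma ncM_nil f g : (f * g) [::] = f [::] * g [::].
Proof. by rewrite ncE big_ord1. Qed.

Lemma ncM_cons f g a w :
  (f * g) (a :: w) = f [::] * g (a :: w) + (lder a f * g) w.
Proof. by rewrite !ncE big_ord_recl. Qed.

Lemma ncM_rcons f g w a :
  (f * g) (rcons w a) = (f * rder a g) w + f (rcons w a) * g [::].
Proof.
rewrite !ncE size_rcons big_ord_recr /=; congr (_ + _); last first.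
  by rewrite -(size_rcons w a) take_size drop_size.
apply: eq_bigr => i _; have hi : (i <= size w)%N by rewrite -ltnS.
by rewrite -cats1 takel_cat // drop_cat ltn_neqAle hi andbT;
  case: eqP => [-> | _] /=; rewrite /rder -?cats1 ?subnn ?drop0 ?drop_size.
Qed.

Lemma lderM a f g : lder a (f * g) = (coefC (f [::]) : ncseries T R) * lder a g + lder a f * g.
Proof.
apply: ncP => w; rewrite /lder ncM_cons ncD; congr (_ + _).
rewrite ncE big_ord_recl take0 drop0 /coefC eqxx big1 ?addr0 // => i _.
by rewrite -size_eq0 size_takel ?mulr0n ?mul0r //; exact: ltn_ord.
Qed.

Lemma coefCM c f w : ((coefC c : ncseries T R) * f) w = c * f w.
Proof.
rewrite ncE big_ord_recl take0 drop0 /coefC eqxx big1 ?addr0 // => i _.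
by rewrite -size_eq0 size_takel ?mulr0n ?mul0r //; exact: ltn_ord.
Qed.

Lemma McoefC c f w : (f * (coefC c : ncseries T R)) w = f w * c.
Proof.
rewrite ncE big_ord_recr /= take_size drop_size /coefC eqxx big1 ?add0r // => i _.
by rewrite -size_eq0 size_drop subn_eq0 leqNgt ltn_ord mulr0n mulr0.
Qed.

Lemma coefC_nil c : (coefC c : ncseries T R) [::] = c. Proof. by rewrite /coefC eqxx. Qed.

Lemma coefC_comp c d : coefC c * coefC d = coefC (c * d) :> ncseries T R.
Proof. by apply: ncP => w; rewrite coefCM /coefC mulrnAr. Qed.

Lemma coefCD c d : coefC (c + d) = coefC c + coefC d :> ncseries T R.
Proof. by apply: ncP => w; rewrite ncD /coefC mulrnDl. Qed.

Lemma coefCN c : coefC (- c) = - coefC c :> ncseries T R.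
Proof. by apply: ncP => w; rewrite ncN /coefC mulNrn. Qed.

Lemma coefC1 : coefC 1 = 1 :> ncseries T R.
Proof. by apply: ncP => w; rewrite nc1. Qed.

Lemma coefC0 : coefC 0 = 0 :> ncseries T R.
Proof. by apply: ncP => w; rewrite /coefC mul0rn. Qed.

Lemma coefC_sum I (r : seq I) (P : pred I) (F : I -> R) :
  coefC (\sum_(i <- r | P i) F i) = \sum_(i <- r | P i) coefC (F i) :> ncseries T R.
Proof.
elim/big_rec2: _ => [|i x y _ <-]; [exact: coefC0 | exact: coefCD].
Qed.

Lemma letM_nil a f : (monom R [:: a] * f) [::] = 0.
Proof. by rewrite ncM_nil /monom eq_sym mul0r. Qed.

Lemma letM_cons a f b w :
  (monom R [:: a] * f) (b :: w) = if b == a then f w else 0.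
Proof.
rewrite ncM_cons /monom eq_sym mul0r add0r.
have -> : lder b (fun w : seq T => (w == [:: a])%:R : R) =
   coefC (b == a)%:R.
  apply: ncP => v; rewrite /lder /coefC eqseq_cons.
  by case: (b == a); case: (v == _); rewrite /= ?mul0rn.
by rewrite coefCM; case: (b == a); rewrite ?mul1r ?mul0r.
Qed.

Lemma Mlet_nil a f : (f * monom R [:: a]) [::] = 0.
Proof. by rewrite ncM_nil /monom eq_sym mulr0. Qed.

Lemma Mlet_rcons a f b w :
  (f * monom R [:: a]) (rcons w b) = if b == a then f w else 0.
Proof.
rewrite ncM_rcons /monom [[::] == _]eq_sym mulr0 addr0.
have -> : rder b (fun w : seq T => (w == [:: a])%:R : R) =
   coefC (b == a)%:R.
  apply: ncP => v; rewrite /rder /coefC -[[:: a]]/(rcons [::] a) eqseq_rcons.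
  by case: (b == a); case: (v == _); rewrite /= ?mul0rn.
by rewrite McoefC; case: (b == a); rewrite ?mulr1 ?mulr0.
Qed.

Lemma ncM_small f g w : (forall v, (size v < size w)%N -> f v = 0) ->
  (f * g) w = f w * g [::].
Proof.
move=> hf; rewrite ncE big_ord_recr /= take_size drop_size big1 ?add0r // => i _.
by rewrite hf ?mul0r // size_takel //; apply: ltnW; exact: ltn_ord.
Qed.

Lemma ncM_small_r f g w : (forall v, (size v < size w)%N -> g v = 0) ->
  (f * g) w = f [::] * g w.
Proof.
move=> hg; rewrite ncE big_ord_recl /= take0 drop0 big1 ?addr0 // => i _.
by rewrite hg ?mulr0 // size_drop ltn_subrL /= (leq_trans _ (ltn_ord i)).
Qed.

Lemma ncM_eq0 f g w : (forall i, (i <= size w)%N ->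
    f (take i w) = 0 \/ g (drop i w) = 0) -> (f * g) w = 0.
Proof.
move=> h; rewrite ncE big1 // => i _.
by case: (h i) => [|->|->]; rewrite ?mul0r ?mulr0 // -ltnS.
Qed.

Lemma ncX_small f n w : f [::] = 0 -> (size w < n)%N -> (f ^+ n) w = 0.
Proof.
move=> f0; elim: n w => // n IH w hw; rewrite exprS; apply: ncM_eq0 => i hi.
case: i hi => [|i] hi; first by left; rewrite take0.
by right; apply: IH; rewrite size_drop; move: hw hi; case: (size w) => //= m;
  rewrite !ltnS subSS => hm him; apply: leq_ltn_trans (leq_subr _ _) _.
Qed.

Lemma ncM_agree f f' g g' w : (forall v, (size v <= size w)%N -> f v = f' v) ->
  (forall v, (size v <= size w)%N -> g v = g' v) -> (f * g) w = (f' * g') w.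
Proof.
move=> hf hg; rewrite !ncE; apply: eq_bigr => i _; rewrite hf ?hg //.
  by rewrite size_drop leq_subr.
by rewrite size_take_min geq_minr.
Qed.

Lemma ncinv_nil f : f [::] = 1 -> ncinv f [::] = 1.
Proof. by move=> f1; rewrite /ncinv big_ord1 expr0 nc1 eqxx. Qed.

(** Lengthening the truncation changes nothing, so one finite geometric sum serves all the factors
    of a word at once and can be telescoped. *)
Lemma ncinvE f N w : f [::] = 1 -> (size w <= N)%N ->
  ncinv f w = (\sum_(k < N.+1) (1 - f) ^+ k) w.
Proof.
move=> f1 hN; rewrite nc_sum /ncinv.
rewrite -!(big_mkord xpredT (fun k => ((1 - f) ^+ k) w)).
rewrite [RHS](big_cat_nat (n := (size w).+1)) //= [X in _ = _ + X]big1_seq ?addr0 //.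
move=> k; rewrite mem_index_iota => /andP[_ /andP[hk _]].
by apply: ncX_small; rewrite // ncB f1 nc1 subrr.
Qed.

Lemma ncinvK_aux f N : (\sum_(k < N.+1) (1 - f) ^+ k) * f = 1 - (1 - f) ^+ N.+1
  /\ f * (\sum_(k < N.+1) (1 - f) ^+ k) = 1 - (1 - f) ^+ N.+1.
Proof.
set x := 1 - f; have E : f = - (x - 1) by rewrite /x addrC addrA addNr sub0r opprK.
have cx : GRing.comm (x - 1) (\sum_(k < N.+1) x ^+ k).
  apply: commr_sum => i _; apply: commrX; apply/commr_sym.
  exact: commrB (commr_refl _) (commr1 _).
by rewrite E mulrN mulNr -cx -subrX1 opprB.
Qed.

Lemma ncmulV f : f [::] = 1 -> f * ncinv f = 1.
Proof.
move=> f1; apply: ncP => w.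
rewrite (@ncM_agree _ f _ (\sum_(k < (size w).+1) (1 - f) ^+ k)) //; last first.
  by move=> v hv; apply: ncinvE.
rewrite (ncinvK_aux f (size w)).2 ncB ncX_small ?subr0 //.
by rewrite ncB f1 nc1 subrr.
Qed.

Lemma ncmulVf f : f [::] = 1 -> ncinv f * f = 1.
Proof.
move=> f1; apply: ncP => w.
rewrite (@ncM_agree _ (\sum_(k < (size w).+1) (1 - f) ^+ k) _ f) //; last first.
  by move=> v hv; apply: ncinvE.
rewrite (ncinvK_aux f (size w)).1 ncB ncX_small ?subr0 //.
by rewrite ncB f1 nc1 subrr.
Qed.

Lemma ncmulI f g h : f [::] = 1 -> f * g = f * h -> g = h.
Proof.
move=> f1 /(congr1 (fun x => ncinv f * x)).
by rewrite !mulrA ncmulVf // !mul1r.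
Qed.

Lemma ncmulIr f g h : f [::] = 1 -> g * f = h * f -> g = h.
Proof.
move=> f1 /(congr1 (fun x => x * ncinv f)).
by rewrite -!mulrA ncmulV // !mulr1.
Qed.

End NCSeries.

(** * The stuffle coproduct *)

Section Tensor.
Variables (T : choiceType) (K : fieldType).
Implicit Types f g : ncseries T K.

Lemma tens1 : tens 1 1 = 1 :> ncseries T (ncseries T K).
Proof.
apply: ncP => u; apply: ncP => v; rewrite /tens !nc1.
by case: (u == [::]); rewrite ?nc1 ?mul1r ?mul0r.
Qed.

Lemma tensE f g u : tens f g u = (coefC (f u) : ncseries T K) * g.
Proof. by apply: ncP => v; rewrite coefCM. Qed.

Lemma coefC_comm (c : K) f : (coefC c : ncseries T K) * f = f * coefC c.
Proof. by apply: ncP => w; rewrite coefCM McoefC mulrC. Qed.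

Lemma tensM f g f' g' : tens f g * tens f' g' = tens (f * f') (g * g').
Proof.
apply: ncP => u; rewrite tensE ncE [in RHS]ncE coefC_sum mulr_suml.
apply: eq_bigr => i _; rewrite !tensE -coefC_comp -!mulrA; congr (_ * _).
by rewrite [RHS]mulrA [coefC _ * g]coefC_comm mulrA.
Qed.

Lemma tens1l g : tens 1 g = coefC g.
Proof.
by apply: ncP => u; apply: ncP => v; rewrite /tens /coefC nc1;
   case: (u == [::]); rewrite ?mul1r ?mul0r.
Qed.

Lemma tens_letter a g :
  tens (monom K [:: a]) g = monom (ncseries T K) [:: a] * coefC g.
Proof.
apply: ncP => u; rewrite McoefC tensE /monom.
by case: (u == _); rewrite ?coefC0 ?coefC1 ?mul0r ?mul1r.
Qed.

Lemma coproductE (d : T -> ncseries T (ncseries T K)) f u v (r : seq (seq T)) :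
    uniq r ->
    (forall w, w \notin r -> (\prod_(l <- w) d l) u v = 0) ->
  coproduct d f u v = \sum_(w <- r) f w * (\prod_(l <- w) d l) u v.
Proof.
move=> ur hr; rewrite /coproduct (fsbigE r) //.
  by apply: eq_bigl => w; rewrite in_setT.
by move=> w _ /hr ->; rewrite mulr0.
Qed.

End Tensor.

(** A finite range for the sum in [Deltast]. The length bound [s] is separate from the letter bound
    [N] because peeling off the first letter lowers only the former. *)
Fixpoint bounded_words (N s : nat) : seq (seq nat) :=
  if s is s'.+1 then
    [::] :: [seq l :: w | l <- iota 0 N, w <- bounded_words N s']
  else [:: [::]].

Lemma mem_bounded_words N s w :
  (w \in bounded_words N s) = (size w <= s)%N && all (fun l => l < N)%N w.
Proof.
elim: s w => [|s IH] [|l w] //=; rewrite in_cons /= ltnS.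
apply/allpairsP/andP => [[[l' w'] /= [hl hw [-> ->]]]|[hs /andP[hl hw]]].
  by move: hw hl; rewrite IH mem_iota add0n => /andP[-> ->] /= ->.
by exists (l, w); rewrite /= IH hs hw mem_iota.
Qed.

Lemma uniq_bounded_words N s : uniq (bounded_words N s).
Proof.
elim: s => //= s IH; apply/andP; split.
  by apply/negP => /allpairsP[[l w] /= [_ _]].
apply: allpairs_uniq; rewrite ?iota_uniq //.
by move=> [l w] [l' w'] _ _ /= [-> ->].
Qed.

(** The letter [l] encodes y_(l+1), hence the summand [size w]. *)
Definition weight (w : seq nat) := (sumn w + size w)%N.

Lemma weight_bounded N s w : (weight w <= N)%N -> (N <= s)%N ->
  w \in bounded_words N s.
Proof.
rewrite mem_bounded_words => hw hs; apply/andP; split.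
  by apply: leq_trans hs; apply: leq_trans hw; rewrite leq_addl.
elim: w N hw {hs} => //= l w IH N; rewrite /weight /= => hw.
by apply/andP; split; [lia | apply: IH; rewrite /weight; lia].
Qed.

Section Stuffle.
Variable K : fieldType.
Notation Y := (ncseries nat K).
Notation YY := (ncseries nat (ncseries nat K)).
Implicit Types (f g : Y) (F : YY) (u v w : seq nat) (a b l : nat).

Definition stletter (m : nat) : YY :=
  \sum_(i < m.+2) tens (yser K i) (yser K (m.+1 - i)).

Definition stw w : YY := \prod_(l <- w) stletter l.

Lemma coefCM2 (g : Y) F u : ((coefC g : YY) * F) u = g * F u.
Proof. exact: coefCM. Qed.

Lemma stletterE l F u v :
  (stletter l * F) u v =
    ((coefC (monom K [:: l]) : YY) * F) u v
  + (monom Y [:: l] * F) u v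
  + \sum_(i < l) (monom Y [:: i : nat] * ((coefC (monom K [:: l.-1 - i]%N) : YY) * F)) u v.
Proof.
rewrite /stletter big_ord_recl big_ord_recr /= tens1l.
rewrite (_ : l.+1 - bump 0 l = 0)%N ?tens_letter /=; last by rewrite /bump add1n subnn.
rewrite [coefC 1]coefC1 mulr1 add0n mulrDl mulrDl [X in _ + X]addrC addrA.
rewrite !ncD; congr (_ + _).
rewrite mulr_suml !nc_sum; apply: eq_bigr => i _.
rewrite /bump add1n subSS.
case: l i => [|l] i; first by case: i.
have hi : (i <= l)%N by rewrite -ltnS.
by rewrite subSn //= tens_letter mulrA.
Qed.

Lemma stw_cons l w : stw (l :: w) = stletter l * stw w.
Proof. exact: big_cons. Qed.

Lemma stletter_nn l F : (stletter l * F) [::] [::] = 0.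
Proof.
rewrite stletterE coefCM2 letM_nil letM_nil nc0 add0r big1 ?addr0 // => i _.
by rewrite letM_nil.
Qed.

Lemma stletter_nc l F b v :
  (stletter l * F) [::] (b :: v) = if b == l then F [::] v else 0.
Proof.
rewrite stletterE coefCM2 letM_nil letM_cons nc0 addr0 big1 ?addr0 // => i _.
by rewrite letM_nil.
Qed.

Lemma stletter_cn l F a u :
  (stletter l * F) (a :: u) [::] = if a == l then F u [::] else 0.
Proof.
rewrite stletterE coefCM2 letM_nil letM_cons add0r big1 ?addr0 // => [|i _].
  by case: eqP.
by rewrite letM_cons; case: eqP => //; rewrite coefCM2 letM_nil.
Qed.

(** The quasi-shuffle recursion: y_(a+1) and y_(b+1) contract to y_(a+b+2), whose code is
    [(a + b).+1]. *)
Lemma stletter_cc l F a u b v :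
  (stletter l * F) (a :: u) (b :: v) =
    (if a == l then F u (b :: v) else 0)
  + (if b == l then F (a :: u) v else 0)
  + (if (a + b).+1 == l then F u v else 0).
Proof.
rewrite stletterE coefCM2 !letM_cons [X in X + _]addrC; congr (_ + _ + _).
  by case: eqP.
under eq_bigr => i _.
  rewrite letM_cons.
  rewrite (_ : (if a == i then _ else 0) (b :: v) =
     if a == i then if b == (l.-1 - i)%N then F u v else 0 else 0); last first.
    by case: eqP => //; rewrite coefCM2 letM_cons.
  over.
have [la|al] := leqP l a.
  rewrite big1 => [|i _].
    case: eqP => // E; move: la; rewrite -E => la.
    by move: (leq_trans la (leq_addr b a)); rewrite ltnn.
  by case: eqP => // E; move: la; rewrite E leqNgt ltn_ord.
rewrite (bigD1 (Ordinal al)) //= eqxx big1 ?addr0 => [|i ni]; last first.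
  by case: eqP => // E; move: ni; rewrite -val_eqE /= E eqxx.
congr (if _ then _ else _); case: l al => // l al; rewrite eqSS /=.
by apply/eqP/eqP => [->|<-]; [rewrite subnKC | rewrite addKn].
Qed.

Lemma stw_weight w u v : weight w <> (weight u + weight v)%N -> stw w u v = 0.
Proof.
elim: w u v => [|l w IH] u v.
  rewrite /stw big_nil nc1; case: u => [|a u] //.
  by rewrite eqxx mulr1n nc1; case: v.
rewrite stw_cons; case: u v => [|a u] [|b v].
- by rewrite stletter_nn.
- rewrite stletter_nc; case: eqP => [->|] // h; apply: IH => E; apply: h.
  by move: E; rewrite /weight /=; lia.
- rewrite stletter_cn; case: eqP => [->|] // h; apply: IH => E; apply: h.
  by move: E; rewrite /weight /=; lia.
- rewrite stletter_cc => h.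
  case: eqP => [E|_]; case: eqP => [E'|_]; case: eqP => [E''|_];
  rewrite ?add0r ?addr0 // ?IH ?addr0 // => E0; apply: h;
  by move: E0; subst; rewrite /weight /=; lia.
Qed.

Lemma DeltastE f u v N s : (weight u + weight v <= N)%N -> (N <= s)%N ->
  Deltast f u v = \sum_(w <- bounded_words N s) f w * stw w u v.
Proof.
move=> hN hs; apply: coproductE; first exact: uniq_bounded_words.
move=> w hw; apply: stw_weight => E; move/negP: hw; apply.
by apply: weight_bounded hs; rewrite E.
Qed.

Lemma DeltastE_cons f u v N s : (u != [::]) || (v != [::]) ->
    (weight u + weight v <= N)%N -> (N <= s)%N ->
  Deltast f u v = \sum_(l <- iota 0 N) \sum_(w <- bounded_words N s)
    f (l :: w) * (stletter l * stw w) u v.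
Proof.
move=> huv hN hs; rewrite (DeltastE f hN (leqW hs)) /= big_cons big_allpairs_dep.
rewrite [X in _ * X](_ : _ = 0) ?mulr0 ?add0r.
  by apply: eq_bigr => l _; apply: eq_bigr => w _; rewrite stw_cons.
apply: stw_weight => E; move/negP: huv; apply.
by move: u v E {hN} => [|a u] [|b v]; rewrite /weight /=; lia.
Qed.

Lemma Deltast_lder f u v a N s : (a < N)%N ->
    (weight u + weight v <= N)%N -> (N <= s)%N ->
  \sum_(l <- iota 0 N) \sum_(w <- bounded_words N s)
    f (l :: w) * (if a == l then stw w u v else 0) = Deltast (lder a f) u v.
Proof.
move=> aN hN hs; rewrite (bigD1_seq a) ?iota_uniq ?mem_iota //=.
rewrite [X in _ + X]big1 ?addr0 => [|l /negbTE nl]; last first.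
  by rewrite big1 // => w _; rewrite eq_sym nl mulr0.
by rewrite (DeltastE _ hN hs); apply: eq_bigr => w _; rewrite eqxx.
Qed.

Lemma Deltast_nn f : Deltast f [::] [::] = f [::].
Proof.
rewrite (@DeltastE _ _ _ 0 0) //= big_seq1 /stw big_nil !nc1 eqxx.
by rewrite mulr1n nc1 mulr1.
Qed.

Lemma Deltast_nl f v : Deltast f [::] v = f v.
Proof.
elim: v f => [|b v IH] f; first exact: Deltast_nn.
rewrite (@DeltastE_cons f _ _ (weight (b :: v)) (weight (b :: v))) //.
under eq_bigr do under eq_bigr do rewrite stletter_nc.
by rewrite Deltast_lder ?IH // /weight /=; lia.
Qed.

Lemma Deltast_ln f u : Deltast f u [::] = f u.
Proof.
elim: u f => [|b u IH] f; first exact: Deltast_nn.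
rewrite (@DeltastE_cons f _ _ (weight (b :: u)) (weight (b :: u))) ?addn0 //.
under eq_bigr do under eq_bigr do rewrite stletter_cn.
by rewrite Deltast_lder ?IH // /weight /=; lia.
Qed.

(** Together with [Deltast_nl] and [Deltast_ln] this determines the coproduct by recursion on the
    two words, without infinite sums. *)
Lemma Deltast_cc f a u b v :
  Deltast f (a :: u) (b :: v) =
    Deltast (lder a f) u (b :: v) + Deltast (lder b f) (a :: u) v
  + Deltast (lder (a + b).+1 f) u v.
Proof.
pose N := (weight (a :: u) + weight (b :: v))%N.
rewrite (@DeltastE_cons f _ _ N N) //.
under eq_bigr do under eq_bigr do rewrite stletter_cc !mulrDr.
under eq_bigr do rewrite !big_split /=.
by rewrite !big_split /= !Deltast_lder // /N /weight /=; lia.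
Qed.

Lemma DeltastD f g u v : Deltast (f + g) u v = Deltast f u v + Deltast g u v.
Proof.
pose N := (weight u + weight v)%N.
rewrite !(@DeltastE _ _ _ N N) // -big_split; apply: eq_bigr => w _.
by rewrite ncD mulrDl.
Qed.

Lemma DeltastZ (c : K) f u v : Deltast ((coefC c : Y) * f) u v = c * Deltast f u v.
Proof.
pose N := (weight u + weight v)%N.
rewrite !(@DeltastE _ _ _ N N) // mulr_sumr; apply: eq_bigr => w _.
by rewrite coefCM mulrA.
Qed.

(* The splittings of (a :: u, b :: v) are sorted according to the letter that
   the stuffle of the two first factors starts with. *)
Lemma DeltastM f g : Deltast (f * g) = Deltast f * Deltast g.
Proof.
apply: ncP => u; apply: ncP => v.
elim: u v f g => [|a u IHu] v f g.
  by rewrite Deltast_nl ncM_nil; apply: ncM_agree => w _; rewrite Deltast_nl.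
elim: v f g => [|b v IHv] f g.
  rewrite Deltast_ln [RHS](_ : _ = \sum_(i < (size (a :: u)).+1)
    Deltast f (take i (a :: u)) [::] * Deltast g (drop i (a :: u)) [::]).
    by apply: eq_bigr => i _; rewrite !Deltast_ln.
  by rewrite ncE nc_sum; apply: eq_bigr => i _; rewrite ncM_nil.
have fg0 c h : Deltast (lder c (f * g)) h =
  (coefC (f [::]) : Y) * Deltast (lder c g) h + Deltast (lder c f * g) h.
  by apply: ncP => w; rewrite lderM DeltastD DeltastZ ncD coefCM.
rewrite Deltast_cc !fg0 !ncD !coefCM !IHu IHv.
have Fn (h : Y) : Deltast h [::] = h by apply/funext => w; exact: Deltast_nl.
have E1 : (lder a (Deltast f) * Deltast g) u (b :: v) =
    (Deltast (lder a f) * Deltast g) u (b :: v)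
  + (lder a (Deltast (lder b f)) * Deltast g) u v
  + (Deltast (lder (a + b).+1 f) * Deltast g) u v.
  rewrite !(ncE (_ : YY)) !nc_sum -!big_split; apply: eq_bigr => i _ /=.
  rewrite !ncM_cons /lder Deltast_ln Deltast_ln -!addrA; congr (_ + _).
  set G := Deltast g _; rewrite -!ncD -!mulrDl.
  apply: ncM_agree => // w _.
  by rewrite !ncD Deltast_cc addrA.
rewrite [in RHS]ncM_cons ncD E1 Fn [X in _ = X + _]ncM_cons Deltast_cc.
rewrite (ncM_cons (Deltast (lder b f)) (Deltast g) a u) Fn !ncD !mulrDr.
move: (f [::] * _) (f [::] * _) (f [::] * _) => x y z.

ring.
Qed.

End Stuffle.

Section DoubleSeries.
Variables (T T' : choiceType) (R : nzRingType).
Implicit Types F G : ncseries T (ncseries T' R).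

Lemma ncM2E F G u v :
  (F * G) u v = \sum_(i < (size u).+1) (F (take i u) * G (drop i u)) v.
Proof. exact: nc_sum. Qed.

Lemma ncM2_nil F G u :
  (F * G) u [::] = (((fun u => F u [::]) : ncseries T R) * ((fun u => G u [::]) : ncseries T R)) u.
Proof. by rewrite ncM2E; apply: eq_bigr => i _; rewrite ncM_nil. Qed.

Definition swap F : ncseries T' (ncseries T R) := fun u v => F v u.

End DoubleSeries.

Lemma swapM (T T' : choiceType) (R : nzRingType) (F G : ncseries T (ncseries T' R)) :
  swap (F * G) = swap F * swap G.
Proof.
apply: ncP => u; apply: ncP => v; rewrite {1}/swap !ncM2E.
under eq_bigr do rewrite ncE.
by rewrite exchange_big; apply: eq_bigr => j _; rewrite ncE.
Qed.

(** * Group-likeness up to a twist in powers of y_1 *)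

Section GroupLike.
Variable K : fieldType.
Notation Y := (ncseries nat K).
Notation YY := (ncseries nat (ncseries nat K)).
Implicit Types (f g : Y) (F : YY) (u v w : seq nat) (a b l : nat).

(** The transpose of stuffle multiplication by y_1. *)
Definition stuffle_y1 f : Y := fun u => Deltast f u [:: 0%N].

Lemma stuffle_y1_nil f : stuffle_y1 f [::] = f [:: 0%N].
Proof. exact: Deltast_nl. Qed.

Lemma stuffle_y1_cons f a u : stuffle_y1 f (a :: u) =
  stuffle_y1 (lder a f) u + f (0%N :: a :: u) + f (a.+1 :: u).
Proof. by rewrite /stuffle_y1 Deltast_cc !Deltast_ln addn0. Qed.

Lemma stuffle_y1D f g u : stuffle_y1 (f + g) u = stuffle_y1 f u + stuffle_y1 g u.
Proof. exact: DeltastD. Qed.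

(** Coassociativity with y_1 as third factor: both sides pair [f] with the stuffle of [u], [v] and
    y_1. *)
Lemma Deltast_stuffle_y1 f u v :
  Deltast (stuffle_y1 f) u v = stuffle_y1 (Deltast f u) v.
Proof.
have Fn (h : Y) : Deltast h [::] = h by apply/funext => w; exact: Deltast_nl.
elim: u v f => [|a u IHu] v f; first by rewrite !Fn.
elim: v f => [|b v IHv] f; first by rewrite Deltast_ln stuffle_y1_nil.
have E c : lder c (stuffle_y1 f) =
    stuffle_y1 (lder c f) + lder c (lder 0%N f) + lder c.+1 f.
  by apply: ncP => w; rewrite /lder stuffle_y1_cons !ncD.
rewrite Deltast_cc !E !DeltastD !IHu IHv (stuffle_y1_cons (Deltast f (a :: u))).
have -> : lder b (Deltast f (a :: u)) = lder b (Deltast (lder a f) u)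
    + Deltast (lder b f) (a :: u) + Deltast (lder (a + b).+1 f) u.
  by apply: ncP => w; rewrite {1}/lder Deltast_cc !ncD.
rewrite !stuffle_y1D (stuffle_y1_cons (Deltast (lder a f) u)).
rewrite (Deltast_cc f a u 0%N) (Deltast_cc f a u b.+1) (Deltast_cc (lder 0%N f)).
rewrite addn0 addnS; ring.
Qed.

Fixpoint insert_letter f n i : K :=
  if i is i'.+1 then f (n :: nseq i 0%N) + insert_letter (lder 0%N f) n i'
  else f [:: n].

Lemma insert_letterE f n i :
  insert_letter f n i = \sum_(j < i.+1) f (nseq j 0%N ++ n :: nseq (i - j) 0%N).
Proof.
elim: i f => [|i IH] f /=; first by rewrite big_ord1.
by rewrite big_ord_recl IH.
Qed.

Lemma insert_letter0 f i : insert_letter f 0 i = i.+1%:R * f (nseq i.+1 0%N).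
Proof.
elim: i f => [|i IH] f /=; first by rewrite mul1r.
by rewrite IH /lder /= -[in RHS]natr1 mulrDl mul1r addrC.
Qed.

(** In the stuffle of y_1^(i+1) with y_(n+1), the letter is either inserted or contracted with one
    of the y_1. *)
Lemma Deltast_y1_letter f n i : Deltast f (nseq i.+1 0%N) [:: n] =
  insert_letter f n i.+1 + insert_letter f n.+1 i.
Proof.
elim: i f => [|i IH] f.
  rewrite Deltast_cc !Deltast_ln Deltast_nl add0n /= /lder; ring.
rewrite [nseq _ _]/= Deltast_cc IH !Deltast_ln add0n /= /lder; ring.
Qed.

Section TwistedGroupLike.
Variables (U : YY) (g : Y).
Hypothesis U_y1 : forall u v,
  (u != nseq (size u) 0%N) || (v != nseq (size v) 0%N) -> U u v = 0.
Hypothesis g1 : g [::] = 1.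
Hypothesis Ug : U * Deltast g = tens g g.
Hypothesis newton : forall i, i.+1%:R * g (nseq i.+1 0%N) =
  \sum_(k < i.+1) (-1) ^+ k * g (nseq (i - k) 0%N) * g [:: k : nat].
Hypothesis charK : forall n, n.+1%:R != 0 :> K.

(** Applying the counit to the second factor of [Ug] leaves a series that fixes the invertible
    [g]. *)
Lemma twist_nil u : U u [::] = (u == [::])%:R.
Proof.
suff E : ((fun u => U u [::]) : Y) = 1 by rewrite -nc1 -E.
apply: (@ncmulIr _ _ g) => //; rewrite mul1r; apply: ncP => w.
have := congr1 (fun F : YY => F w [::]) Ug.
rewrite /tens g1 mulr1 => <-; rewrite ncM2_nil; apply: ncM_agree => // v _.
by rewrite Deltast_ln.
Qed.

(** Among the prefixes of [v] at which [U] is evaluated, only the empty one and [v] itself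
    survive. *)
Lemma twist_split u v : v != [::] ->
    (forall u' j, (0 < j < size v)%N -> U u' (take j v) = 0) ->
  Deltast g u v + (((fun u => U u v) : Y) * g) u = g u * g v.
Proof.
move=> vn hv; have := congr1 (fun F : YY => F u v) Ug; rewrite /tens => <-.
rewrite ncM2E.
have E i : (U (take i u) * Deltast g (drop i u)) v =
    U (take i u) [::] * Deltast g (drop i u) v + U (take i u) v * g (drop i u).
  rewrite ncE big_ord_recl take0 drop0; congr (_ + _).
  case: v vn hv => // b v _ hv.
  rewrite big_ord_recr big1 /= ?add0r => [|j _].
    by rewrite take_size drop_size Deltast_ln.
  by rewrite -[b :: _]/(take j.+1 (b :: v)) hv ?mul0r //= ltnS ltn_ord.
under eq_bigr do rewrite E.
rewrite big_split /=; congr (_ + _).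
rewrite big_ord_recl take0 drop0 twist_nil mul1r big1 ?addr0 // => i _.
by rewrite twist_nil -size_eq0 size_takel ?mul0r // lift0 ltn_ord.
Qed.

Lemma twist_ok u v : (forall u' j, (0 < j <= size v)%N -> U u' (take j v) = 0) ->
  Deltast g u v = g u * g v.
Proof.
case: v => [|b v] hv; first by rewrite Deltast_ln g1 mulr1.
rewrite -twist_split // => [|u' j /andP[j0 js]]; last by rewrite hv // j0 ltnW.
rewrite ncE big1 ?addr0 // => i _.
have := hv (take i u) (size (b :: v)).
by rewrite take_size => -> //=; rewrite ?mul0r ?leqnn.
Qed.

(** By [twist_split], multiplicativity at (y_1^i, y_1^m) makes the product of U(-, y_1^m) with [g]
    vanish on powers of y_1. As [g] has constant term 1, induction on the length removes it. *)
Lemma twist_zero m u : (forall u' j, (0 < j < m)%N -> U u' (nseq j 0%N) = 0) ->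
    (forall i, Deltast g (nseq i 0%N) (nseq m 0%N) =
               g (nseq i 0%N) * g (nseq m 0%N)) ->
  (0 < m)%N -> U u (nseq m 0%N) = 0.
Proof.
move=> hU hD m0; have [Eu|] := eqVneq u (nseq (size u) 0%N); last first.
  by move=> hu; rewrite U_y1 ?hu.
rewrite Eu; elim/ltn_ind: (size u) => {u Eu} i IH.
have := @twist_split (nseq i 0%N) (nseq m 0%N).
rewrite hD size_nseq => h; have {h} : (((fun u => U u (nseq m 0%N)) : Y) * g) (nseq i 0%N) = 0.
  apply: (addrI (g (nseq i 0%N) * g (nseq m 0%N))); rewrite addr0; apply: h.
    by case: (m) m0.
  move=> u' j /andP[j0 jm]; rewrite take_nseq ?(ltnW jm) // hU ?j0 //.
rewrite ncM_small ?g1 ?mulr1 // => v; rewrite size_nseq => vi.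
have [->|hv] := eqVneq v (nseq (size v) 0%N); first exact: IH.
by rewrite U_y1 ?hv.
Qed.

Lemma twist_letter u n : Deltast g u [:: n.+1] = g u * g [:: n.+1].
Proof.
by apply: twist_ok => u' [|j] //= _; rewrite U_y1 ?orbT.
Qed.

(** No prefix of a letter y_m with m >= 2 meets the support of [U], so [g] is multiplicative at
    (y_1^(i+1), y_m). This trades an inserted y_m for an inserted y_(m+1) among fewer y_1; iteration
    gives the alternating sum. *)
Lemma insert_letter_newton n i : insert_letter g n.+1 i =
  \sum_(k < i.+1) (-1) ^+ k * g (nseq (i - k) 0%N) * g [:: (n.+1 + k)%N].
Proof.
elim: i n => [|i IH] n /=.
  by rewrite big_ord1 /= g1 expr0 !mul1r addn0.
have /eqP := twist_letter (nseq i.+1 0%N) n.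
rewrite Deltast_y1_letter -subr_eq0 -addrA addr_eq0 => /eqP.
rewrite [insert_letter g n.+1 i.+1]/= => ->.
rewrite IH [in RHS]big_ord_recl /= expr0 mul1r addn0 opprB; congr (_ + _).
rewrite -sumrN; apply: eq_bigr => k _.
by rewrite /bump add1n subSS exprS addSnnS !mulN1r !mulNr.
Qed.

(** The stuffle of y_1^(i+1) and y_1 is (i+2) y_1^(i+2) plus the words with one y_2. The latter are
    known from [insert_letter_newton], so multiplicativity here amounts to [newton]. *)
Lemma twist_y1 u : U u [:: 0%N] = 0.
Proof.
apply: (@twist_zero 1) => // [u' [|j]//|[|i]].
  by rewrite Deltast_nl g1 mul1r.
rewrite Deltast_y1_letter insert_letter0 newton insert_letter_newton.
rewrite big_ord_recl /= expr0 mul1r -addrA -big_split /= big1 ?addr0 // => k _.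
by rewrite /bump add1n subSS exprS mulN1r !mulNr addNr.
Qed.

Lemma stuffle_y1_twist : stuffle_y1 g = (coefC (g [:: 0%N]) : Y) * g.
Proof.
apply: ncP => u; rewrite coefCM mulrC; apply: twist_ok => u' [|[|j]] //= _.
exact: twist_y1.
Qed.

(** Induction on the power of y_1. The stuffle of y_1^(m+1) and y_1 expresses (m+2) y_1^(m+2)
    through words on which multiplicativity is already known; coassociativity carries this over to
    [Deltast g], and characteristic 0 allows division by m+2. *)
Lemma twist_y1_words m u : (0 < m)%N -> U u (nseq m 0%N) = 0.
Proof.
elim/ltn_ind: m u => [[|[|m]]] // IH u _; first exact: twist_y1.
have ok u' v : (forall j, (0 < j <= size v)%N -> take j v = nseq j 0%N -> (j < m.+2)%N) ->
    Deltast g u' v = g u' * g v.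
  move=> hv; apply: twist_ok => w j /andP[j0 js].
  have sj : size (take j v) = j by rewrite size_takel.
  have [E|hn] := eqVneq (take j v) (nseq (size (take j v)) 0%N); last first.
    by rewrite U_y1 ?hn ?orbT.
  rewrite sj in E; rewrite E IH //; apply: hv => //; exact/andP.
apply: twist_zero => // [u' j /andP[j0 jm]|i]; first exact: IH.
(* Besides y_1^(m+2) only the words y_1^k y_2 y_1^(m-k) occur. Their prefixes that are powers of y_1
   have length at most k <= m, within reach of the induction. *)
have key (h : Y) (c : K) : (forall v, (forall j, (0 < j <= size v)%N ->
      take j v = nseq j 0%N -> (j < m.+2)%N) -> h v = c * g v) ->
    stuffle_y1 h (nseq m.+1 0%N) = m.+2%:R * h (nseq m.+2 0%N) + c * insert_letter g 1 m.
  move=> hh; rewrite /stuffle_y1 Deltast_y1_letter insert_letter0; congr (_ + _).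
  rewrite !insert_letterE mulr_sumr; apply: eq_bigr => k _; apply: hh => j _ E.
  have hk : (k <= m)%N by rewrite -ltnS.
  rewrite ltnNge; apply/negP => hj; have := congr1 (fun w => nth 0%N w k) E.
  rewrite nth_take ?nth_cat ?size_nseq ?ltnn ?subnn /=; last by lia.
  by rewrite nth_nseq; case: ifP.
have E1 := key (Deltast g (nseq i 0%N)) (g (nseq i 0%N)) (ok _).
have E2 := key g 1 (fun v _ => esym (mul1r _)).
rewrite -Deltast_stuffle_y1 stuffle_y1_twist DeltastZ ok in E1; last first.
  by move=> j; rewrite size_nseq => /andP[].
rewrite stuffle_y1_twist coefCM mul1r in E2.
apply: (mulfI (charK m.+1)); apply: (addIr (g (nseq i 0%N) * insert_letter g 1 m)).
by rewrite -E1 mulrCA E2; ring.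
Qed.

Lemma Deltast_twist : Deltast g = tens g g.
Proof.
apply: ncP => u; apply: ncP => v; apply: twist_ok => u' j /andP[j0 jv].
have [->|hn] := eqVneq (take j v) (nseq (size (take j v)) 0%N); last first.
  by rewrite U_y1 ?hn ?orbT.
by apply: twist_y1_words; rewrite size_takel.
Qed.

End TwistedGroupLike.

(* Commuting with y_1 (x) 1 + 1 (x) y_1 at (y_1 u, v) expresses U u v through
   values at pairs with fewer trailing y_1 or with a shorter v. *)
Lemma centralizer_y1_l (U : YY) :
    (monom Y [:: 0%N] + coefC (monom K [:: 0%N])) * U =
    U * (monom Y [:: 0%N] + coefC (monom K [:: 0%N])) ->
  forall u v, u != nseq (size u) 0%N -> U u v = 0.
Proof.
move=> hU.
have step u v : U u v = (U * monom Y [:: 0%N]) (0%N :: u) v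
    + (U (0%N :: u) * monom K [:: 0%N]) v - (monom K [:: 0%N] * U (0%N :: u)) v.
  have := congr1 (fun F : YY => F (0%N :: u) v) hU.
  rewrite mulrDl mulrDr !ncD letM_cons eqxx coefCM McoefC => <-.
  by rewrite addrK.
pose trail (u : seq nat) := find (fun l => l != 0%N) (rev u).
have trr w : trail (rcons w 0%N) = (trail w).+1 by rewrite /trail rev_rcons.
suff H n u v : u != nseq (size u) 0%N -> (trail u + size v <= n)%N -> U u v = 0.
  by move=> u v hu; exact: (H (trail u + size v)%N).
elim/ltn_ind: n u v => n IH u v hu hn.
have hu0 : 0%N :: u != nseq (size (0%N :: u)) 0%N by [].
have hasu : has (fun l => l != 0%N) (rev u).
  rewrite has_rev; apply/negPn/negP; rewrite -all_predC => h; move/negP: hu; apply.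
  by apply/eqP; apply/all_pred1P; apply: sub_all h => l /=; rewrite negbK.
have tr0 : trail (0%N :: u) = trail u by rewrite /trail rev_cons -cats1 find_cat hasu.
have small v' : (size v' < size v)%N -> U (0%N :: u) v' = 0.
  by move=> hv'; apply: (IH (trail (0%N :: u) + size v')%N) => //; rewrite tr0; lia.
rewrite step [X in _ + X - _](_ : _ = 0) ?addr0; last first.
  case/lastP: v hn small => [|v b] hn small; first by rewrite Mlet_nil.
  by rewrite Mlet_rcons; case: eqP => // _; rewrite small ?size_rcons.
rewrite [X in _ - X](_ : _ = 0) ?subr0; last first.
  case: v hn small => [|b v] hn small; first by rewrite letM_nil.
  by rewrite letM_cons; case: eqP => // _; rewrite small.
case/lastP: u hu hu0 hasu tr0 hn {small step} => [|u b] hu hu0 hasu tr0 hn //.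
rewrite -rcons_cons Mlet_rcons; case: eqP => // b0.
apply: (IH (trail (0%N :: u) + size v)%N) => //.
  by move: tr0 hn; rewrite b0 -rcons_cons !trr; lia.
apply/negP => /eqP E; move/negP: hu0; apply; rewrite b0 -rcons_cons E.
by rewrite size_rcons size_nseq -!cats1 -[[:: 0%N]]/(nseq 1 0%N) -nseqD addn1.
Qed.

Lemma centralizer_y1_r (U : YY) :
    (monom Y [:: 0%N] + coefC (monom K [:: 0%N])) * U =
    U * (monom Y [:: 0%N] + coefC (monom K [:: 0%N])) ->
  forall u v, v != nseq (size v) 0%N -> U u v = 0.
Proof.
pose m := monom K [:: 0%N].
have sm : swap (coefC m : YY) = monom Y [:: 0%N].
  apply: ncP => u; apply: ncP => v; rewrite /swap /coefC /m.
  have E1 (b : bool) : ((monom K [:: 0%N] *+ b) u = (b && (u == [:: 0%N]))%:R) by case: b.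
  have E2 (b : bool) : (b%:R : Y) v = ((v == [::]) && b)%:R.
    by case: b; rewrite ?andbT ?andbF ?mulr1n.
  by rewrite E1 -E2.
have sm' : swap (monom Y [:: 0%N]) = (coefC m : YY).
  by rewrite -sm; apply: ncP => u; apply: ncP => v.
move=> /(congr1 (@swap _ _ _)); rewrite !swapM.
have -> : swap (monom Y [:: 0%N] + coefC m) = monom Y [:: 0%N] + coefC m.
  by rewrite -[LHS]/(swap (monom Y [:: 0%N]) + swap (coefC m)) sm sm' addrC.
by move=> /centralizer_y1_l h u v; exact: h.
Qed.

End GroupLike.

(** * p-adic absolute values *)

Section Padic.
Variables (p : nat) (K : fieldType) (abs : K -> rat).
Hypothesis p_pr : prime p.
Hypothesis hK : is_padic_field p abs.
Implicit Types (x y : K) (s t : nat -> K) (e M : rat).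

Let p_gt0 : (0 < p)%N. Proof. exact: prime_gt0. Qed.
Let p_gt1 : (1 < p)%N. Proof. exact: prime_gt1. Qed.
Let abs_ge0 x : 0 <= abs x. Proof. exact: padic_ge0 hK x. Qed.
Let absM x y : abs (x * y) = abs x * abs y. Proof. exact: padicM hK x y. Qed.

Lemma abs0 : abs 0 = 0.
Proof. exact/(padic_eq0 hK). Qed.

Lemma abs_eq0 x : (abs x == 0) = (x == 0).
Proof. by apply/eqP/eqP => /(padic_eq0 hK). Qed.

Lemma abs1 : abs 1 = 1.
Proof.
have : abs 1 * abs 1 = abs 1 * 1 by rewrite -absM !mulr1.
by apply: mulfI; rewrite abs_eq0 oner_eq0.
Qed.

Lemma absN1 : abs (-1) = 1.
Proof.
have : abs (-1) ^+ 2 == 1 by rewrite expr2 -absM mulN1r opprK abs1.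
by rewrite sqrf_eq1 => /orP[/eqP //|/eqP E]; have := abs_ge0 (-1); rewrite E.
Qed.

Lemma absN x : abs (- x) = abs x.
Proof. by rewrite -mulN1r absM absN1 mul1r. Qed.

Lemma absV x : abs x^-1 = (abs x)^-1.
Proof.
have [->|x0] := eqVneq x 0; first by rewrite invr0 abs0 invr0.
have ax : abs x != 0 by rewrite abs_eq0.
by apply: (mulfI ax); rewrite -absM !mulfV // abs1.
Qed.

Lemma absX x n : abs (x ^+ n) = abs x ^+ n.
Proof. by elim: n => [|n IH]; rewrite ?abs1 // !exprS absM IH. Qed.

Lemma absD_le x y M : abs x <= M -> abs y <= M -> abs (x + y) <= M.
Proof.
by move=> hx hy; apply: le_trans (padicD hK x y) _; rewrite ge_max hx.
Qed.

Lemma absB_le x y M : abs x <= M -> abs y <= M -> abs (x - y) <= M.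
Proof. by move=> hx hy; apply: absD_le; rewrite ?absN. Qed.

Lemma absD_lt x y M : abs x < M -> abs y < M -> abs (x + y) < M.
Proof.
by move=> hx hy; apply: le_lt_trans (padicD hK x y) _; rewrite gt_max hx.
Qed.

Lemma abs_sum_le I (r : seq I) (P : pred I) (F : I -> K) M : 0 <= M ->
  (forall i, P i -> abs (F i) <= M) -> abs (\sum_(i <- r | P i) F i) <= M.
Proof.
move=> M0 hF; elim/big_ind: _ => //; first by rewrite abs0.
by move=> x y; exact: absD_le.
Qed.

Lemma absD_dom x y : abs y < abs x -> abs (x + y) = abs x.
Proof.
move=> yx; apply/eqP; rewrite eq_le absD_le ?(ltW yx) //= leNgt; apply/negP => h.
suff : abs x < abs x by rewrite ltxx.
by rewrite -{1}[x](addrK y); apply: absD_lt => //; rewrite absN.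
Qed.

Lemma abs_nat_le1 n : abs n%:R <= 1.
Proof.
elim: n => [|n IH]; first by rewrite abs0.
by rewrite -natr1; apply: absD_le; rewrite ?abs1.
Qed.

Let pr_gt0 : 0 < p%:R :> rat. Proof. by rewrite ltr0n. Qed.
Let pr_gt1 : 1 < p%:R :> rat. Proof. by rewrite ltr1n. Qed.

(** By Bezout some multiple of [n] is 1 modulo p, hence of absolute value 1. *)
Lemma abs_coprime n : coprime p n -> abs n%:R = 1.
Proof.
move=> cpn; apply/eqP; rewrite eq_le abs_nat_le1 /=.
have n0 : (0 < n)%N by case: n cpn => //; rewrite /coprime gcdn0 => /eqP E; move: p_gt1; rewrite E.
have [u v E _] := egcdnP p n0.
have {}E : (u * n = v * p + 1)%N by rewrite E gcdnC (eqP cpn).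
have E1 : abs (u%:R * n%:R) = 1.
  rewrite -natrM E natrD addrC absD_dom abs1 // natrM absM (padic_p hK).
  apply: le_lt_trans (_ : p%:R^-1 < 1); last by rewrite invf_lt1.
  by rewrite ler_piMl ?abs_nat_le1 // invr_ge0 ltW.
by rewrite -E1 absM ler_piMl ?abs_nat_le1.
Qed.

Lemma abs_nat n : (0 < n)%N -> abs n%:R = (p%:R ^+ logn p n)^-1.
Proof.
move=> n0; have [m cpm E] := pfactor_coprime p_pr n0.
by rewrite {1}E natrM absM abs_coprime // mul1r natrX absX (padic_p hK) exprVn.
Qed.

Lemma natr_neq0 n : (0 < n)%N -> n%:R != 0 :> K.
Proof.
move=> n0; rewrite -abs_eq0 abs_nat // invr_eq0 expf_neq0 //.
by rewrite gt_eqF.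
Qed.

Lemma natS_neq0 n : n.+1%:R != 0 :> K. Proof. exact: natr_neq0. Qed.

(** The power of p dividing [n] is at most [n]. Crude, but it turns p-adic denominators into
    polynomial growth. *)
Lemma abs_natV_le n : (0 < n)%N -> abs n%:R^-1 <= n%:R.
Proof.
move=> n0; rewrite absV abs_nat // invrK -natrX ler_nat dvdn_leq //.
exact: pfactor_dvdnn.
Qed.

Lemma abs_pXV r : abs (p ^ r)%:R^-1 = p%:R ^+ r.
Proof. by rewrite absV natrX absX (padic_p hK) exprVn invrK. Qed.

Lemma abs_pX r : abs (p ^ r)%:R = p%:R ^- r.
Proof. by rewrite natrX absX (padic_p hK) exprVn. Qed.

Lemma pX_unbounded M : exists N, forall r, (N <= r)%N -> M < p%:R ^+ r.
Proof.
exists (Num.bound M) => r hr.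
have [M0|M0] := ltP M 0; first by apply: lt_trans M0 _; exact: exprn_gt0.
apply: lt_le_trans (archi_boundP M0) _; rewrite -natrX ler_nat.
by apply: leq_trans hr _; apply: ltnW; exact: ltn_expl.
Qed.

Lemma pXV_small e : 0 < e -> exists N, forall r, (N <= r)%N -> p%:R ^- r < e.
Proof.
move=> e0; have [N hN] := pX_unbounded e^-1; exists N => r /hN h.
by rewrite -[e]invrK ltf_pV2 // posrE ?invr_gt0 // exprn_gt0.
Qed.

Definition bounded s := exists M, forall n, abs (s n) <= M.

Lemma bounded_cst x : bounded (fun=> x).
Proof. by exists (abs x). Qed.

Lemma boundedD s t : bounded s -> bounded t -> bounded (fun n => s n + t n).
Proof.
move=> [M hM] [N hN]; exists (Num.max M N) => n.
by apply: absD_le; rewrite le_max ?hM ?hN ?orbT.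
Qed.

Lemma boundedN s : bounded s -> bounded (fun n => - s n).
Proof. by move=> [M hM]; exists M => n; rewrite absN. Qed.

Lemma boundedM s t : bounded s -> bounded t -> bounded (fun n => s n * t n).
Proof. by move=> [M hM] [N hN]; exists (M * N) => n; rewrite absM ler_pM. Qed.

Lemma bounded_sum I (r : seq I) (P : pred I) (F : I -> nat -> K) :
  (forall i, P i -> bounded (F i)) -> bounded (fun n => \sum_(i <- r | P i) F i n).
Proof.
move=> hF; elim: r => [|i r [M hM]].
  by exists 0 => n; rewrite big_nil abs0.
have [Pi|nPi] := boolP (P i); last by exists M => n; rewrite big_cons (negbTE nPi).
have [N hN] := boundedD (hF i Pi) (ex_intro _ M hM).
by exists N => n; rewrite big_cons Pi.
Qed.

Lemma eq_bounded s t : s =1 t -> bounded s -> bounded t.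
Proof. by move=> E [M hM]; exists M => n; rewrite -E. Qed.

(** If q X + c is bounded at the points p^(-r), then q is of order p^(-r) in absolute value there,
    since these points have absolute value p^r. By induction q is constant, and then it is 0. *)
Lemma poly_bounded (q : {poly K}) :
  bounded (fun r => q.[(p ^ r)%:R^-1]) -> (size q <= 1)%N.
Proof.
elim/poly_ind: q => [|q c IH] [M hM]; first by rewrite size_poly0.
have [N hN] : exists N, forall r, abs q.[(p ^ r)%:R^-1] <= N / p%:R ^+ r.
  exists (Num.max M (abs c)) => r; rewrite ler_pdivlMr ?exprn_gt0 // -abs_pXV -absM.
  have -> : q.[(p ^ r)%:R^-1] * (p ^ r)%:R^-1 = (q * 'X + c%:P).[(p ^ r)%:R^-1] - c.
    by rewrite hornerMXaddC addrK.
  by apply: absB_le; rewrite le_max ?hM ?lexx ?orbT.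
have N0 : 0 <= N by have := hN 0%N; rewrite expr0 divr1; exact: le_trans.
have /size1_polyC E : (size q <= 1)%N.
  apply: IH; exists N => r; apply: le_trans (hN r) _.
  by rewrite ler_piMr // invf_le1 ?exprn_gt0 // exprn_ege1 // ltW.
suff -> : q = 0 by rewrite mul0r add0r size_polyC_leq1.
move: (q`_0) E => a E; rewrite E; suff -> : a = 0 by rewrite polyC0.
apply/eqP; rewrite -abs_eq0 eq_le abs_ge0 andbT leNgt; apply/negP => a0.
have [r /(_ r (leqnn r))] := pX_unbounded (N / abs a).
have := hN r; rewrite E hornerC ler_pdivlMr ?exprn_gt0 // => h1.
by rewrite ltr_pdivrMr // mulrC ltNge h1.
Qed.

(** Among 1, ..., n + p^r - 1 < 2 p^r the only multiple of p^r is p^r itself, so the term 1/p^r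
    strictly dominates. *)
Lemma harmonic_abs n r : (0 < n <= p ^ r)%N ->
  abs (\sum_(m < n + p ^ r - 1) m.+1%:R^-1) = p%:R ^+ r.
Proof.
move=> /andP[n0 nr]; have pr0 : (0 < p ^ r)%N by rewrite expn_gt0 p_gt0.
have hi : ((p ^ r).-1 < n + p ^ r - 1)%N by lia.
rewrite (bigD1 (Ordinal hi)) //= prednK // absD_dom abs_pXV //.
case: r nr pr0 hi => [|r] nr pr0 hi.
  rewrite expn0 in nr; rewrite big1 ?abs0 ?expr0 // => i /eqP ni; exfalso; apply: ni.
  apply: val_inj => /=; have : (i < n + p ^ 0 - 1)%N := ltn_ord i.
  by move: (nat_of_ord i) => j; rewrite expn0; lia.
apply: le_lt_trans (_ : p%:R ^+ r < _); last by rewrite ltr_eXn2l.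
apply: abs_sum_le => [|i ni]; first exact/exprn_ge0/ltW.
rewrite absV abs_nat // invrK ler_eXn2l // -ltnS ltnNge -pfactor_dvdn //.
apply/negP => /dvdnP[k E]; move/eqP: ni; apply; apply: val_inj => /=.
have aux (j P : nat) : (n <= P -> j < n + P - 1 -> j.+1 = k * P -> j = P.-1)%N.
  by case: k {E} => [|[|k]]; nia.
exact: aux nr (ltn_ord i) E.
Qed.

End Padic.

(** * Coproduct defect of a Frobenius recursion *)

Section DeltastUnit.
Variable K : fieldType.
Notation Y := (ncseries nat K).
Notation YY := (ncseries nat (ncseries nat K)).

Lemma Deltast0 : Deltast 0 = 0 :> YY.
Proof.
apply: ncP => u; apply: ncP => v.
have -> : (0 : Y) = coefC 0 * 0 by rewrite mulr0.
by rewrite DeltastZ mul0r.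
Qed.

Lemma Deltast1 : Deltast 1 = 1 :> YY.
Proof.
apply: ncP => -[|a u].
  by apply: ncP => v; rewrite Deltast_nl.
apply: ncP => -[|b v]; first by rewrite Deltast_ln.
have E c : lder c (1 : Y) = 0 by apply: ncP.
by rewrite Deltast_cc !E Deltast0 -[LHS]/(0 + 0 + 0 : K) !addr0.
Qed.

Lemma Deltast_y1 : Deltast (monom K [:: 0%N]) =
  monom Y [:: 0%N] + coefC (monom K [:: 0%N]).
Proof.
apply: ncP => -[|a u].
  by apply: ncP => v; rewrite Deltast_nl ncD coefC_nil add0r.
apply: ncP => -[|b v]; rewrite ncD /coefC /= addr0 /monom.
  by rewrite Deltast_ln; case: (_ == _).
have E c : lder c (monom K [:: 0%N]) = coefC (c == 0%N)%:R.
  by apply: ncP => w; rewrite /lder /monom /coefC eqseq_cons; case: (c == 0%N); rewrite /= ?mul0rn.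
have -> : ((a :: u == [:: 0%N])%:R : Y) (b :: v) = 0 by case: (_ == _).
rewrite Deltast_cc !E /= coefC0 Deltast0 nc0 addr0.
have E2 (c : bool) : Deltast (coefC c%:R : Y) = (coefC (coefC c%:R) : YY).
  by case: c; rewrite ?coefC1 ?Deltast1 // !coefC0 Deltast0.
by rewrite !E2 /coefC /= [X in _ + X](_ : _ = 0) // addr0; case: (u == [::]).
Qed.

End DeltastUnit.

Section BoundedSeries.
Variables (p : nat) (K : fieldType) (abs : K -> rat).
Hypothesis p_pr : prime p.
Hypothesis hK : is_padic_field p abs.
Notation bounded := (bounded abs).

Definition bounded_ncs (T : choiceType) (f : nat -> ncseries T K) :=
  forall u, bounded (fun n => f n u).

Lemma bounded_ncsM (T : choiceType) (f g : nat -> ncseries T K) :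
  bounded_ncs f -> bounded_ncs g -> bounded_ncs (fun n => f n * g n).
Proof.
move=> hf hg u; apply: (bounded_sum hK) => i _; exact: (boundedM hK).
Qed.

Lemma bounded_ncsV (T : choiceType) (f : nat -> ncseries T K) :
  bounded_ncs f -> bounded_ncs (fun n => ncinv (f n)).
Proof.
move=> hf u; apply: (bounded_sum hK) => i _.
move: (nat_of_ord i) => k; elim: k u {i} => [|k IH] v.
  by exists (abs ((v == [::])%:R)) => n; rewrite expr0.
apply: eq_bounded (bounded_ncsM _ IH v) => [n|]; first by rewrite exprS.
move=> w; apply: (boundedD hK); first exact: bounded_cst.
exact: (boundedN hK).
Qed.

Lemma bounded_Deltast (f : nat -> ncseries nat K) u v :
  bounded_ncs f -> bounded (fun n => Deltast (f n) u v).
Proof.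
move=> hf; pose N := (weight u + weight v)%N.
apply: eq_bounded (_ : bounded (fun n => \sum_(w <- bounded_words N N) f n w * stw K w u v)).
  by move=> n; rewrite (@DeltastE _ _ _ _ N N).
by apply: (bounded_sum hK) => w _; apply: (boundedM hK) => //; exact: bounded_cst.
Qed.

(* A rational expression in n all of whose poles are at 0, together with its
   expansion c0 + c1 / (p n) to first order. *)
Definition polar (s : nat -> K) (c0 c1 : K) := exists q : {poly K},
  [/\ q`_0 = c0, q`_1 = c1 & forall n, (0 < n)%N -> s n = q.[(p * n)%:R^-1]].

Lemma polar_cst c : polar (fun=> c) c 0.
Proof. by exists c%:P; split=> [||n _]; rewrite ?poly.coefC ?hornerC. Qed.

Lemma polarD s t a0 a1 b0 b1 : polar s a0 a1 -> polar t b0 b1 ->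
  polar (fun n => s n + t n) (a0 + b0) (a1 + b1).
Proof.
move=> [q [q0 q1 hq]] [r [r0 r1 hr]]; exists (q + r).
by split=> [||n n0]; rewrite ?coefD ?hornerD ?hq ?hr // ?q0 ?q1 ?r0 ?r1.
Qed.

Lemma polarM s t a0 a1 b0 b1 : polar s a0 a1 -> polar t b0 b1 ->
  polar (fun n => s n * t n) (a0 * b0) (a0 * b1 + a1 * b0).
Proof.
move=> [q [q0 q1 hq]] [r [r0 r1 hr]]; exists (q * r).
split=> [||n n0]; rewrite ?coefM ?hornerM ?hq ?hr //.
  by rewrite big_ord1 q0 r0.
by rewrite big_ord_recl big_ord1 /= q0 q1 r0 r1.
Qed.

Lemma polar_sum I (r : seq I) (P : pred I) (s : I -> nat -> K) (a0 a1 : I -> K) :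
    (forall i, P i -> polar (s i) (a0 i) (a1 i)) ->
  polar (fun n => \sum_(i <- r | P i) s i n)
    (\sum_(i <- r | P i) a0 i) (\sum_(i <- r | P i) a1 i).
Proof.
move=> hs; elim: r => [|i r IH].
  exists 0; rewrite !big_nil !coef0; split=> // n _.
  by rewrite big_nil horner0.
rewrite !big_cons; have [Pi|nPi] := boolP (P i); last first.
  by case: IH => q [? ? hq]; exists q; split=> // n n0; rewrite big_cons (negbTE nPi) hq.
case: (polarD (hs i Pi) IH) => q [? ? hq]; exists q; split=> // n n0.
by rewrite big_cons Pi hq.
Qed.

Lemma eq_polar s t a0 a1 : s =1 t -> polar s a0 a1 -> polar t a0 a1.
Proof. by move=> E [q [? ? hq]]; exists q; split=> // n n0; rewrite -E hq. Qed.

(** The increments of a bounded sequence are bounded, so [poly_bounded] makes the polynomial behind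
    [s] constant, and its constant term is 0. *)
Lemma polar_bounded s f c1 : polar s 0 c1 -> bounded f ->
    (forall n, f n.+1 - f n = s n.+1) ->
  c1 = 0 /\ (forall n, f n = f 0%N).
Proof.
move=> [q [q0 <- hq]] [M hM] hs.
have /size1_polyC E : (size q <= 1)%N.
  apply: (poly_bounded p_pr hK).
  (* 1/p^0 is not of the form 1/(p n), hence the separate bound for r = 0. *)
  exists (Num.max M (abs q.[1])) => -[|r].
    by rewrite expn0 invr1 le_max lexx orbT.
  rewrite expnS -hq ?expn_gt0 ?prime_gt0 //.
  rewrite -(prednK (_ : 0 < p ^ r)%N) ?expn_gt0 ?prime_gt0 // -hs.
  by apply: (absB_le hK) => //; rewrite le_max hM.
have q00 : q = 0 by rewrite E q0 polyC0.
split=> [|n]; first by rewrite q00 coef0.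
by elim: n => // n <-; apply/eqP; rewrite -subr_eq0 hs hq // q00 horner0.
Qed.

End BoundedSeries.

Section FrobeniusCoproduct.
Variables (p : nat) (K : fieldType) (abs : K -> rat).
Hypothesis p_pr : prime p.
Hypothesis hK : is_padic_field p abs.
Notation Y := (ncseries nat K).
Notation YY := (ncseries nat (ncseries nat K)).
Notation y1 := (monom K [:: 0%N]).
Variables (v b eta : nat -> Y) (phi : Y).
Hypothesis v_nil : forall n, v n [::] = 1.
Hypothesis v_bounded : bounded_ncs abs v.
Hypothesis b_polar : forall u, polar p (fun n => b n u) ((1 : Y) u) (y1 u).
Hypothesis b_nil : forall n, b n [::] = 1.
Hypothesis vb : forall n, v n.+1 * b n.+1 = eta n.+1 * v n.
Hypothesis eta_group : forall n, Deltast (eta n.+1) = tens (eta n.+1) (eta n.+1).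
Hypothesis v0_group : Deltast (v 0%N * phi) = tens (v 0%N * phi) (v 0%N * phi).

Let U n : YY := tens (ncinv (v n)) (ncinv (v n)) * Deltast (v n).

Lemma Deltast_v n : Deltast (v n) = tens (v n) (v n) * U n.
Proof. by rewrite /U mulrA tensM ncmulV // tens1 mul1r. Qed.

(** [b n.+1] is [v n.+1]^(-1) [eta n.+1] [v n], so the group-like [eta] cancels. *)
Lemma U_step n : U n.+1 * Deltast (b n.+1) = tens (b n.+1) (b n.+1) * U n.
Proof.
rewrite /U -mulrA -DeltastM vb DeltastM eta_group !mulrA !tensM; congr (tens _ _ * _).
  by rewrite -[LHS]mulr1 -(ncmulV (v_nil n)) mulrA -[X in X * _]mulrA -vb mulrA
     ncmulVf // mul1r.
by rewrite -[LHS]mulr1 -(ncmulV (v_nil n)) mulrA -[X in X * _]mulrA -vb mulrA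
     ncmulVf // mul1r.
Qed.

Lemma U_bounded u w : bounded abs (fun n => U n u w).
Proof.
apply: (eq_bounded (fun n => esym (ncM2E _ _ _ _))).
apply: (bounded_sum hK) => i _.
apply: (bounded_ncsM hK) => {}w; last exact: (bounded_Deltast hK).
by apply: (boundedM hK); apply: (bounded_ncsV hK).
Qed.

Lemma polar_2M (F G : nat -> YY) (F0 F1 G0 G1 : YY) :
    (forall u w, polar p (fun n => F n u w) (F0 u w) (F1 u w)) ->
    (forall u w, polar p (fun n => G n u w) (G0 u w) (G1 u w)) ->
  forall u w, polar p (fun n => (F n * G n) u w) ((F0 * G0) u w)
    ((F0 * G1 + F1 * G0) u w).
Proof.
move=> hF hG u w; rewrite !ncD !ncM2E -big_split /=.
apply: eq_polar (_ : polar p (fun n => \sum_(i < (size u).+1)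
   (F n (take i u) * G n (drop i u)) w) _ _) => [n|]; first by rewrite ncM2E.
apply: polar_sum => i _; rewrite !ncE -big_split /=.
apply: eq_polar (_ : polar p (fun n => \sum_(j < (size w).+1)
   F n (take i u) (take j w) * G n (drop i u) (drop j w)) _ _) => [n|]; first by [].
by apply: polar_sum => j _; exact: polarM.
Qed.

Lemma polar_Deltast u w :
  polar p (fun n => Deltast (b n) u w) ((1 : YY) u w) (Deltast y1 u w).
Proof.
pose N := (weight u + weight w)%N.
rewrite -Deltast1 !(@DeltastE _ _ _ _ N N) //.
apply: eq_polar (_ : polar p (fun n => \sum_(i <- bounded_words N N) b n i * stw K i u w) _ _).
  by move=> n; rewrite (@DeltastE _ _ _ _ N N).
apply: polar_sum => i _; have := polarM (b_polar i) (polar_cst p (stw K i u w)).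
by rewrite mulr0 add0r.
Qed.

(** Same first-order expansion as in [polar_Deltast], because y_1 is primitive. In the difference of
    the two sides of [U_step] this leaves a commutator. *)
Lemma polar_tens u w : polar p (fun n => tens (b n) (b n) u w) ((1 : YY) u w)
  (Deltast y1 u w).
Proof.
have := polarM (b_polar u) (b_polar w).
rewrite Deltast_y1 -tens1 ncD /tens.
have -> : (1 : Y) u * y1 w + y1 u * (1 : Y) w = (monom Y [:: 0%N] u + (coefC y1 : YY) u) w.
  rewrite ncD addrC !nc1 /coefC; congr (_ + _).
    by rewrite /monom; case: (u == _); rewrite ?mul1r ?mul0r ?mulr1n ?nc1.
  by case: (u == _); rewrite ?mul1r ?mul0r.
by [].
Qed.

Lemma ncM2_small (D F : YY) u w :
    (forall u' w', (size u' <= size u)%N -> (size w' <= size w)%N ->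
       (size u' + size w' < size u + size w)%N -> D u' w' = 0) ->
  (D * F) u w = D u w * F [::] [::] /\ (F * D) u w = F [::] [::] * D u w.
Proof.
move=> hD; split.
  rewrite ncM2E big_ord_recr /= take_size drop_size big1 ?add0r => [|i _].
    rewrite ncM_small // => w' hw'; apply: hD; rewrite // ?ltn_add2l //; exact: ltnW.
  have hi := ltn_ord i; rewrite ncE big1 // => j _; rewrite hD ?mul0r //= .
  - by rewrite size_take_min; lia.
  - by rewrite size_take_min; lia.
  - by rewrite !size_take_min; lia.
rewrite ncM2E big_ord_recl /= take0 drop0 big1 ?addr0 => [|i _].
  rewrite ncM_small_r // => w' hw'; apply: hD; rewrite // ?ltn_add2l //; exact: ltnW.
have hi := ltn_ord i; rewrite ncE big1 // => j _; rewrite hD ?mulr0 // !size_drop ?leq_subr //.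
by rewrite /bump /=; lia.
Qed.

(** Induction on the total length. Once [U] is constant in n on shorter pairs, [U_step] expresses
    its increment at (u, w) by [U 0] alone: the constant terms cancel and the coefficient of 1/(p n)
    is the commutator. Boundedness kills the whole increment, so both claims come out together. *)
Lemma U_const_comm u w :
  (forall n, U n u w = U 0%N u w) /\
  (Deltast y1 * U 0%N - U 0%N * Deltast y1) u w = 0.
Proof.
have [m] := ubnP (size u + size w); elim: m u w => // m IH u w hm.
have cst u' w' n : (size u' + size w' < size u + size w)%N -> U n u' w' = U 0%N u' w'.
  by move=> h; apply: (IH u' w' _).1; apply: leq_trans h _.
pose L n := (tens (b n) (b n) * U 0%N - U 0%N * Deltast (b n)) u w.
have L_polar : polar p L 0 ((Deltast y1 * U 0%N - U 0%N * Deltast y1) u w).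
  have P1 := @polar_2M (fun n => tens (b n) (b n)) (fun=> U 0%N) _ _ _ 0 polar_tens
    (fun u w => polar_cst p _) u w.
  have P2 := @polar_2M (fun=> U 0%N) (fun n => Deltast (b n)) _ 0 _ _
    (fun u w => polar_cst p _) polar_Deltast u w.
  have := polarD P1 (polarM (polar_cst p (-1)) P2).
  rewrite !mulN1r !mul0r !mulr0 mul1r mulr1 !addr0 !add0r subrr.
  by apply: eq_polar => n; rewrite mulN1r.
have step n : U n.+1 u w - U n u w = L n.+1.
  have D0 k u' w' : (size u' <= size u)%N -> (size w' <= size w)%N ->
      (size u' + size w' < size u + size w)%N -> (U k - U 0%N) u' w' = 0.
    by move=> _ _ h; rewrite !ncB cst // subrr.
  have E := congr1 (fun F : YY => F u w) (U_step n).
  have E1 : (U n.+1 * Deltast (b n.+1)) u w = (U 0%N * Deltast (b n.+1)) u w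
      + (U n.+1 u w - U 0%N u w).
    rewrite -{1}(subrK (U 0%N) (U n.+1)) mulrDl !ncD addrC; congr (_ + _).
    by rewrite (ncM2_small _ (D0 n.+1)).1 Deltast_nn b_nil mulr1 !ncB.
  have E2 : (tens (b n.+1) (b n.+1) * U n) u w = (tens (b n.+1) (b n.+1) * U 0%N) u w
      + (U n u w - U 0%N u w).
    rewrite -{1}(subrK (U 0%N) (U n)) mulrDr !ncD addrC; congr (_ + _).
    by rewrite (ncM2_small _ (D0 n)).2 /tens b_nil !mul1r !ncB.
  rewrite E1 E2 in E; rewrite /L !ncB; move: E.
  move: (U n.+1 u w) (U n u w) (U 0%N u w) => x y z.
  by move=> /eqP; rewrite -subr_eq => /eqP <-; ring.
have [c0 cc] := polar_bounded p_pr hK L_polar (U_bounded u w) step.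
by [].
Qed.

Lemma twisted_coproduct : exists W : YY,
  W * Deltast phi = tens phi phi /\
  forall u w, (u != nseq (size u) 0%N) || (w != nseq (size w) 0%N) -> W u w = 0.
Proof.
exists (U 0%N); split.
- have : tens (v 0%N) (v 0%N) * (U 0%N * Deltast phi) = tens (v 0%N) (v 0%N) * tens phi phi.
    by rewrite mulrA -Deltast_v -DeltastM v0_group tensM.
  move=> /(congr1 (fun F => tens (ncinv (v 0%N)) (ncinv (v 0%N)) * F)).
  by rewrite ![_ * (_ * _)]mulrA tensM ncmulVf // tens1 !mul1r.
- have comm : (monom Y [:: 0%N] + coefC y1) * U 0%N = U 0%N * (monom Y [:: 0%N] + coefC y1).
    rewrite -Deltast_y1; apply: ncP => u; apply: ncP => w.
    by apply/eqP; rewrite -subr_eq0; apply/eqP; exact: (U_const_comm u w).2.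
  move=> u w /orP[hu|hw]; first exact: centralizer_y1_l comm _ _ hu.
  exact: centralizer_y1_r comm _ _ hw.
Qed.

End FrobeniusCoproduct.

(** * The exponential correction *)

Section Y1Series.
Variable K : fieldType.
Notation Y := (ncseries nat K).
Notation YY := (ncseries nat (ncseries nat K)).
Implicit Types f g a : Y.

Definition y1_word (u : seq nat) := u == nseq (size u) 0%N.

Lemma y1_wordE u : y1_word u = all (pred1 0%N) u.
Proof. by apply/eqP/all_pred1P. Qed.

Lemma y1_word_cat u v : y1_word (u ++ v) = y1_word u && y1_word v.
Proof. by rewrite !y1_wordE all_cat. Qed.

Definition y1_series f := forall u, ~~ y1_word u -> f u = 0.

Lemma y1_seriesM f g : y1_series f -> y1_series g -> y1_series (f * g).
Proof.
move=> hf hg u hu; apply: ncM_eq0 => i _.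
move: hu; rewrite -{1}(cat_take_drop i u) y1_word_cat negb_and.
by move=> /orP[/hf|/hg]; [left|right].
Qed.

Lemma y1_series1 : y1_series 1.
Proof. by case. Qed.

Lemma y1_seriesX f n : y1_series f -> y1_series (f ^+ n).
Proof.
move=> hf; elim: n => [|n IH]; first exact: y1_series1.
by rewrite exprS; exact: y1_seriesM.
Qed.

Lemma ncM_y1 f g n : (f * g) (nseq n 0%N) =
  \sum_(i < n.+1) f (nseq i 0%N) * g (nseq (n - i) 0%N).
Proof.
rewrite ncE size_nseq; apply: eq_bigr => i _.
by rewrite take_nseq -1?ltnS // drop_nseq.
Qed.

Lemma y1_seriesC f g : y1_series f -> y1_series g -> f * g = g * f.
Proof.
move=> hf hg; apply: ncP => w; have [/eqP->|hw] := boolP (y1_word w); last first.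
  by rewrite !y1_seriesM.
rewrite !ncM_y1 [RHS](reindex_inj rev_ord_inj); apply: eq_bigr => i _ /=.
by rewrite mulrC subSS subKn // -ltnS.
Qed.

Lemma y1_seriesV f : y1_series f -> y1_series (ncinv f).
Proof.
move=> hf u hu; rewrite /ncinv big1 // => i _; apply: y1_seriesX => // v hv.
by rewrite ncB hf // (y1_series1 hv) subrr.
Qed.

Lemma y1_series_exp a : y1_series a -> y1_series (ncexp a).
Proof.
by move=> ha u hu; rewrite /ncexp big1 // => i _; rewrite y1_seriesX ?mul0r.
Qed.

Lemma ncexp_nil a : ncexp a [::] = 1.
Proof. by rewrite /ncexp big_ord1 expr0 nc1 fact0 divr1. Qed.

Hypothesis charK : forall n, n.+1%:R != 0 :> K.

(** The length derivation, which is y_1 d/dy_1 on series in y_1 alone. *)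
Definition euler f : Y := fun w => (size w)%:R * f w.

Lemma eulerM f g : euler (f * g) = euler f * g + f * euler g.
Proof.
apply: ncP => w; rewrite ncD /euler !ncE mulr_sumr -big_split /=.
apply: eq_bigr => i _.
have -> : (size w)%:R = (size (take i w))%:R + (size (drop i w))%:R :> K.
  by rewrite -natrD -size_cat cat_take_drop.
by move: (_%:R) (_%:R) => m n; ring.
Qed.

Lemma eulerX a n : y1_series a -> euler (a ^+ n.+1) = euler a * a ^+ n *+ n.+1.
Proof.
move=> ha; have hea : y1_series (euler a) by move=> u hu; rewrite /euler ha ?mulr0.
elim: n => [|n IH]; first by rewrite mulr1n expr0 mulr1.
rewrite exprS eulerM IH mulrnAr mulrA (y1_seriesC ha hea) -mulrA -exprS.
by rewrite [in RHS]mulrS.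
Qed.

(** The chain rule for exp; it uses that series in y_1 commute. *)
Lemma euler_exp a : a [::] = 0 -> y1_series a -> euler (ncexp a) = euler a * ncexp a.
Proof.
move=> a0 ha; apply: ncP => w.
pose P N : Y := \sum_(k < N.+1) (coefC (k`!%:R^-1) : Y) * a ^+ k.
have expE N v : (size v <= N)%N -> ncexp a v = P N v.
  move=> hN; rewrite /P nc_sum; under [RHS]eq_bigr do rewrite coefCM mulrC.
  rewrite /ncexp -!(big_mkord xpredT (fun k => (a ^+ k) v / k`!%:R)).
  rewrite [RHS](big_cat_nat (n := (size v).+1)) //= [X in _ = _ + X]big1_seq ?addr0 //.
  move=> k; rewrite mem_index_iota => /andP[_ /andP[hk _]].
  by rewrite ncX_small ?mul0r.
have -> : (euler a * ncexp a) w = (euler a * P (size w)) w.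
  by apply: ncM_agree => // v hv; exact: expE.
(* One more term on this side, as the derivation lowers the exponents by one. *)
rewrite {1}/euler (expE (size w).+1) // -/(euler (P (size w).+1) w).
congr (_ w); rewrite {1}/P /P.
have eulerD f g : euler (f + g) = euler f + euler g.
  by apply: ncP => u; rewrite /euler !ncD mulrDr.
have euler0 : euler 0 = 0 by apply: ncP => u; rewrite /euler mulr0.
rewrite (big_morph euler eulerD euler0) big_ord_recl /= mulr_sumr.
rewrite [X in X + _](_ : _ = 0) ?add0r.
  apply: eq_bigr => k _; rewrite /bump add1n.
  have -> : euler ((coefC k.+1`!%:R^-1 : Y) * a ^+ k.+1) = coefC k.+1`!%:R^-1 * euler (a ^+ k.+1).
    by apply: ncP => u; rewrite /euler !coefCM mulrCA.
  rewrite eulerX // mulrA -coefC_comm -mulrA; apply: ncP => u; rewrite !coefCM.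
  have -> : (euler a * a ^+ k *+ k.+1) u = (euler a * a ^+ k) u *+ k.+1.
    by elim: (k.+1) => // n IH; rewrite !mulrS ncD IH.
  rewrite -[_ *+ k.+1]mulr_natl mulrA factS natrM invfM; congr (_ * _).
  by rewrite mulrAC mulVf ?mul1r.
apply: ncP => u; rewrite /euler coefCM expr0 nc1.
by case: u => [|x u]; rewrite ?mul0r ?mulr0.
Qed.

Section Gstar.
Variables (g : ncseries bool K) (W : YY).
Hypothesis g_nil : g [::] = 1.
Hypothesis g_B : forall n, g (nseq n.+1 lB) = 0.
Hypothesis W_supp : forall u w, ~~ y1_word u || ~~ y1_word w -> W u w = 0.
Hypothesis W_pi : W * Deltast (pi_y g) = tens (pi_y g) (pi_y g).

Lemma Deltast_y1_series f u w : y1_series f -> ~~ y1_word u || ~~ y1_word w ->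
  Deltast f u w = 0.
Proof.
have lder0 (x : nat) h : y1_series h -> x != 0%N -> lder x h = 0.
  by move=> hh x0; apply: ncP => v; rewrite /lder hh // y1_wordE /= (negbTE x0).
have lder1 h : y1_series h -> y1_series (lder 0%N h).
  by move=> hh v hv; rewrite /lder hh // y1_wordE /= -y1_wordE.
elim: u w f => [|a u IHu] w f hf; first by rewrite Deltast_nl => /hf.
elim: w f hf => [|b w IHw] f hf; first by rewrite Deltast_ln orbF => /hf.
move=> h; rewrite Deltast_cc [X in _ + X](_ : _ = 0) ?addr0; last first.
  by rewrite lder0 // Deltast0.
rewrite [X in X + _](_ : _ = 0) ?add0r.
  have [b0|b0] := eqVneq b 0%N; last by rewrite lder0 // Deltast0.
  move: h; rewrite b0 ![y1_word (_ :: _)]y1_wordE /= -!y1_wordE => h.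
  by apply: IHw; [exact: lder1 | rewrite y1_wordE /= -y1_wordE].
have [a0|a0] := eqVneq a 0%N; last by rewrite lder0 // Deltast0.
move: h; rewrite a0 ![y1_word (0%N :: _)]y1_wordE /= -!y1_wordE => h.
by apply: IHu; first exact: lder1.
Qed.

Let a := - corr g.
Let c := ncexp a.

Lemma monomX_word n w : (monom K [:: 0%N] ^+ n) w = (w == nseq n 0%N)%:R.
Proof.
elim: n w => // n IH [|x w]; rewrite exprS ?letM_nil // letM_cons eqseq_cons.
by case: eqP => //= _; rewrite IH.
Qed.

Lemma corrE n : corr g (nseq n.+1 0%N) =
  (-1) ^+ n.+1 / n.+1%:R * g (rcons (nseq n lA) lB).
Proof.
rewrite /corr size_nseq big_nat_recr //= monomX_word eqxx mulr1.
rewrite big_nat big1 ?add0r // => m /andP[m0 mn]; rewrite monomX_word.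
rewrite [_ == _](_ : _ = false) ?mulr0 //; apply/eqP => /(congr1 size).
by rewrite /= !size_nseq => E; move: mn; rewrite -E ltnn.
Qed.

Lemma a_y1 : y1_series a.
Proof.
move=> u hu; rewrite /a ncN /corr big1 ?oppr0 // => m _; rewrite monomX_word.
rewrite [_ == _](_ : _ = false) ?mulr0 //; apply/eqP => E; move/negP: hu; apply.
by rewrite /y1_word E size_nseq.
Qed.

Lemma a_nil : a [::] = 0.
Proof. by rewrite /a ncN /corr big_geq ?oppr0. Qed.

Lemma c_y1 : y1_series c. Proof. exact: y1_series_exp a_y1. Qed.

(** The coefficient of y_1^(i+1) in [euler_exp]; the derivation cancels the denominators n of
    [corr]. *)
Lemma c_newton i : i.+1%:R * c (nseq i.+1 0%N) =
  \sum_(k < i.+1) (-1) ^+ k * c (nseq (i - k) 0%N) * g (rcons (nseq k lA) lB).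
Proof.
have : euler c (nseq i.+1 0%N) = (euler a * c) (nseq i.+1 0%N).
  by rewrite /c (euler_exp a_nil a_y1).
rewrite {1}/euler size_nseq => ->; rewrite ncM_y1 big_ord_recl.
rewrite {1}/euler a_nil mulr0 mul0r add0r; apply: eq_bigr => k _.
rewrite lift0 /euler size_nseq subSS {1}/a ncN corrE exprS; have := charK k.
by move: ((-1) ^+ k) (k.+1%:R) (g _) (c _) => x n y z n0; field.
Qed.

(** y_1^n corresponds to B^n, where [g] vanishes for n > 0; on powers of y_1 only the exponential
    factor remains. *)
Lemma gstar_y1 n : gstar g (nseq n 0%N) = c (nseq n 0%N).
Proof.
rewrite /gstar ncM_y1 big_ord_recr /= subnn big1 ?add0r => [|i _].
  by rewrite /pi_y /= g_nil mulr1.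
rewrite -(subnSK (ltn_ord i)) /pi_y (_ : wordAB _ = nseq (n - i.+1).+1 lB) ?g_B ?mulr0 //.
by elim: (_.+1) => //= m IH; congr (_ :: _).
Qed.

Lemma gstar_letter k : gstar g [:: k] = g (rcons (nseq k lA) lB).
Proof.
rewrite /gstar -/c ncM_cons ncM_nil /c ncexp_nil -/c mul1r /lder.
rewrite /pi_y /wordAB /= cats0 g_nil mulr1; case: k => [|k]; last by rewrite c_y1 ?addr0.
have := c_newton 0; rewrite big_ord1 /= mul1r expr0 mul1r /c ncexp_nil mul1r => ->.
by have := g_B 0 => /= ->; rewrite addr0.
Qed.

(** Multiplying by [c] on the left replaces the twist [W] by [W'], still supported on powers of y_1,
    and [c] supplies the Newton identities that [Deltast_twist] asks for. *)
Lemma gstar_group : Deltast (gstar g) = tens (gstar g) (gstar g).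
Proof.
pose W' := tens c c * W * Deltast (ncinv c).
have c1 : c [::] = 1 by exact: ncexp_nil.
have suppM (F G : YY) : (forall u w, ~~ y1_word u || ~~ y1_word w -> F u w = 0) ->
    (forall u w, ~~ y1_word u || ~~ y1_word w -> G u w = 0) ->
    forall u w, ~~ y1_word u || ~~ y1_word w -> (F * G) u w = 0.
  move=> hF hG u w h; rewrite ncM2E big1 // => i _; apply: ncM_eq0 => j _.
  move: h; rewrite -{1}(cat_take_drop i u) -{1}(cat_take_drop j w) !y1_word_cat.
  rewrite !negb_and => h.
  have [hl|hl] := boolP (~~ y1_word (take i u) || ~~ y1_word (take j w)).
    by left; apply: hF.
  by right; apply: hG; move: h hl; do 4 case: (y1_word _).
apply: (@Deltast_twist _ W') => //.
- apply: (suppM) => [|u v h]; last first.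
    by apply: Deltast_y1_series => //; exact: y1_seriesV c_y1.
  apply: (suppM) => // u v /orP[h|h]; rewrite /tens.
    by rewrite (c_y1 h) mul0r.
  by rewrite (c_y1 h) mulr0.
- by rewrite (gstar_y1 0).
- rewrite /W' -!mulrA -DeltastM /gstar -/a -/c [ncinv c * _]mulrA ncmulVf // mul1r.
  by rewrite W_pi tensM.
- move=> i; rewrite gstar_y1 c_newton; apply: eq_bigr => k _.
  by rewrite gstar_y1 gstar_letter.
Qed.

End Gstar.

End Y1Series.

(** * p-adic series *)

Section Series.
Variables (p : nat) (K : fieldType) (abs : K -> rat).
Hypothesis hK : is_padic_field p abs.
Implicit Types (x y l m : K) (s t : nat -> K) (e M : rat).
Let abs_ge0 x : 0 <= abs x. Proof. exact: padic_ge0 hK x. Qed.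
Let absM x y : abs (x * y) = abs x * abs y. Proof. exact: padicM hK x y. Qed.

Definition tends s l := forall e, 0 < e ->
  exists N, forall n, (N <= n)%N -> abs (s n - l) < e.

Lemma tends_cst l : tends (fun=> l) l.
Proof. by move=> e e0; exists 0%N => n _; rewrite subrr (abs0 hK). Qed.

Lemma eq_tends s t l : s =1 t -> tends s l -> tends t l.
Proof. by move=> E h e /h[N hN]; exists N => n /hN; rewrite E. Qed.

Lemma tends_uniq s l m : tends s l -> tends s m -> l = m.
Proof.
move=> hl hm; apply/eqP; rewrite -subr_eq0 -(abs_eq0 hK).
rewrite eq_le abs_ge0 andbT leNgt; apply/negP => e0.
have [N hN] := hl _ e0; have [N' hN'] := hm _ e0.
have /(_ (leq_maxl _ _)) h1 := hN (maxn N N').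
have /(_ (leq_maxr _ _)) h2 := hN' (maxn N N').
suff : abs (l - m) < abs (l - m) by rewrite ltxx.
rewrite {1}(_ : l - m = (s (maxn N N') - m) - (s (maxn N N') - l)); last by ring.
by apply: (absD_lt hK) => //; rewrite (absN hK).
Qed.

Lemma tendsD s t l m : tends s l -> tends t m -> tends (fun n => s n + t n) (l + m).
Proof.
move=> hs ht e e0; have [N hN] := hs e e0; have [N' hN'] := ht e e0.
exists (maxn N N') => n; rewrite geq_max => /andP[/hN h1 /hN' h2].
by rewrite opprD addrACA; exact: (absD_lt hK).
Qed.

Lemma tends_bounded s l : tends s l -> exists N, forall n, (N <= n)%N ->
  abs (s n) <= abs l + 1.
Proof.
move=> /(_ 1 ltr01)[N hN]; exists N => n /hN h.
rewrite -[s n](subrK l); apply: (absD_le hK); last by rewrite lerDl.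
by apply: le_trans (ltW h) _; rewrite lerDr.
Qed.

Lemma tendsM s t l m : tends s l -> tends t m -> tends (fun n => s n * t n) (l * m).
Proof.
move=> hs ht e e0; have m1 : 0 < abs m + 1 by have := abs_ge0 m; lra.
have l1 : 0 < abs l + 1 by have := abs_ge0 l; lra.
have [N0 hN0] := tends_bounded ht.
have [N hN] := hs _ (divr_gt0 e0 m1); have [N' hN'] := ht _ (divr_gt0 e0 l1).
exists (maxn N0 (maxn N N')) => n; rewrite !geq_max => /andP[/hN0 h0 /andP[/hN h1 /hN' h2]].
rewrite (_ : _ - _ = (s n - l) * t n + l * (t n - m)); last by ring.
apply: (absD_lt hK); rewrite absM.
  by apply: le_lt_trans (ler_wpM2l (abs_ge0 _) h0) _; rewrite -ltr_pdivlMr.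
rewrite mulrC; apply: le_lt_trans (_ : _ <= abs (t n - m) * (abs l + 1)) _.
  by rewrite ler_wpM2l // lerDl.
by rewrite -ltr_pdivlMr.
Qed.

Lemma tendsN s l : tends s l -> tends (fun n => - s n) (- l).
Proof. by move=> h e /h[N hN]; exists N => n /hN; rewrite -opprD (absN hK). Qed.

Lemma tends_sum I (r : seq I) (P : pred I) (F : I -> nat -> K) (l : I -> K) :
    (forall i, P i -> tends (F i) (l i)) ->
  tends (fun n => \sum_(i <- r | P i) F i n) (\sum_(i <- r | P i) l i).
Proof.
move=> hF; elim: r => [|i r IH].
  by rewrite big_nil; apply: eq_tends (tends_cst 0) => n; rewrite big_nil.
rewrite big_cons; have [Pi|nPi] := boolP (P i).
  by apply: eq_tends (tendsD (hF i Pi) IH) => n; rewrite big_cons Pi.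
by apply: eq_tends IH => n; rewrite big_cons (negbTE nPi).
Qed.

Lemma tends_abs s l : l != 0 -> tends s l ->
  exists N, forall n, (N <= n)%N -> abs (s n) = abs l.
Proof.
move=> l0 hs; have al : 0 < abs l by rewrite lt_neqAle abs_ge0 eq_sym (abs_eq0 hK) l0.
have [N hN] := hs _ al; exists N => n /hN h.
by rewrite -[s n](subrK l) addrC (absD_dom hK).
Qed.

Lemma tendsV s l : l != 0 -> tends s l -> tends (fun n => (s n)^-1) l^-1.
Proof.
move=> l0 hs e e0.
have al : 0 < abs l by rewrite lt_neqAle abs_ge0 eq_sym (abs_eq0 hK) l0.
have [N hN] := tends_abs l0 hs.
have [N' hN'] := hs _ (mulr_gt0 e0 (mulr_gt0 al al)).
exists (maxn N N') => n; rewrite geq_max => /andP[/hN h1 /hN' h2].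
have sn0 : s n != 0 by rewrite -(abs_eq0 hK) h1 gt_eqF.
rewrite (_ : _ - _ = - (s n - l) / (s n * l)); last by field; rewrite ?l0 ?sn0.
by rewrite absM (absN hK) (absV hK) absM h1 ltr_pdivrMr ?mulr_gt0.
Qed.

Lemma tends_le s l M : (forall n, abs (s n) <= M) -> tends s l -> abs l <= M.
Proof.
move=> hM hs; rewrite leNgt; apply/negP => h.
have M0 : 0 <= M := le_trans (abs_ge0 _) (hM 0%N).
have l0 : l != 0 by rewrite -(abs_eq0 hK) gt_eqF // (le_lt_trans M0).
have [N /(_ N (leqnn N)) E] := tends_abs l0 hs.
by move: (hM N); rewrite E leNgt h.
Qed.

Definition psum s n := \sum_(i < n) s i.

Lemma ser_cauchy s : tends s 0 -> exists l, tends (psum s) l.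
Proof.
move=> hs; apply: (padic_complete hK) => e e0; have [N hN] := hs e e0.
exists N => m n hm hn; wlog mn : m n hm hn / (m <= n)%N.
  move=> h; have [/h|/ltnW /h] := leqP m n; first exact.
  by rewrite -(absN hK) opprB; exact.
rewrite -(absN hK) opprB (_ : _ - _ = \sum_(m <= i < n) s i); last first.
  rewrite /psum -!(big_mkord xpredT s) [X in X - _](big_cat_nat (n := m)) //=.
  by rewrite addrAC subrr add0r.
rewrite big_nat; elim/big_ind: _ => [|x y|i /andP[mi _]]; first by rewrite (abs0 hK).
  exact: (absD_lt hK).
by have := hN i (leq_trans hm mi); rewrite subr0.
Qed.

Definition ser s : K :=
  if pselect (exists l, tends (psum s) l) is left h then projT1 (cid h) else 0.

Lemma ser_tends s : tends s 0 -> tends (psum s) (ser s).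
Proof. by move=> /ser_cauchy h; rewrite /ser; case: pselect => // {}h; case: cid. Qed.

Lemma serE s l : tends (psum s) l -> ser s = l.
Proof.
move=> h; rewrite /ser; case: pselect => [{}h'|[]]; last by exists l.
by case: cid => l' /= hl'; exact: tends_uniq hl' h.
Qed.

Lemma eq_ser s t : s =1 t -> ser s = ser t.
Proof. by move=> /funext ->. Qed.

Lemma ser0 : ser (fun=> 0) = 0.
Proof.
by apply: serE; apply: eq_tends (tends_cst 0) => n; rewrite /psum big1.
Qed.

Lemma serD s t : tends s 0 -> tends t 0 -> ser (fun n => s n + t n) = ser s + ser t.
Proof.
move=> hs ht; apply: serE.
apply: eq_tends (tendsD (ser_tends hs) (ser_tends ht)) => n.
by rewrite /psum -big_split.
Qed.

Lemma tends0Z (c : K) s : tends s 0 -> tends (fun n => c * s n) 0.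
Proof. by move=> hs; rewrite -(mulr0 c); apply: tendsM => //; exact: tends_cst. Qed.

Lemma tends0D s t : tends s 0 -> tends t 0 -> tends (fun n => s n + t n) 0.
Proof. by move=> hs ht; rewrite -[0]addr0; exact: tendsD. Qed.

Lemma serZ (c : K) s : tends s 0 -> ser (fun n => c * s n) = c * ser s.
Proof.
move=> hs; apply: serE; apply: eq_tends (tendsM (tends_cst c) (ser_tends hs)) => n.
by rewrite /psum mulr_sumr.
Qed.

Lemma ser_sum I (r : seq I) (F : I -> nat -> K) :
    (forall i, tends (F i) 0) ->
  ser (fun n => \sum_(i <- r) F i n) = \sum_(i <- r) ser (F i)
  /\ tends (fun n => \sum_(i <- r) F i n) 0.
Proof.
move=> hF; elim: r => [|i r [IH1 IH2]].
  rewrite big_nil; split.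
    by rewrite -[RHS]ser0; apply: eq_ser => n; rewrite big_nil.
  by apply: eq_tends (tends_cst 0) => n; rewrite big_nil.
rewrite big_cons -IH1 -serD //; split.
  by apply: eq_ser => n; rewrite big_cons.
by apply: eq_tends (tends0D (hF i) IH2) => n; rewrite big_cons.
Qed.

Lemma ser_le s M : tends s 0 -> (forall n, abs (s n) <= M) -> abs (ser s) <= M.
Proof.
move=> hs hM; apply: tends_le (ser_tends hs) => n.
by apply: (abs_sum_le hK) => //; exact: le_trans (abs_ge0 _) (hM 0%N).
Qed.

Lemma tends_shift N s l : tends s l -> tends (fun n => s (N + n)%N) l.
Proof.
move=> h e /h[N' hN']; exists N' => n hn; apply: hN'.
by apply: leq_trans hn _; rewrite leq_addl.
Qed.

Lemma ser_split s N : tends s 0 -> ser s = psum s N + ser (fun n => s (N + n)%N).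
Proof.
move=> hs; apply: serE; have := ser_tends (tends_shift N hs).
move=> /(tendsD (tends_cst (psum s N))) h e /h[N' hN'].
exists (N + N')%N => n hn; have := hN' (n - N)%N.
rewrite /psum -!(big_mkord xpredT s) -(big_mkord xpredT (fun i => s (N + i)%N)).
rewrite (_ : \sum_(0 <= i < n - N) s (N + i)%N = \sum_(N <= i < n) s i); last first.
  rewrite (_ : \sum_(N <= i < n) s i = \sum_((0 + N)%N <= i < n) s i) //.
  by rewrite [RHS]big_addn; apply: eq_bigr => i _; rewrite addnC.
have Nn : (N <= n)%N by apply: leq_trans hn; rewrite leq_addr.
rewrite -big_cat_nat //=.
by apply; rewrite leq_subRL.
Qed.

Lemma ser_recl s : tends s 0 -> ser s = s 0%N + ser (fun n => s n.+1).
Proof.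
move=> hs; rewrite (ser_split 1 hs) /psum big_ord1; congr (_ + _).
Qed.

Definition vanish (M : nat -> rat) := forall e, 0 < e ->
  exists N, forall n, (N <= n)%N -> M n < e.

Lemma tends_dom s (M : nat -> rat) : vanish M -> (forall n, abs (s n) <= M n) -> tends s 0.
Proof.
move=> hM hs e /hM[N hN]; exists N => n /hN h; rewrite subr0.
exact: le_lt_trans h.
Qed.

(** Dominated convergence. By the ultrametric inequality a tail is bounded by the bound on its
    terms, so [M] need only tend to 0. *)
Lemma ser_dominated (s : nat -> nat -> K) (l : nat -> K) (M : nat -> rat) :
    vanish M -> (forall r k, abs (s r k) <= M k) ->
    (forall k, tends (fun r => s r k) (l k)) ->
  tends (fun r => ser (s r)) (ser l).
Proof.
move=> hM hs hl e e0.
have hlM k : abs (l k) <= M k by exact: tends_le (hl k).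
have e2 : 0 < e / 2 by rewrite divr_gt0.
have e2e : e / 2 < e by rewrite ltr_pdivrMr // ltr_pMr // ltr1n.
have [N hN] := hM _ e2.
have [N' hN'] := tends_sum (index_enum 'I_N) (P := xpredT) (fun i _ => hl i) e0.
exists N' => r /hN' h.
have sr0 : tends (s r) 0 by exact: tends_dom (hs r).
have l0 : tends l 0 by exact: tends_dom hlM.
rewrite (ser_split N sr0) (ser_split N l0) opprD addrACA.
apply: (absD_lt hK) => //; apply: le_lt_trans e2e; apply: (absB_le hK).
  apply: ser_le => [|n]; first exact: tends_shift.
  by apply: le_trans (hs _ _) _; apply/ltW/hN; rewrite leq_addr.
apply: ser_le => [|n]; first exact: tends_shift.
by apply: le_trans (hlM _) _; apply/ltW/hN; rewrite leq_addr.
Qed.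

End Series.

(** * Geometric decay against polynomial growth *)

Section Growth.
Implicit Types (r M e : rat).

Lemma bernoulli (h : rat) n : 0 <= h -> 1 + n%:R * h <= (1 + h) ^+ n.
Proof.
move=> h0; elim: n => [|n IH]; first by rewrite mul0r addr0 expr0.
rewrite exprS; apply: le_trans (ler_wpM2l _ IH); last by lra.
rewrite -natr1; have : 0 <= n%:R * h * h by rewrite !mulr_ge0.
lra.
Qed.

Lemma linear_growth r : 1 < r -> exists M, forall k, k.+1%:R <= M * r ^+ k.
Proof.
move=> r1; have h0 : 0 < r - 1 by lra.
exists (1 + (r - 1)^-1) => k.
have := bernoulli k (ltW h0); rewrite addrCA subrr addr0 => h.
apply: le_trans (ler_wpM2l _ h); last by rewrite addr_ge0 // invr_ge0 ltW.
have E : (r - 1) * (r - 1)^-1 = 1 by rewrite mulfV // gt_eqF.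
have : 0 <= k%:R * (r - 1) by rewrite mulr_ge0 // ltW.
have : 0 < (r - 1)^-1 by rewrite invr_gt0.
move: E; rewrite -natr1; move: (k%:R) (r - 1) (_^-1) => x y z E z0 xy.
rewrite (_ : (1 + z) * (1 + x * y) = 1 + x * y + z + x * (y * z)); last by ring.
rewrite E; lra.
Qed.

(** A rational substitute for the d-th root of r, absolute values being rational. *)
Lemma small_root r d : 1 < r -> exists2 s, 1 < s & s ^+ d <= r.
Proof.
move=> r1; elim: d r r1 => [|d IH] r r1; first by exists 2; rewrite ?expr0 ?ltW.
(* Chosen so that (1 + h)^2 <= 1 + 3 h <= r. *)
pose h := Num.min 1 ((r - 1) / 3).
have h0 : 0 < h by rewrite lt_min; apply/andP; split; lra.
have h1 : h <= 1 by rewrite ge_min lexx.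
have h2 : h <= (r - 1) / 3 by rewrite ge_min lexx orbT.
have [s s1 hs] := IH (1 + h) ltac:(lra).
exists (Num.min s (1 + h)); first by rewrite lt_min s1; lra.
have s0 : 0 <= Num.min s (1 + h) by rewrite le_min; apply/andP; split; lra.
rewrite exprS; apply: le_trans (_ : (1 + h) * (1 + h) <= r).
  apply: ler_pM => //; first exact: exprn_ge0.
    by rewrite ge_min lexx orbT.
  by apply: le_trans hs; apply: lerXn2r; rewrite ?nnegrE ?ge_min ?lexx //; lra.
have : h * h <= h by rewrite ler_piMl // ltW.
lra.
Qed.

Lemma poly_geometric_vanish r M C d : 1 < r ->
  vanish (fun k => M * r ^- k * (C * k.+1%:R ^+ d)).
Proof.
move=> r1; have [s s1 hs] := small_root d.+1 r1.
have [B hB] := linear_growth s1.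
have B0 : 0 <= B by have := hB 0%N; rewrite expr0 mulr1; exact: le_trans.
(* One power of k + 1 more than required is absorbed, which leaves a factor 1/(k+1) tending to 0. *)
have key k : r ^- k * k.+1%:R ^+ d.+1 <= B ^+ d.+1.
  have rk : 0 < r ^+ k by rewrite exprn_gt0 //; lra.
  rewrite mulrC ler_pdivrMr //.
  apply: le_trans (_ : (B * s ^+ k) ^+ d.+1 <= _).
    by apply: lerXn2r; rewrite ?nnegrE //; exact: le_trans (hB k).
  rewrite exprMn; apply: ler_wpM2l; first exact: exprn_ge0.
  by rewrite exprAC; apply: lerXn2r; rewrite ?nnegrE ?exprn_ge0 //; lra.
move=> e e0; pose A := `|M * C| * B ^+ d.+1.
have A0 : 0 <= A by rewrite mulr_ge0 // exprn_ge0.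
exists (Num.bound (A / e)) => k hk.
have k1 : 0 < k.+1%:R :> rat by rewrite ltr0n.
apply: le_lt_trans (_ : A / k.+1%:R < e).
  rewrite ler_pdivlMr // (_ : M * r ^- k * (C * k.+1%:R ^+ d) * k.+1%:R =
    (M * C) * (r ^- k * k.+1%:R ^+ d.+1)); last first.
    by rewrite exprSr; move: (r ^- k) ((k.+1%:R : rat) ^+ d) (k.+1%:R : rat) => x y z; ring.
  apply: le_trans (ler_norm _) _; rewrite normrM /A; apply: ler_wpM2l => //.
  by rewrite ger0_norm // mulr_ge0 ?exprn_ge0 // invr_ge0 exprn_ge0 //; lra.
rewrite ltr_pdivrMr // mulrC -ltr_pdivrMr //.
apply: lt_le_trans (archi_boundP _) _; first by rewrite divr_ge0 // ltW.
by rewrite ler_nat; exact: leq_trans hk _.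
Qed.

End Growth.

(** * Expansion at z = 0 *)

(* The number of multisets of size n in a k-element set, that is the
   coefficient of z^n in (1 - z)^(-k). *)
Fixpoint multiset (k n : nat) : nat :=
  if k is k'.+1 then (\sum_(m < n.+1) multiset k' m)%N else (n == 0%N).

Lemma multisetS k n :
  multiset k.+1 n.+1 = (multiset k.+1 n + multiset k n.+1)%N.
Proof. by rewrite /= big_ord_recr. Qed.

Lemma multiset_n0 k : multiset k 0 = 1%N.
Proof. by elim: k => //= k IH; rewrite big_ord1. Qed.

Lemma multiset1 n : multiset 1 n = 1%N.
Proof. by elim: n => [|n IH]; rewrite ?multiset_n0 // multisetS IH. Qed.

(** The coefficient of z^n in d/dz (1 - z)^(-k) = k (1 - z)^(-k-1). *)
Lemma multiset_diag k n : (k * multiset k.+1 n = n.+1 * multiset k n.+1)%N.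
Proof.
elim: k n => [|k IHk] n; first by rewrite mul0n muln0.
elim: n => [|n IHn].
  by have := IHk 0%N; rewrite (multisetS k 0) !multiset_n0; lia.
have := IHk n.+1; rewrite (multisetS k.+1) mulnDr IHn (multisetS k n.+1).
by move: (multiset k.+1 n.+1) (multiset k n.+2) => x y; nia.
Qed.

Section PowserComm.
Variable K : fieldType.
Notation R := (ncseries bool K).
Notation Q := (ncseries bool (powser K)).
Notation pc := (@polyC_nc K).

Lemma seq_unit (v : seq unit) : v = nseq (size v) tt.
Proof. by elim: v => [|[] v {1}->]. Qed.

Lemma powserP (f g : powser K) :
  (forall n, f (nseq n tt) = g (nseq n tt)) -> f = g.
Proof. by move=> h; apply: ncP => v; rewrite (seq_unit v). Qed.

Lemma powserM (f g : powser K) n : (f * g) (nseq n tt) =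
  \sum_(i < n.+1) f (nseq i tt) * g (nseq (n - i) tt).
Proof.
rewrite ncE size_nseq; apply: eq_bigr => i _.
by rewrite take_nseq -1?ltnS // drop_nseq.
Qed.

Lemma powserC (f g : powser K) : f * g = g * f.
Proof.
apply: powserP => n; rewrite !powserM [RHS](reindex_inj rev_ord_inj).
by apply: eq_bigr => i _ /=; rewrite mulrC subSS subKn // -ltnS.
Qed.

Lemma popM (q r : {poly K}) :
  powser_of_poly (q * r) = powser_of_poly q * powser_of_poly r.
Proof.
apply: powserP => n; rewrite powserM /powser_of_poly size_nseq coefM.
by apply: eq_bigr => i _; rewrite !size_nseq.
Qed.

Lemma popD (q r : {poly K}) :
  powser_of_poly (q + r) = powser_of_poly q + powser_of_poly r.
Proof. by apply: ncP => v; rewrite /powser_of_poly coefD. Qed.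

Lemma popN (q : {poly K}) : powser_of_poly (- q) = - powser_of_poly q.
Proof. by apply: ncP => v; rewrite /powser_of_poly coefN. Qed.

Lemma popC (c : K) : powser_of_poly c%:P = coefC c.
Proof.
apply: ncP => v; rewrite /powser_of_poly /coefC poly.coefC.
by rewrite -size_eq0; case: (size v).
Qed.

Lemma popX : powser_of_poly 'X = monom K [:: tt].
Proof.
apply: ncP => v; rewrite /powser_of_poly /monom coefX.
by rewrite (seq_unit v) size_nseq; case: (size v) => [|[|n]].
Qed.

Lemma pcM (q r : {poly K}) : pc (q * r) = pc q * pc r.
Proof. by rewrite /polyC_nc popM -coefC_comp. Qed.

Lemma pcD (q r : {poly K}) : pc (q + r) = pc q + pc r.
Proof. by rewrite /polyC_nc popD coefCD. Qed.

Lemma pcN (q : {poly K}) : pc (- q) = - pc q.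
Proof. by rewrite /polyC_nc popN coefCN. Qed.

Lemma pc1 : pc 1 = 1.
Proof. by rewrite /polyC_nc -polyC1 popC !coefC1. Qed.

Lemma pcE q (H : Q) u : (pc q * H) u = powser_of_poly q * H u.
Proof. exact: coefCM. Qed.

Lemma pc_comm q (H : Q) : pc q * H = H * pc q.
Proof. by apply: ncP => u; rewrite pcE McoefC powserC. Qed.

Lemma pcA q r (H : Q) : pc q * (pc r * H) = pc (q * r) * H.
Proof. by rewrite pcM mulrA. Qed.

Lemma mul_pc (H H' : Q) q : H * (pc q * H') = pc q * (H * H').
Proof. by rewrite mulrA -pc_comm mulrA. Qed.

Lemma pc_inj (q : {poly K}) (H H' : Q) : q`_0 = 1 -> pc q * H = pc q * H' -> H = H'.
Proof.
move=> q0 E; apply: ncP => u; apply: (@ncmulI _ _ (powser_of_poly q)) => //.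
by rewrite -!pcE E.
Qed.

(** The operator z d/dz, the power series variable now being read as z. *)
Definition theta (H : Q) : Q := fun u v => (size v)%:R * H u v.

Lemma thetaM (H H' : Q) : theta (H * H') = theta H * H' + H * theta H'.
Proof.
have D (f g : powser K) : ((fun v => (size v)%:R * (f * g) v) : powser K) =
    ((fun v => (size v)%:R * f v) : powser K) * g + f * (fun v => (size v)%:R * g v).
  apply: ncP => v; rewrite ncD !ncE mulr_sumr -big_split /=; apply: eq_bigr => i _.
  have -> : (size v)%:R = (size (take i v))%:R + (size (drop i v))%:R :> K.
    by rewrite -natrD -size_cat cat_take_drop.
  by move: (_%:R) (_%:R) => m n; ring.
apply: ncP => u; rewrite ncD !ncE -big_split /=.
rewrite -[LHS]/((fun v => (size v)%:R * (H * H') u v) : powser K).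
have -> : ((fun v => (size v)%:R * (H * H') u v) : powser K) =
   \sum_(i < (size u).+1) ((fun v => (size v)%:R * (H (take i u) * H' (drop i u)) v) : powser K).
  by apply: ncP => v; rewrite ncM2E nc_sum mulr_sumr.
by apply: eq_bigr => i _; rewrite D.
Qed.

Definition coefz n (H : Q) : R := fun u => H u (nseq n tt).

Lemma coefzP (H H' : Q) : (forall n, coefz n H = coefz n H') -> H = H'.
Proof.
move=> h; apply: ncP => u; apply: powserP => n.
by move: (h n) => /(congr1 (fun f : R => f u)).
Qed.

Lemma coefzM n (H H' : Q) :
  coefz n (H * H') = \sum_(i < n.+1) coefz i H * coefz (n - i) H'.
Proof.
apply: ncP => u; rewrite /coefz ncM2E nc_sum.
under eq_bigr do rewrite powserM.
by rewrite exchange_big; apply: eq_bigr => i _; rewrite ncE.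
Qed.

Lemma coefzD n (H H' : Q) : coefz n (H + H') = coefz n H + coefz n H'.
Proof. by []. Qed.
Lemma coefzN n (H : Q) : coefz n (- H) = - coefz n H.
Proof. by []. Qed.

Lemma coefz_theta n (H : Q) : coefz n (theta H) = (coefC n%:R : R) * coefz n H.
Proof. by apply: ncP => u; rewrite coefCM /coefz /theta size_nseq. Qed.

Lemma coefz_letter n a (H : Q) :
  coefz n (monom _ [:: a] * H) = monom K [:: a] * coefz n H.
Proof.
apply: ncP => -[|b u]; rewrite /coefz ?letM_nil // !letM_cons.
by case: eqP.
Qed.

Lemma coefz_ext n (H : Q) (f : R) :
  coefz n (H * extend_scalars f) = coefz n H * f.
Proof.
apply: ncP => u; rewrite /coefz ncM2E ncE; apply: eq_bigr => i _.
exact: McoefC.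
Qed.

Lemma coefz_extl n (H : Q) (f : R) :
  coefz n (extend_scalars f * H) = f * coefz n H.
Proof.
apply: ncP => u; rewrite /coefz ncM2E ncE; apply: eq_bigr => i _.
exact: coefCM.
Qed.

Lemma coefz_X n (H : Q) :
  coefz n (pc 'X * H) = if n is n'.+1 then coefz n' H else 0.
Proof.
apply: ncP => u; rewrite /coefz pcE popX.
by case: n => [|n]; rewrite ?letM_nil // letM_cons.
Qed.

Lemma coefz_Xn n m (H : Q) :
  coefz n (pc 'X^m * H) = if (m <= n)%N then coefz (n - m) H else 0.
Proof.
elim: m n => [|m IH] n; first by rewrite expr0 pc1 mul1r subn0.
rewrite exprS pcM -mulrA coefz_X; case: n => [|n] //; rewrite IH subSS.
Qed.

Lemma ext_letter a : extend_scalars (monom K [:: a]) = monom _ [:: a].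
Proof.
apply: ncP => u; rewrite /extend_scalars /monom.
by case: (u == _); rewrite ?coefC1 ?coefC0.
Qed.

Lemma extM (f g : R) : extend_scalars (f * g) = extend_scalars f * extend_scalars g.
Proof.
apply: coefzP => n; rewrite coefz_ext; apply: ncP => u.
rewrite /coefz /extend_scalars /coefC; case: n => [|n] /=.
  by rewrite mulr1n; apply: ncM_agree => v _.
by rewrite mulr0n ncM_eq0 // => i _; left.
Qed.

Lemma ext_C (c : K) : extend_scalars (coefC c) = pc c%:P.
Proof.
apply: ncP => u; rewrite /extend_scalars /polyC_nc popC /coefC.
by case: (u == [::]) => //; apply: ncP => v; rewrite mulr0n mul0rn.
Qed.

End PowserComm.

(** * From the coordinate w to the coordinate z *)

Section Hat.
Variables (p : nat) (K : fieldType) (abs : K -> rat).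
Hypothesis hK : is_padic_field p abs.
Notation R := (ncseries bool K).
Notation tends := (tends abs).
Notation ser := (ser abs).

Definition zterm (f : powser K) n k : K :=
  (multiset k n)%:R * ((-1) ^+ k * f (nseq k tt)).

(* As w^k = (-1)^k (1 - z)^(-k), this is the expansion at z = 0. *)
Definition hat (f : powser K) : powser K := fun v => ser (zterm f (size v)).

Definition null_powser (f : powser K) := tends (fun k => f (nseq k tt)) 0.

Lemma tends0_le1 (c s : nat -> K) : (forall k, abs (c k) <= 1) ->
  tends s 0 -> tends (fun k => c k * s k) 0.
Proof.
move=> hc hs e e0; have [N hN] := hs e e0; exists N => n /hN; rewrite !subr0.
apply: le_lt_trans; rewrite (padicM hK) ler_piMl //; exact: padic_ge0 hK _.
Qed.

Lemma abs_sign k : abs ((-1) ^+ k) = 1.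
Proof. by rewrite (absX hK) (absN1 hK) expr1n. Qed.

Lemma zterm_tends f n : null_powser f -> tends (zterm f n) 0.
Proof.
move=> hf; apply: tends0_le1 => [k|]; first exact: (abs_nat_le1 hK).
by apply: tends0_le1 => [k|//]; rewrite abs_sign.
Qed.

Lemma null_powserD f g : null_powser f -> null_powser g -> null_powser (f + g).
Proof. exact: (tends0D hK). Qed.

Lemma null_powserZ c f : null_powser f -> null_powser ((coefC c : powser K) * f).
Proof.
move=> hf; apply: eq_tends (tends0Z hK c hf) => k; by rewrite coefCM.
Qed.

Lemma null_powserX f : null_powser f -> null_powser (powser_of_poly 'X * f).
Proof.
move=> hf e /hf[N hN]; exists N.+1 => -[|n] // hn.
by rewrite popX letM_cons eqxx; exact: hN.
Qed.

Lemma null_powser_ddw f : null_powser f -> null_powser (ddw f).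
Proof.
move=> hf; apply: tends0_le1 => [k|]; first exact: (abs_nat_le1 hK).
by have := tends_shift 1 hf.
Qed.

Lemma hatD f g : null_powser f -> null_powser g -> hat (f + g) = hat f + hat g.
Proof.
move=> hf hg; apply: ncP => v; rewrite ncD -(serD hK); try exact: zterm_tends.
by apply: eq_ser => k; rewrite /zterm ncD !mulrDr.
Qed.

Lemma hatZ c f : null_powser f -> hat ((coefC c : powser K) * f) = coefC c * hat f.
Proof.
move=> hf; apply: ncP => v; rewrite coefCM -(serZ hK); last exact: zterm_tends.
by apply: eq_ser => k; rewrite /zterm coefCM; ring.
Qed.

Lemma hat0 : hat 0 = 0.
Proof.
apply: ncP => v; rewrite /hat -[RHS](ser0 hK); apply: eq_ser => k.
by rewrite /zterm !mulr0.
Qed.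

Lemma hatX f n : null_powser f -> hat (powser_of_poly 'X * f) (nseq n tt) =
  - ser (fun k => (multiset k.+1 n)%:R * ((-1) ^+ k * f (nseq k tt))).
Proof.
move=> hf; have hX := null_powserX hf.
rewrite /hat size_nseq (ser_recl hK); last exact: zterm_tends.
rewrite {1}/zterm popX letM_nil !mulr0 add0r -[RHS]mulN1r -(serZ hK); last first.
  apply: tends0_le1 => [k|]; first exact: (abs_nat_le1 hK).
  by apply: tends0_le1 => [k|//]; rewrite abs_sign.
by apply: eq_ser => k; rewrite /zterm letM_cons eqxx exprS; ring.
Qed.

(** Multiplication by w becomes division by z - 1. *)
Lemma hat_X f : null_powser f ->
  powser_of_poly ('X - 1) * hat (powser_of_poly 'X * f) = hat f.
Proof.
move=> hf; rewrite popD popN -polyC1 popC coefC1 popX mulrBl mul1r -popX.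
have nt n : tends (fun k => (multiset k.+1 n)%:R * ((-1) ^+ k * f (nseq k tt))) 0.
  apply: tends0_le1 => [k|]; first exact: (abs_nat_le1 hK).
  by apply: tends0_le1 => [k|//]; rewrite abs_sign.
apply: powserP => -[|n]; rewrite ncB hatX // popX ?letM_nil ?letM_cons ?eqxx.
  rewrite opprK add0r /hat; apply: eq_ser => k.
  by rewrite /zterm !multiset_n0.
rewrite -popX hatX // opprK addrC.
rewrite -[X in _ + X = _]mulN1r -(serZ hK) // -(serD hK) //; last first.
  exact: (tends0Z hK).
apply: eq_ser => k; rewrite /zterm size_nseq multisetS natrD; ring.
Qed.

(** w^2 d/dw = - d/dz. *)
Lemma hat_ddw f : null_powser f ->
  hat (powser_of_poly ('X * 'X) * ddw f) = - ddw (hat f).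
Proof.
move=> hf; rewrite popM -mulrA.
have hd := null_powser_ddw hf; have hX := null_powserX hd.
apply: powserP => n; rewrite hatX // ncN; congr (- _).
rewrite /ddw /hat /= size_nseq -(serZ hK); last exact: zterm_tends.
rewrite (ser_recl hK) ?popX; last first.
  apply: tends0_le1 => [k|]; first exact: (abs_nat_le1 hK).
  by apply: tends0_le1 => [k|]; rewrite ?abs_sign // -popX.
rewrite letM_nil !mulr0 add0r [RHS](ser_recl hK); last first.
  by apply: (tends0Z hK); exact: zterm_tends.
rewrite {1}/zterm [multiset 0 _]/= mul0r mulr0 add0r.
apply: eq_ser => k; rewrite letM_cons eqxx /zterm size_nseq [nseq k.+1 _]/=.
have := congr1 (fun m => m%:R : K) (multiset_diag k.+1 n); rewrite /= !natrM.
move: (multiset k.+2 n)%:R (multiset k.+1 n.+1)%:R => x y E.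
by rewrite !mulrA -E; ring.
Qed.

End Hat.

Section Resolvent.
Variable K : fieldType.
Notation R := (ncseries bool K).
Notation A := (monom K [:: lA]).
Implicit Types (x : K) (f h : R).

(* (x - A)^(-1) *)
Definition resolvent x : R := fun w =>
  if w == nseq (size w) lA then x^-1 ^+ (size w).+1 else 0.

Lemma resolventV x : x != 0 -> (coefC x - A) * resolvent x = 1.
Proof.
move=> x0; apply: ncP => -[|b w]; rewrite mulrBl ncB coefCM.
  by rewrite letM_nil subr0 /resolvent /= expr1 mulfV.
rewrite letM_cons /resolvent /= eqseq_cons.
case: eqP => _; case: eqP => _ /=; rewrite ?mulr0 ?subrr // exprS mulrA mulfV //.
by rewrite mul1r subrr.
Qed.

Lemma resolventK x : x != 0 -> resolvent x * (coefC x - A) = 1.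
Proof.
move=> x0; pose l : R := ncinv (coefC x^-1 * (coefC x - A)) * coefC x^-1.
have E : l * (coefC x - A) = 1.
  rewrite /l -mulrA ncmulVf // coefCM ncB coefC_nil.
  by rewrite [monom _ _ _](_ : _ = 0) // subr0 mulVf.
by rewrite -[resolvent x]mul1r -E -(mulrA l) resolventV // mulr1.
Qed.

(* Equality modulo the left ideal generated by A. *)
Definition eqmodA f h := forall u, last true u -> f u = h u.

Lemma eqmodA_sym f h : eqmodA f h -> eqmodA h f.
Proof. by move=> e u /e. Qed.

Lemma eqmodA_trans h f k : eqmodA f h -> eqmodA h k -> eqmodA f k.
Proof. by move=> e1 e2 u hu; rewrite e1 ?e2. Qed.

Lemma last_drop (u : seq bool) i : last true u -> last true (drop i u).
Proof.
move=> hu; have := cat_take_drop i u; case: (drop i u) => // b w E.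
by move: hu; rewrite -E last_cat.
Qed.

Lemma eqmodA_mul k f h : eqmodA f h -> eqmodA (k * f) (k * h).
Proof.
move=> e u hu; rewrite !ncE; apply: eq_bigr => i _.
by rewrite e // last_drop.
Qed.

Lemma eqmodA_add f f' h h' : eqmodA f h -> eqmodA f' h' -> eqmodA (f + f') (h + h').
Proof. by move=> e e' u hu; rewrite !ncD e ?e'. Qed.

Lemma eqmodA_opp f h : eqmodA f h -> eqmodA (- f) (- h).
Proof. by move=> e u hu; rewrite !ncN e. Qed.

Lemma eqmodA0 f : eqmodA (f * A) 0.
Proof.
case/lastP => [|u b] hu; first by rewrite Mlet_nil.
by rewrite Mlet_rcons; move: hu; rewrite last_rcons => ->.
Qed.

Fixpoint harmonic_product n : R :=
  if n is n'.+1 then (1 - resolvent n%:R * monom K [:: lB]) * harmonic_product n'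
  else 1.

End Resolvent.

Section Horizontal.
Variables (p : nat) (K : fieldType) (abs : K -> rat).
Hypothesis hK : is_padic_field p abs.
Notation R := (ncseries bool K).
Notation Q := (ncseries bool (powser K)).
Notation pc := (@polyC_nc K).
Notation null_powser := (null_powser abs).
Notation hat := (hat abs).

Definition null_series (H : Q) := forall u, null_powser (H u).
Definition Hat (H : Q) : Q := fun u => hat (H u).

Lemma null_seriesD H H' : null_series H -> null_series H' -> null_series (H + H').
Proof. by move=> h h' u; exact: (null_powserD hK). Qed.

Lemma null_poly q f : null_powser f -> null_powser (powser_of_poly q * f).
Proof.
move=> hf; elim/poly_ind: q => [|q c IH].
  have -> : powser_of_poly (0 : {poly K}) = 0 by rewrite -polyC0 popC coefC0.
  by rewrite mul0r; exact: (tends_cst hK).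
rewrite popD popM popC mulrDl; apply: (null_powserD hK); last exact: (null_powserZ hK).
by rewrite [powser_of_poly q * _]powserC -mulrA; exact: null_powserX.
Qed.

Lemma null_pc q H : null_series H -> null_series (pc q * H).
Proof. by move=> h u; rewrite pcE; exact: null_poly. Qed.

Lemma null_letter a H : null_series H -> null_series (monom _ [:: a] * H).
Proof.
move=> h [|b u]; first by rewrite letM_nil; exact: (tends_cst hK).
by rewrite letM_cons; case: eqP => _; [exact: h | exact: (tends_cst hK)].
Qed.

Lemma hat_sum I (r : seq I) (F : I -> powser K) : (forall i, null_powser (F i)) ->
  hat (\sum_(i <- r) F i) = \sum_(i <- r) hat (F i) /\ null_powser (\sum_(i <- r) F i).
Proof.
move=> hF; elim: r => [|i r [IH1 IH2]].
  by rewrite !big_nil (hat0 hK); split=> //; exact: (tends_cst hK).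
rewrite !big_cons (hatD hK) // IH1; split=> //.
exact: (null_powserD hK).
Qed.

Lemma extE H (f : R) u : (H * extend_scalars f) u =
  \sum_(i < (size u).+1) (coefC (f (drop i u)) : powser K) * H (take i u).
Proof. by rewrite ncE; apply: eq_bigr => i _; rewrite powserC. Qed.

Lemma null_ext H (f : R) : null_series H -> null_series (H * extend_scalars f).
Proof.
move=> h u; rewrite extE; apply: (hat_sum _ _).2 => i; exact: (null_powserZ hK).
Qed.

Lemma HatD H H' : null_series H -> null_series H' -> Hat (H + H') = Hat H + Hat H'.
Proof. by move=> h h'; apply: ncP => u; exact: (hatD hK). Qed.

Lemma Hat_letter a H : Hat (monom _ [:: a] * H) = monom _ [:: a] * Hat H.
Proof.
apply: ncP => -[|b u]; rewrite /Hat ?letM_nil ?(hat0 hK) // !letM_cons.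
by case: eqP => _ //; rewrite (hat0 hK).
Qed.

Lemma Hat_ext H (f : R) : null_series H ->
  Hat (H * extend_scalars f) = Hat H * extend_scalars f.
Proof.
move=> h; apply: ncP => u; rewrite /Hat !extE (hat_sum _ _).1; last first.
  by move=> i; exact: (null_powserZ hK).
by apply: eq_bigr => i _; exact: (hatZ hK).
Qed.

Lemma Hat_C (c : K) H : null_series H -> Hat (pc c%:P * H) = pc c%:P * Hat H.
Proof. by move=> h; apply: ncP => u; rewrite /Hat !pcE popC (hatZ hK). Qed.

Lemma Hat_X H : null_series H -> pc ('X - 1) * Hat (pc 'X * H) = Hat H.
Proof. by move=> h; apply: ncP => u; rewrite pcE /Hat pcE (hat_X hK). Qed.

(** w + 1 = z/(z-1). *)
Lemma Hat_X1 H : null_series H -> pc ('X - 1) * Hat (pc ('X + 1) * H) = pc 'X * Hat H.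
Proof.
move=> h; rewrite pcD pc1 mulrDl mul1r HatD //; last exact: null_pc.
rewrite mulrDr Hat_X // -{1}[Hat H]mul1r -pc1 -mulrDl -pcD.
by congr (pc _ * _); ring.
Qed.

Lemma Hat_Xn n H : null_series H -> pc (('X - 1) ^+ n) * Hat (pc 'X^n * H) = Hat H.
Proof.
move=> h; elim: n => [|n IH]; first by rewrite !expr0 pc1 !mul1r.
by rewrite exprSr -pcA exprS -pcA Hat_X ?IH //; exact: null_pc.
Qed.

Lemma Hat_X1n n H : null_series H ->
  pc (('X - 1) ^+ n) * Hat (pc (('X + 1) ^+ n) * H) = pc 'X^n * Hat H.
Proof.
move=> h; elim: n => [|n IH]; first by rewrite !expr0 pc1 !mul1r.
rewrite exprSr -pcA exprS -pcA Hat_X1; last exact: null_pc.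
by rewrite pcA mulrC -pcA IH pcA exprS.
Qed.

Lemma HatN H : null_series H -> Hat (- H) = - Hat H.
Proof.
move=> h; have E (H' : Q) : - H' = pc (-1)%:P * H' by rewrite polyCN pcN pc1 mulN1r.
by rewrite !E Hat_C.
Qed.

Lemma null_seriesN H : null_series H -> null_series (- H).
Proof.
move=> h; have -> : - H = pc (-1)%:P * H by rewrite polyCN pcN pc1 mulN1r.
exact: null_pc.
Qed.

(** (w+1)^p - w^p = (z^p - 1)/(z-1)^p. *)
Lemma Hat_frobQ H : null_series H ->
  pc (('X - 1) ^+ p) * Hat (pc (frobQ p K) * H) = pc ('X^p - 1) * Hat H.
Proof.
move=> h; rewrite /frobQ pcD pcN mulrDl mulNr HatD ?HatN; try exact: null_pc.
  rewrite mulrDr mulrN Hat_X1n // Hat_Xn // pcD pcN pc1 mulrDl mulNr mul1r.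
  by [].
exact/null_seriesN/null_pc.
Qed.

Lemma Hat_ddw H : null_series H ->
  pc 'X * Hat (pc ('X * 'X) * ((fun u => ddw (H u)) : Q)) = - theta (Hat H).
Proof.
move=> h; apply: ncP => u; rewrite pcE /Hat pcE (hat_ddw hK) // mulrN.
rewrite ncN; congr (- _); apply: powserP => -[|n].
  by rewrite popX letM_nil /theta mul0r.
by rewrite popX [nseq n.+1 tt]/= letM_cons eqxx /theta /ddw /= size_nseq.
Qed.

End Horizontal.

Lemma sum_conv (V : nzRingType) (f g : nat -> V) N :
  \sum_(m < N.+1) \sum_(i < m.+1) f i * g (m - i)%N =
  \sum_(k < N.+1) (\sum_(i < (N - k).+1) f i) * g k.
Proof.
elim: N => [|N IH]; first by rewrite !big_ord1.
rewrite big_ord_recr IH /= [RHS]big_ord_recr /= subnn big_ord1.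
under [in RHS]eq_bigr => k _.
  rewrite subSn -1?ltnS // big_ord_recr /= mulrDl; over.
rewrite big_split /= -addrA; congr (_ + _).
rewrite (reindex_inj rev_ord_inj) big_ord_recr /= subnn subn0; congr (_ + _).
apply: eq_bigr => k _; have := ltn_ord k => hk.
by congr (f _ * g _); lia.
Qed.

Lemma sum_multiples (V : nmodType) (h : nat -> V) p n : (0 < p)%N ->
    (forall k, ~~ (p %| k)%N -> h k = 0) ->
  \sum_(k < p * n) h k = \sum_(j < n) h (p * j)%N.
Proof.
move=> p0 hh; elim: n => [|n IH]; first by rewrite muln0 !big_ord0.
rewrite mulnSr big_split_ord /= IH big_ord_recr /=; congr (_ + _).
case: p p0 hh {IH} => // p _ hh; rewrite big_ord_recl /= addn0 big1 ?addr0 // => i _.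
by apply: hh; rewrite dvdn_addr ?dvdn_mulr // gtnNdvd //= /bump add1n ltnS.
Qed.

(** * The Frobenius equation at z = 0 and its partial sums *)

Section FrobeniusExpansion.
Variables (p : nat) (K : fieldType) (abs : K -> rat).
Hypothesis p_pr : prime p.
Hypothesis hK : is_padic_field p abs.
Notation R := (ncseries bool K).
Notation Q := (ncseries bool (powser K)).
Notation pc := (@polyC_nc K).
Notation null_series := (null_series abs).
Notation Hat := (Hat abs).
Notation A := (monom K [:: lA]).
Notation B := (monom K [:: lB]).
Notation AA := (monom (powser K) [:: lA]).
Notation BB := (monom (powser K) [:: lB]).
Variables (C : R) (G : Q).
Hypothesis G_null : null_series G.
Hypothesis G_horizontal :
  frobenius_horizontal p (coefC p%:R^-1 * A) (coefC p%:R^-1 * C) G.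
Hypothesis G_at0 : coefz 0 (Hat G) = 1.

Let p_gt0 : (0 < p)%N. Proof. exact: prime_gt0. Qed.
Let p_neq0 : p%:R != 0 :> K. Proof. exact: (natr_neq0 p_pr hK). Qed.

Lemma pc_swap q r (H : Q) : pc q * (pc r * H) = pc r * (pc q * H).
Proof. by rewrite !pcA mulrC. Qed.

Lemma ext_p (f : R) : pc p%:R * extend_scalars (coefC p%:R^-1 * f) = extend_scalars f.
Proof.
by rewrite extM ext_C pcA -polyC_natr -polyCM mulfV // polyC1 pc1 mul1r.
Qed.

Let dG : Q := fun u => ddw (G u).

(** Horizontality multiplied by w, so that the derivative occurs as w^2 d/dw and translates to z by
    [Hat_ddw]. *)
Lemma G_equation :
  pc (frobQ p K) * (pc ('X + 1) * (pc ('X * 'X) * dG)) =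
    - (pc (frobQ p K) * (pc 'X * (AA * G)))
    - pc (frobQ p K) * (pc ('X + 1) * (pc 'X * (BB * G)))
    + (pc (frobQ p K) * (pc 'X * (G * extend_scalars A))
       + pc (('X + 1) ^+ p) * (pc 'X * (G * extend_scalars C))).
Proof.
have E0 : pc (formden p K) * dG = pc (form0 p K) * (AA * G) + pc (form1 p K) * (BB * G)
    - (pc (Fform0 p K) * (G * extend_scalars (coefC p%:R^-1 * A))
       + pc (Fform1 p K) * (G * extend_scalars (coefC p%:R^-1 * C))).
  rewrite -(mul_pc G (extend_scalars (_ * A))) -(mul_pc G (extend_scalars (_ * C))).
  rewrite -mulrDr (mulrA (pc (form0 p K))) (mulrA (pc (form1 p K))) -mulrDl.
  exact: G_horizontal.
have E1 : frobQ p K * (('X + 1) * ('X * 'X)) = 'X * formden p K.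
  by rewrite /formden; ring.
rewrite (pcA ('X + 1)) (pcA (frobQ p K) (_ * _)) E1 -(pcA 'X) E0.
rewrite mulrBr !mulrDr opprD -(ext_p A) -(ext_p C).
rewrite (mul_pc G (extend_scalars (_ * A))) (mul_pc G (extend_scalars (_ * C))).
congr (_ + _ + (_ + _)).
- by rewrite !pcA -mulNr -pcN; congr (pc _ * _); rewrite /form0; ring.
- by rewrite !pcA -mulNr -pcN; congr (pc _ * _); rewrite /form1; ring.
- by rewrite !pcA -mulNr -pcN; congr (pc _ * _); rewrite /Fform0; ring.
- by rewrite !pcA -mulNr -pcN; congr (pc _ * _); rewrite /Fform1; ring.
Qed.

(** Expansion in z with the common denominator (z-1)^(p+2) cleared: p factors come from [frobQ] or
    (w+1)^p, two more from w + 1 and w. *)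
Let Psi H := pc ('X - 1) * (pc ('X - 1) * (pc (('X - 1) ^+ p) * Hat H)).

Lemma PsiD H H' : null_series H -> null_series H' -> Psi (H + H') = Psi H + Psi H'.
Proof. by move=> h h'; rewrite /Psi (HatD hK) // !mulrDr. Qed.

Lemma PsiN H : null_series H -> Psi (- H) = - Psi H.
Proof. by move=> h; rewrite /Psi (HatN hK) // !mulrN. Qed.

Lemma Psi_frobQ_X H : null_series H -> Psi (pc (frobQ p K) * (pc 'X * H)) =
  pc (('X - 1) * ('X^p - 1)) * Hat H.
Proof.
move=> h; rewrite /Psi (Hat_frobQ hK); last exact: (null_pc hK).
by rewrite [X in pc _ * X]pc_swap (Hat_X hK) // pcA.
Qed.

Lemma Psi_frobQ_X1X H : null_series H ->
  Psi (pc (frobQ p K) * (pc ('X + 1) * (pc 'X * H))) = pc ('X * ('X^p - 1)) * Hat H.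
Proof.
move=> h; have hX := null_pc hK 'X h.
rewrite /Psi (Hat_frobQ hK); last exact: (null_pc hK).
rewrite [X in pc _ * X]pc_swap (Hat_X1 hK) // pc_swap [X in pc _ * X]pc_swap.
by rewrite (Hat_X hK) // pcA mulrC.
Qed.

Lemma Psi_X1p_X H : null_series H -> Psi (pc (('X + 1) ^+ p) * (pc 'X * H)) =
  pc (('X - 1) * 'X^p) * Hat H.
Proof.
move=> h; rewrite /Psi (Hat_X1n hK); last exact: (null_pc hK).
by rewrite [X in pc _ * X]pc_swap (Hat_X hK) // pcA.
Qed.

Lemma Psi_dG : Psi (pc (frobQ p K) * (pc ('X + 1) * (pc ('X * 'X) * dG))) =
  - (pc (('X - 1) * ('X^p - 1)) * theta (Hat G)).
Proof.
have nd : null_series dG by move=> u; exact: (null_powser_ddw hK).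
have hX := null_pc hK ('X * 'X) nd.
rewrite /Psi (Hat_frobQ hK); last exact: (null_pc hK).
rewrite [X in pc _ * X]pc_swap (Hat_X1 hK) // (Hat_ddw hK) // !mulrN.
by rewrite pcA.
Qed.

(** The cleared form of theta G = A G + z/(z-1) B G - G (A + z^p/(z^p-1) C). The factors 1/p of the
    inverse Frobenius have cancelled against the factors p of the pulled-back forms. *)
Lemma Hat_equation :
  pc (('X - 1) * ('X^p - 1)) * theta (Hat G) =
    pc (('X - 1) * ('X^p - 1)) * (AA * Hat G)
  + pc ('X * ('X^p - 1)) * (BB * Hat G)
  - (pc (('X - 1) * ('X^p - 1)) * (Hat G * extend_scalars A)
     + pc (('X - 1) * 'X^p) * (Hat G * extend_scalars C)).
Proof.
have nA := null_letter hK lA G_null; have nB := null_letter hK lB G_null.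
have nEA := null_ext hK A G_null; have nEC := null_ext hK C G_null.
have npc q H := null_pc hK q (H := H).
have nN H := null_seriesN hK (H := H); have nD H H' := null_seriesD hK (H := H) (H' := H').
have := congr1 Psi G_equation; rewrite Psi_dG PsiD; first last.
- by apply: (nD); apply: (npc); apply: (npc).
- by apply: (nD); apply: (nN); apply: (npc); apply: (npc); [|apply: (npc)].
rewrite PsiD; first last.
- by apply: (nN); apply: (npc); apply: (npc); apply: (npc).
- by apply: (nN); apply: (npc); apply: (npc).
rewrite (PsiN (npc _ _ (npc _ _ nA))) (PsiN (npc _ _ (npc _ _ (npc _ _ nB)))).
rewrite (PsiD (npc _ _ (npc _ _ nEA)) (npc _ _ (npc _ _ nEC))).
rewrite (Psi_frobQ_X nA) (Psi_frobQ_X1X nB) (Psi_frobQ_X nEA) (Psi_X1p_X nEC).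
rewrite !(Hat_letter hK) !(Hat_ext hK) // => E.
by apply: oppr_inj; rewrite E opprB opprD addrC.
Qed.

Fixpoint frob_product n : R :=
  if n is n'.+1 then (1 - resolvent (p * n)%:R * C) * frob_product n' else 1.

Definition frob_term n : R :=
  if n is n'.+1 then frob_product n - frob_product n' else 1.

Lemma frob_termE n : (coefC (p * n.+1)%:R - A) * frob_term n.+1 = - (C * frob_product n).
Proof.
rewrite /= (_ : _ - frob_product n = - (resolvent (p * n.+1)%:R * C * frob_product n)).
  rewrite mulrN !mulrA resolventV ?mul1r //.
  by apply: (natr_neq0 p_pr hK); rewrite muln_gt0 p_gt0.
by rewrite mulrBl mul1r addrAC subrr add0r.
Qed.

Lemma frob_product_sum n : frob_product n = \sum_(j < n.+1) frob_term j.
Proof.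
elim: n => [|n IH]; first by rewrite big_ord1.
by rewrite big_ord_recr /= -IH addrC subrK.
Qed.

(** A series in z^p, horizontal modulo the left ideal generated by A for the pulled-back connection;
    the factor z^A of a true solution is invisible there. *)
Definition frob_series : Q := fun u v =>
  if (p %| size v)%N then frob_term (size v %/ p) u else 0.

Lemma coefz_frob_series n :
  coefz n frob_series = if (p %| n)%N then frob_term (n %/ p) else 0.
Proof. by apply: ncP => u; rewrite /coefz /frob_series size_nseq; case: ifP. Qed.

Lemma coefz_Xp1 n (H : Q) : coefz n (pc ('X^p - 1) * H) =
  (if (p <= n)%N then coefz (n - p) H else 0) - coefz n H.
Proof. by rewrite pcD pcN pc1 mulrBl mul1r coefzD coefzN coefz_Xn. Qed.

Lemma coefz_AA n : coefz n AA = if n == 0%N then A else 0.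
Proof.
rewrite -ext_letter; apply: ncP => u; rewrite /coefz /extend_scalars /coefC.
by case: n.
Qed.

(** The summand [AA] balances the coefficient of z^0, where [theta] gives 0, and belongs to the left
    ideal. For the others, z^p/(z^p-1) = - (z^p + z^(2p) + ...) produces partial sums, which is the
    recursion [frob_termE]. *)
Lemma frob_series_equation :
  pc ('X^p - 1) * (theta frob_series - AA * frob_series + AA) =
  pc 'X^p * (extend_scalars C * frob_series).
Proof.
pose t : Q := theta frob_series - AA * frob_series + AA.
have t0 n : ~~ (p %| n)%N -> coefz n t = 0.
  move=> hn; rewrite /t !coefzD coefzN coefz_theta coefz_letter coefz_frob_series.
  rewrite (negbTE hn) !mulr0 subrr add0r coefz_AA.
  by case: n hn => //; rewrite dvdn0.
have tp j : coefz (p * j.+1) t = - (C * frob_product j).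
  rewrite /t !coefzD coefzN coefz_theta coefz_letter coefz_frob_series dvdn_mulr //.
  rewrite mulKn // coefz_AA muln_eq0 (gtn_eqF p_gt0) /= addr0 -mulrBl.
  exact: frob_termE.
have t00 : coefz 0 t = 0.
  rewrite /t !coefzD coefzN coefz_theta coefz_letter coefz_frob_series dvdn0.
  by rewrite div0n coefz_AA /= !mulr1 coefC0 sub0r addNr.
apply: coefzP => n; rewrite -/t coefz_Xp1 coefz_Xn coefz_extl coefz_frob_series.
have [/dvdnP[j ->]|hn] := boolP (p %| n)%N; last first.
  rewrite (t0 n) // subr0; case: leqP => // pn.
  have hn' : ~~ (p %| n - p)%N by rewrite dvdn_subl.
  by rewrite t0 // (negbTE hn') mulr0.
case: j => [|j]; first by rewrite mul0n leqNgt p_gt0 /= t00 subr0.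
rewrite leq_pmull // mulSn addKn dvdn_mull // mulnK // -mulSn [(j.+1 * p)%N]mulnC tp opprK.
case: j => [|j]; first by rewrite mul0n t00 add0r.
by rewrite mulnC tp addrC /= mulrBr.
Qed.

Let L : Q := Hat G * frob_series.

(** In the product the pulled-back connection cancels. What is left is the universal one, up to Hat
    G * A in the left ideal. *)
Lemma L_equation : pc ('X - 1) * theta L =
  pc ('X - 1) * (AA * L) + pc 'X * (BB * L) - pc ('X - 1) * (Hat G * AA).
Proof.
(* [pc_inj] asks for constant term 1, hence 1 - z^p rather than z^p - 1. *)
apply: (@pc_inj _ (1 - 'X^p)).
  by rewrite coefB coef1 coefXn (ltn_eqF p_gt0) subr0.
have E1 : theta frob_series = (theta frob_series - AA * frob_series + AA)
     + (AA * frob_series - AA) by rewrite addrACA subrK subrr addr0.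
have E2 : pc ('X^p - 1) * theta L = pc ('X^p - 1) * (theta (Hat G) * frob_series)
     + Hat G * (pc 'X^p * (extend_scalars C * frob_series))
     + pc ('X^p - 1) * (Hat G * (AA * frob_series - AA)).
  rewrite /L thetaM mulrDr -addrA; congr (_ + _).
  rewrite -frob_series_equation -[in RHS]mul_pc -mulrDr -mulrDr -E1.
  by rewrite mul_pc.
have E3 : pc ('X - 1) * (pc ('X^p - 1) * (theta (Hat G) * frob_series)) =
    pc (('X - 1) * ('X^p - 1)) * (AA * L) + pc ('X * ('X^p - 1)) * (BB * L)
  - (pc (('X - 1) * ('X^p - 1)) * (Hat G * (AA * frob_series))
     + pc (('X - 1) * 'X^p) * (Hat G * (extend_scalars C * frob_series))).
  rewrite pcA mulrA Hat_equation /L ext_letter.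
  move: (('X - 1) * ('X^p - 1)) ('X * ('X^p - 1)) (('X - 1) * 'X^p) => q1 q2 q3.
  by rewrite mulrBl !mulrDl -!mulrA.
have neg q (H : Q) : pc (1 - 'X^p) * (pc q * H) = - (pc (q * ('X^p - 1)) * H).
  by rewrite pcA -mulNr -pcN; congr (pc _ * _); ring.
have E4 : pc (('X - 1) * ('X^p - 1)) * theta L =
    pc (('X - 1) * ('X^p - 1)) * (AA * L) + pc ('X * ('X^p - 1)) * (BB * L)
    - pc (('X - 1) * ('X^p - 1)) * (Hat G * AA).
  rewrite -pcA E2 2!mulrDr E3 mul_pc !pcA.
  move: (('X - 1) * ('X^p - 1)) ('X * ('X^p - 1)) (('X - 1) * 'X^p) => q1 q2 q3.
  rewrite (mulrBr (Hat G)) (mulrBr (pc q1)) opprD.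
  move: (pc q1 * (Hat G * (AA * _))) (pc q3 * _) => x y.
  by rewrite !addrA !subrK.
rewrite mulrBr mulrDr !neg E4.
move: (('X - 1) * ('X^p - 1)) ('X * ('X^p - 1)) => q1 q2.
by rewrite opprB opprD opprK addrC.
Qed.

Definition partial_sums : Q := fun u v => \sum_(m < (size v).+1) coefz m L u.

Lemma coefz_partial_sums n : coefz n partial_sums = \sum_(m < n.+1) coefz m L.
Proof. by apply: ncP => u; rewrite nc_sum /coefz /partial_sums size_nseq. Qed.

Lemma partial_sumsE : L = pc (1 - 'X) * partial_sums.
Proof.
apply: coefzP => n; rewrite pcD pcN pc1 mulrBl mul1r coefzD coefzN coefz_X.
rewrite coefz_partial_sums; case: n => [|n]; first by rewrite big_ord1 subr0.
by rewrite coefz_partial_sums big_ord_recr /= addrAC subrr add0r.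
Qed.

(** z/(z-1) L is - z times the series of partial sums, so a single partial sum enters the n-th
    coefficient. *)
Lemma L_recursion n : (coefC n%:R - A) * coefz n L =
  (if n is n'.+1 then - (B * coefz n' partial_sums) else 0) - coefz n (Hat G) * A.
Proof.
have E : theta L = AA * L - pc 'X * (BB * partial_sums) - Hat G * AA.
  apply: (@pc_inj _ (1 - 'X)); first by rewrite coefB coef1 coefX subr0.
  have E1 : BB * L = pc (1 - 'X) * (BB * partial_sums).
    by rewrite -mul_pc -partial_sumsE.
  have := L_equation; rewrite E1.
  have -> : pc ('X - 1) = - pc (1 - 'X) by rewrite -pcN opprB.
  rewrite pc_swap !mulNr => /(congr1 (fun H => - H)).
  by rewrite opprK => ->; rewrite !mulrBr !opprD !opprK.
have := congr1 (coefz n) E.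
have GA : coefz n (Hat G * AA) = coefz n (Hat G) * A by rewrite -ext_letter coefz_ext.
rewrite coefz_theta !coefzD !coefzN coefz_letter coefz_X GA.
rewrite mulrBl => ->; rewrite addrC !addrA addNr add0r.
by case: n {GA} => [|n]; rewrite ?coefz_letter // oppr0.
Qed.

Lemma partial_sums_harmonic n :
  eqmodA (coefz n partial_sums) (harmonic_product K n).
Proof.
have L0 : coefz 0 L = 1.
  by rewrite coefzM big_ord1 G_at0 mul1r coefz_frob_series dvdn0 div0n.
elim: n => [|n IH]; first by rewrite coefz_partial_sums big_ord1 L0.
have n0 : n.+1%:R != 0 :> K by exact: (natr_neq0 p_pr hK).
have E := L_recursion n.+1.
have {}E : coefz n.+1 L = - (resolvent n.+1%:R * B * coefz n partial_sums)
    - resolvent n.+1%:R * coefz n.+1 (Hat G) * A.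
  by rewrite -[LHS]mul1r -(resolventK n0) -(mulrA (resolvent _)) E mulrBr mulrN !mulrA.
rewrite coefz_partial_sums big_ord_recr /= -coefz_partial_sums E mulrBl mul1r.
apply: (@eqmodA_trans _ (coefz n partial_sums - resolvent n.+1%:R * B * coefz n partial_sums)).
  rewrite addrA; apply: (@eqmodA_trans _ (coefz n partial_sums
    - resolvent n.+1%:R * B * coefz n partial_sums + 0)); last by rewrite addr0.
  apply: eqmodA_add => //; rewrite -oppr0; apply: eqmodA_opp; exact: eqmodA0.
by apply: eqmodA_add => //; apply/eqmodA_opp/eqmodA_mul.
Qed.

(** Cutting just before p (n + 1) makes all inner sums end at an index congruent to p - 1, so that
    one residue class modulo p has to be interpolated. *)
Lemma coefz_partial_sums_block n : coefz (p * n + p.-1) partial_sums =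
  \sum_(j < n.+1) (\sum_(i < (p * (n - j) + p.-1).+1) coefz i (Hat G)) * frob_term j.
Proof.
rewrite coefz_partial_sums; under eq_bigr do rewrite coefzM.
rewrite (sum_conv (fun i => coefz i (Hat G)) (fun k => coefz k frob_series)).
have E : (p * n + p.-1).+1 = (p * n.+1)%N by rewrite mulnS -addnS prednK // addnC.
rewrite E (sum_multiples (h := fun k => (\sum_(i < (p * n + p.-1 - k).+1) coefz i (Hat G))
  * coefz k frob_series)) // => [|k hk]; last first.
  by rewrite coefz_frob_series (negbTE hk) mulr0.
apply: eq_bigr => j _; rewrite coefz_frob_series dvdn_mulr // mulKn //.
by rewrite mulnBr addnBAC // leq_mul2l -ltnS ltn_ord orbT.
Qed.

End FrobeniusExpansion.

(** * Interpolation in n *)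

Section PolynomialFunctions.
Variables (p : nat) (K : fieldType) (abs : K -> rat).
Hypothesis hK : is_padic_field p abs.
Implicit Types f g : nat -> K.

(** Functions killed by d + 1 successive differences, that is polynomials of degree at most d in
    characteristic 0. *)
Fixpoint polyfun (d : nat) f : Prop :=
  if d is d'.+1 then polyfun d' (fun n => f n.+1 - f n) else forall n, f n = f 0%N.

Lemma eq_polyfun d f g : f =1 g -> polyfun d f -> polyfun d g.
Proof. by move=> /funext ->. Qed.

Lemma polyfun0 d : polyfun d (fun=> 0).
Proof. by elim: d => //= d; apply: eq_polyfun => n; rewrite subrr. Qed.

Lemma polyfun_cst d c : polyfun d (fun=> c).
Proof. by case: d => //= d; apply: eq_polyfun (polyfun0 d) => n; rewrite subrr. Qed.

Lemma polyfunD d f g : polyfun d f -> polyfun d g -> polyfun d (fun n => f n + g n).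
Proof.
elim: d f g => [|d IH] f g /= hf hg; first by move=> n; rewrite hf hg.
by apply: eq_polyfun (IH _ _ hf hg) => n; rewrite opprD addrACA.
Qed.

Lemma polyfunZ d c f : polyfun d f -> polyfun d (fun n => c * f n).
Proof.
elim: d f => [|d IH] f /= hf; first by move=> n; rewrite hf.
by apply: eq_polyfun (IH _ hf) => n; rewrite mulrBr.
Qed.

Lemma polyfun_sum d I (r : seq I) (F : I -> nat -> K) :
  (forall i, polyfun d (F i)) -> polyfun d (fun n => \sum_(i <- r) F i n).
Proof.
move=> hF; elim: r => [|i r IH].
  by apply: eq_polyfun (polyfun0 d) => n; rewrite big_nil.
by apply: eq_polyfun (polyfunD (hF i) IH) => n; rewrite big_cons.
Qed.

Lemma polyfunS d f : polyfun d f -> polyfun d.+1 f.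
Proof.
elim: d f => [|d IH] f; last by move=> /= /IH.
by move=> hf n; rewrite !hf.
Qed.

Lemma polyfun_shift d f : polyfun d f -> polyfun d (fun n => f n.+1).
Proof.
elim: d f => [|d IH] f; first by move=> hf n; rewrite !hf.
by move=> /= /IH.
Qed.

Lemma polyfunX d f : polyfun d f -> polyfun d.+1 (fun n => n%:R * f n).
Proof.
elim: d f => [|d IH] f hf.
  move=> n /=; rewrite !(hf _.+1) (hf n) -!mulrBl; congr (_ * _).
  by rewrite -!natr1; ring.
apply: eq_polyfun (polyfunD (IH _ hf) (polyfun_shift hf)) => n.
by rewrite -natr1; ring.
Qed.

(* Newton interpolation at 0, ..., d has integral coefficients. *)
Lemma polyfun_bound d f M : polyfun d f ->
  (forall n, (n <= d)%N -> abs (f n) <= M) -> forall n, abs (f n) <= M.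
Proof.
elim: d f => [|d IH] f hf hM n; first by rewrite hf hM.
elim: n => [|n IHn]; first exact: hM.
rewrite -[f n.+1](subrK (f n)); apply: (absD_le hK) => //.
apply: (IH (fun n => f n.+1 - f n)) => // m hm.
by apply: (absB_le hK); apply: hM => //; exact: leqW.
Qed.

Definition multiset_span k f := exists c : nat -> K,
  (forall l, abs (c l) <= 1) /\
  forall m, f m = \sum_(l < k.+1) c l * (multiset l.+1 m)%:R.

Lemma eq_multiset_span k f g : f =1 g -> multiset_span k f -> multiset_span k g.
Proof. by move=> /funext ->. Qed.

Lemma multiset_spanD k f g : multiset_span k f -> multiset_span k g ->
  multiset_span k (fun n => f n + g n).
Proof.
move=> [c [hc Ec]] [d [hd Ed]]; exists (fun l => c l + d l); split.
  by move=> l; exact: (absD_le hK).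
by move=> m; rewrite Ec Ed -big_split; apply: eq_bigr => l _; rewrite mulrDl.
Qed.

Lemma multiset_spanN k f : multiset_span k f -> multiset_span k (fun n => - f n).
Proof.
move=> [c [hc Ec]]; exists (fun l => - c l); split.
  by move=> l; rewrite (absN hK).
by move=> m; rewrite Ec -sumrN; apply: eq_bigr => l _; rewrite mulNr.
Qed.

Lemma multiset_span_sum k n (F : nat -> nat -> K) :
    (forall i, (i < n)%N -> multiset_span k (F i)) ->
  multiset_span k (fun m => \sum_(i < n) F i m).
Proof.
elim: n => [|n IH] hF.
  exists (fun=> 0); split=> [l|m]; first by rewrite (abs0 hK).
  by rewrite big_ord0 big1 // => l _; rewrite mul0r.
have h := multiset_spanD (IH (fun i hi => hF i (ltnW hi))) (hF n (ltnSn n)).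
by apply: eq_multiset_span h => m; rewrite big_ord_recr.
Qed.

Lemma multiset_spanS k f : multiset_span k f -> multiset_span k.+1 f.
Proof.
move=> [c [hc Ec]]; exists (fun l => if (l < k.+1)%N then c l else 0); split.
  by move=> l; case: ifP => // _; rewrite (abs0 hK).
move=> m; rewrite Ec [RHS]big_ord_recr /= ltnn mul0r addr0.
by apply: eq_bigr => l _; rewrite ltn_ord.
Qed.

Lemma multiset_span_cumul k f : multiset_span k f ->
  multiset_span k.+1 (fun m => \sum_(i < m.+1) f i).
Proof.
move=> [c [hc Ec]]; exists (fun l => if l is l'.+1 then c l' else 0); split.
  by case=> // ; rewrite (abs0 hK).
move=> m; rewrite [RHS]big_ord_recl mul0r add0r.
under eq_bigr do rewrite Ec.
rewrite exchange_big; apply: eq_bigr => l _; rewrite -mulr_sumr; congr (_ * _).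
by rewrite lift0 [in RHS]/= natr_sum.
Qed.

(* The section by residue classes mod p of the expansion of (1 - z)^(-k). *)
Lemma multiset_section k i : (i < p)%N ->
  multiset_span k (fun m => (multiset k.+1 (p * m + i))%:R).
Proof.
elim: k i => [|k IH] i hi.
  exists (fun=> 1); split=> [l|m]; first by rewrite (abs1 hK).
  by rewrite big_ord1 !multiset1 mul1r.
pose F i m : K := (multiset k.+1 (p * m + i))%:R.
have h1 : multiset_span k (fun m => \sum_(i < p) F i m) by exact: multiset_span_sum.
have h2 : multiset_span k (fun m => \sum_(j < i.+1) F j m).
  by apply: multiset_span_sum => j ji; apply: IH; exact: leq_trans hi.
(* The sum up to p m + i consists of the blocks of length p up to and including block m, minus block
   m, plus the first i + 1 terms of block m. *)
have := multiset_spanD (multiset_span_cumul h1)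
  (multiset_spanS (multiset_spanD (multiset_spanN h1) h2)).
apply: eq_multiset_span => m; rewrite addrA.
rewrite big_ord_recr /= addrK.
have -> : (\sum_(m0 < (p * m + i).+1) multiset k.+1 m0)%:R =
   \sum_(m0 < (p * m + i).+1) (multiset k.+1 m0)%:R :> K by rewrite natr_sum.
rewrite -addnS big_split_ord /=; congr (_ + _).
elim: m => [|m IHm]; first by rewrite muln0 !big_ord0.
by rewrite mulnSr big_split_ord /= big_ord_recr /= IHm.
Qed.

End PolynomialFunctions.

(** * Bounds for series on words of bounded length *)

Section GeometricBound.
Variables (p : nat) (K : fieldType) (abs : K -> rat).
Hypothesis hK : is_padic_field p abs.
Notation R := (ncseries bool K).
Implicit Types (f g : R) (rho : rat).
Let absM x y : abs (x * y) = abs x * abs y. Proof. exact: padicM hK x y. Qed.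
Let abs_ge0 x : 0 <= abs x. Proof. exact: padic_ge0 hK x. Qed.

(** Weighting by the length makes the bound stable under products, and under inverses of series with
    constant term 1, with no loss of constants. *)
Definition geom_bounded d rho f := forall u, (size u <= d)%N -> abs (f u) <= rho ^+ size u.

Lemma geom_bounded1 d rho : 0 <= rho -> geom_bounded d rho 1.
Proof.
move=> h [|a u] _; first by rewrite nc1 (abs1 hK).
by rewrite nc1 (abs0 hK) exprn_ge0.
Qed.

Lemma geom_boundedM d rho f g : 0 <= rho ->
  geom_bounded d rho f -> geom_bounded d rho g -> geom_bounded d rho (f * g).
Proof.
move=> h hf hg u hu; apply: (abs_sum_le hK) => [|i _]; first exact: exprn_ge0.
rewrite absM -[in X in _ <= X](cat_take_drop i u) size_cat exprD.
have h1 : (size (take i u) <= d)%N by apply: leq_trans hu; rewrite size_take_min geq_minr.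
have h2 : (size (drop i u) <= d)%N by apply: leq_trans hu; rewrite size_drop leq_subr.
by apply: ler_pM => //; [exact: hf | exact: hg].
Qed.

Lemma geom_boundedX d rho f n : 0 <= rho ->
  geom_bounded d rho f -> geom_bounded d rho (f ^+ n).
Proof.
move=> h hf; elim: n => [|n IH]; first exact: geom_bounded1.
by rewrite exprS; exact: geom_boundedM.
Qed.

Lemma geom_boundedV d rho f : 0 <= rho -> f [::] = 1 ->
  geom_bounded d rho f -> geom_bounded d rho (ncinv f).
Proof.
move=> h f1 hf u hu; apply: (abs_sum_le hK) => [|i _]; first exact: exprn_ge0.
apply: (@geom_boundedX d rho (1 - f) i h) => // -[|a w] hw.
  by rewrite ncB f1 nc1 subrr (abs0 hK).
by rewrite ncB nc1 sub0r (absN hK); exact: hf.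
Qed.

Lemma words_bound d f : exists M, forall u, (size u <= d)%N -> abs (f u) <= M.
Proof.
elim: d f => [|d IH] f; first by exists (abs (f [::])) => -[].
have [M1 h1] := IH (lder true f); have [M2 h2] := IH (lder false f).
exists (Num.max (abs (f [::])) (Num.max M1 M2)) => -[|[] u] /= hu.
- by rewrite le_max lexx.
- by rewrite !le_max (h1 u) ?orbT.
- by rewrite !le_max (h2 u) ?orbT.
Qed.

End GeometricBound.

(** * Iterated sums of the Frobenius product *)

Section Transfer.
Variables (p : nat) (K : fieldType) (abs : K -> rat).
Hypothesis p_pr : prime p.
Hypothesis hK : is_padic_field p abs.
Notation R := (ncseries bool K).
Notation A := (monom K [:: lA]).
Notation tends := (tends abs).
Notation geom_bounded := (geom_bounded abs).
Variable C : R.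
Hypothesis C_nil : C [::] = 0.
Let absM x y : abs (x * y) = abs x * abs y. Proof. exact: padicM hK x y. Qed.
Let abs_ge0 x : 0 <= abs x. Proof. exact: padic_ge0 hK x. Qed.
Let p_gt0 : (0 < p)%N. Proof. exact: prime_gt0. Qed.
Let cst (x : K) : R := coefC x.

Let scalar_neq0 l : (p * l.+1)%:R != 0 :> K.
Proof. by apply: (natr_neq0 p_pr hK); rewrite muln_gt0 p_gt0. Qed.

Definition unitC l : R := 1 - cst (p * l.+1)%:R^-1 * C.

Lemma unitC_nil l : unitC l [::] = 1.
Proof. by rewrite /unitC ncB nc1 coefCM C_nil mulr0 subr0. Qed.

Definition invC l : R := ncinv (unitC l) * cst (p * l.+1)%:R^-1.

Lemma invCK l f : invC l * ((cst (p * l.+1)%:R - C) * f) = f.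
Proof.
rewrite mulrA /invC -(mulrA (ncinv _)) (_ : cst _ * (_ - _) = unitC l).
  by rewrite ncmulVf ?mul1r ?unitC_nil.
by rewrite mulrBr coefC_comp mulVf // coefC1.
Qed.

(* transfer l n expresses the l-fold iterated sums of the terms of the product
   frob_product at n through the product itself, modulo A on the right. *)
Fixpoint transfer l n : R :=
  if l is l'.+1 then
    invC l' * ((cst (p * n + p * l)%:R - A - C) * transfer l' n)
  else 1.

Fixpoint iterated_sum l n : R :=
  if l is l'.+1 then \sum_(m < n.+1) iterated_sum l' m else frob_term p C n.

Lemma iterated_sumS l n :
  iterated_sum l.+1 n.+1 = iterated_sum l.+1 n + iterated_sum l n.+1.
Proof. by rewrite /= big_ord_recr. Qed.

Lemma iterated_sum0 l : iterated_sum l 0 = 1.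
Proof. by elim: l => //= l IH; rewrite big_ord1. Qed.

(** Let x = z^p and let F be the series with coefficients [frob_term]. [iterated_sum l] gives the
    coefficients of (1-x)^(-l) F, and the relation is the coefficient of x^n in the differential
    equation of that series, with x/(1-x) = 1/(1-x) - 1. The inhomogeneous term lies in the left
    ideal of A. *)
Lemma iterated_sum_step l n :
  eqmodA ((cst (p * l)%:R - C) * iterated_sum l.+1 n)
         ((cst (p * n + p * l)%:R - A - C) * iterated_sum l n).
Proof.
have at0 k : eqmodA ((cst (p * k)%:R - C) * 1) ((cst (p * 0 + p * k)%:R - A - C) * 1).
  rewrite !mulr1 muln0 add0n addrAC.
  apply: (@eqmodA_trans _ (cst (p * k)%:R - C + 0)); first by rewrite addr0.
  apply: eqmodA_add => //; rewrite -oppr0; apply/eqmodA_opp/eqmodA_sym.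
  by rewrite -[A]mul1r; exact: eqmodA0.
elim: l n => [|l IHl] n.
  case: n => [|n]; first by rewrite !iterated_sum0; exact: at0.
  rewrite muln0 addn0 /cst coefC0 sub0r.
  rewrite -[iterated_sum 1 n.+1]/(\sum_(m < n.+2) frob_term p C m) -frob_product_sum.
  rewrite -[iterated_sum 0 n.+1]/(frob_term p C n.+1) mulrBl (frob_termE p_pr hK).
  rewrite (_ : frob_product p C n.+1 = frob_product p C n + frob_term p C n.+1).
    by rewrite mulrDr !mulNr.
  by rewrite [frob_term _ _ _]/= addrC subrK.
elim: n => [|n IHn]; first by rewrite !iterated_sum0; exact: at0.
have E1 : (cst (p * l.+1)%:R - C) * iterated_sum l.+2 n.+1 =
   (cst (p * l.+1)%:R - C) * iterated_sum l.+2 n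
   + (cst (p * l.+1)%:R - C) * iterated_sum l.+1 n.+1.
  by rewrite (iterated_sumS l.+1) [LHS]mulrDr.
rewrite E1; apply: (@eqmodA_trans _ ((cst (p * n + p * l.+1)%:R - A - C) * iterated_sum l.+1 n
   + (cst (p * l.+1)%:R - C) * iterated_sum l.+1 n.+1)).
  exact: eqmodA_add.
have E2 : iterated_sum l.+1 n = iterated_sum l.+1 n.+1 - iterated_sum l n.+1.
  by rewrite iterated_sumS addrK.
have E3 : (p * n + p * l.+1 = p * n.+1 + p * l)%N by rewrite !mulnS; lia.
have IH := IHl n.+1; rewrite -E3 in IH; set a := (p * n + p * l.+1)%N in IH *.
have -> : (p * n.+1 + p * l.+1 = a + p)%N by rewrite /a mulnS; lia.
rewrite E2 mulrBr.
apply: (@eqmodA_trans _ ((cst a%:R - A - C) * iterated_sum l.+1 n.+1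
   - (cst (p * l)%:R - C) * iterated_sum l.+1 n.+1
   + (cst (p * l.+1)%:R - C) * iterated_sum l.+1 n.+1)).
  by apply: eqmodA_add => //; apply: eqmodA_add => //; apply/eqmodA_opp/eqmodA_sym.
rewrite -mulrBl -mulrDl.
rewrite (_ : cst a%:R - A - C - (cst (p * l)%:R - C) + (cst (p * l.+1)%:R - C)
   = cst (a + p)%:R - A - C) //.
have -> : cst (a + p)%:R = cst a%:R + cst p%:R by rewrite natrD /cst coefCD.
have -> : cst (p * l.+1)%:R = cst p%:R + cst (p * l)%:R by rewrite mulnS natrD /cst coefCD.
move: (cst a%:R) (cst p%:R) (cst (p * l)%:R) => x y z.
rewrite opprB !addrA subrK -(addrA _ y z) (addrC y z) addrA subrK.
by rewrite [x - A + y]addrAC.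
Qed.

Lemma iterated_sum_transfer l n :
  eqmodA (iterated_sum l.+1 n) (transfer l n * frob_product p C n).
Proof.
elim: l => [|l IH]; first by rewrite mul1r frob_product_sum.
apply: (@eqmodA_trans _ (invC l * ((cst (p * n + p * l.+1)%:R - A - C) * iterated_sum l.+1 n))).
  rewrite -[X in eqmodA X](invCK l); apply: eqmodA_mul.
  exact: iterated_sum_step.
by rewrite /= -!(mulrA (invC l)) -mulrA; do 2 apply: eqmodA_mul.
Qed.

Lemma iterated_sumE l n :
  iterated_sum l n = \sum_(j < n.+1) cst (multiset l (n - j))%:R * frob_term p C j.
Proof.
elim: l n => [|l IH] n.
  rewrite big_ord_recr /= subnn /cst coefC1 mul1r big1 ?add0r // => j _.
  by rewrite subn_eq0 leqNgt ltn_ord /= coefC0 mul0r.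
rewrite /=; under eq_bigr do rewrite IH.
transitivity (\sum_(m < n.+1) \sum_(i < m.+1) cst (multiset l i)%:R * frob_term p C (m - i)).
  apply: eq_bigr => m _; rewrite (reindex_inj rev_ord_inj); apply: eq_bigr => i _ /=.
  by rewrite subSS subKn // -ltnS.
rewrite (sum_conv (fun i => cst (multiset l i)%:R)); apply: eq_bigr => j _.
by rewrite natr_sum /cst coefC_sum.
Qed.

Lemma polyfun_transfer l u : polyfun l (fun n => transfer l n u).
Proof.
elim: l u => [|l IH] u; first exact: polyfun_cst.
have mulc k (f : R) (F : nat -> R) : (forall u, polyfun k (fun n => F n u)) ->
    forall u, polyfun k (fun n => (f * F n) u).
  by move=> hF w; apply: polyfun_sum => i; apply: polyfunZ.
apply: (mulc) => {}u.
have E n : ((cst (p * n + p * l.+1)%:R - A - C) * transfer l n) u =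
    p%:R * (n%:R * transfer l n u) + ((cst (p * l.+1)%:R - A - C) * transfer l n) u.
  rewrite natrD /cst coefCD -!addrA mulrDl ncD coefCM natrM mulrA.
  by [].
apply: eq_polyfun (fun n => esym (E n)) _; apply: polyfunD.
  exact/polyfunZ/polyfunX.
by apply: polyfunS; apply: (mulc).
Qed.

Lemma tends_transfer l u (s : nat -> nat) n :
    tends (fun r => (s r)%:R) n%:R ->
  tends (fun r => transfer l (s r) u) (transfer l n u).
Proof.
move=> hs; elim: l u => [|l IH] u; first exact: (tends_cst hK).
have mul (F F' : nat -> R) (f f' : R) : (forall u, tends (fun r => F r u) (f u)) ->
    (forall u, tends (fun r => F' r u) (f' u)) ->
    forall u, tends (fun r => (F r * F' r) u) ((f * f') u).
  by move=> h h' w; apply: (tends_sum hK) => i _; exact: (tendsM hK).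
apply: (mul) => {}u; first exact: (tends_cst hK).
apply: (mul) => {}u //; apply: (tendsD hK); last exact: (tends_cst hK).
apply: (tendsD hK); last exact: (tends_cst hK).
case: u => [|a u]; last exact: (tends_cst hK).
have E (m : nat) : cst (p * m + p * l.+1)%:R [::] = p%:R * m%:R + (p * l.+1)%:R.
  by rewrite /cst coefC_nil natrD natrM.
rewrite E; apply: eq_tends (fun r => esym (E (s r))) _; apply: (tendsD hK).
  exact: (tendsM hK (tends_cst hK _)).
exact: (tends_cst hK).
Qed.

(** Being polynomial of degree at most l in n, [transfer l n u] need only be bounded for n <= l.
    There the scalar parts of the factors (p n + p j - A - C) and (p j - C)^(-1) combine to a
    binomial coefficient, of absolute value at most 1. The remaining factors have constant term 1
    and denominators linear in l, so each letter costs at most a factor linear in l. *)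
Lemma transfer_bound d : exists2 M : rat, 1 <= M & forall l n u, (size u <= d)%N ->
  abs (transfer l n u) <= (M * l.+1%:R) ^+ d.
Proof.
have [M1 hM1] := words_bound abs d C.
have [M2 hM2] := words_bound abs d (A + C).
pose M0 := Num.max 1 (Num.max M1 M2).
have M0_1 : 1 <= M0 by rewrite le_max lexx.
have M0_C u : (size u <= d)%N -> abs (C u) <= M0 by move=> /hM1 h; rewrite !le_max h orbT.
have M0_AC u : (size u <= d)%N -> abs ((A + C) u) <= M0 by move=> /hM2 h; rewrite !le_max h !orbT.
(* The denominators met below are at most 2 p (l + 1). *)
exists (M0 * (2 * p)%:R); first by rewrite mulr_ege1 // ler1n muln_gt0 p_gt0.
move=> l n u hu.
pose rho := M0 * (2 * p)%:R * l.+1%:R.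
have rho1 : 1 <= rho by rewrite !mulr_ege1 // ?ler1n // muln_gt0 p_gt0.
have rho0 : 0 <= rho := le_trans ler01 rho1.
suff H m : (m <= l)%N -> abs (transfer l m u) <= rho ^+ size u.
  apply: le_trans (polyfun_bound hK (polyfun_transfer l u) H n) _.
  exact: ler_weXn2l.
move=> ml.
have small x (f : R) : (0 < x)%N -> (x <= 2 * p * l.+1)%N -> f [::] = 0 ->
    (forall u, (size u <= d)%N -> abs (f u) <= M0) ->
    geom_bounded d rho (1 - cst x%:R^-1 * f).
  move=> x0 xl f0 hf [|a w] hw.
    by rewrite ncB nc1 coefCM f0 mulr0 subr0 (abs1 hK) expr0.
  rewrite ncB nc1 sub0r (absN hK) coefCM absM.
  apply: le_trans (_ : rho <= _); last by rewrite exprS ler_peMr // exprn_ege1.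
  rewrite /rho -mulrA mulrC -natrM; apply: ler_pM => //; first exact: hf.
  by apply: le_trans (abs_natV_le p_pr hK x0) _; rewrite ler_nat.
suff [Y hY ->] : exists2 Y, geom_bounded d rho Y & transfer l m = cst 'C(m + l, l)%:R * Y.
  rewrite coefCM absM; apply: le_trans (ler_piMl (abs_ge0 _) (abs_nat_le1 hK _)) _.
  exact: hY.
suff H j : (j <= l)%N ->
    exists2 Y, geom_bounded d rho Y & transfer j m = cst 'C(m + j, j)%:R * Y by exact: H.
elim: j => [|j IH] jl.
  exists 1; first exact: (geom_bounded1 hK).
  by rewrite addn0 bin0 /cst coefC1 mulr1.
have [Y hY E] := IH (ltnW jl).
have x1 : (0 < p * j.+1)%N by rewrite muln_gt0 p_gt0.
have x2 : (0 < p * (m + j.+1))%N by rewrite muln_gt0 p_gt0 addnS.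
pose Z : R := 1 - cst (p * (m + j.+1))%:R^-1 * (A + C).
have AC0 : (A + C) [::] = 0 by rewrite ncD C_nil addr0.
exists (ncinv (unitC j) * (Z * Y)).
  apply: (geom_boundedM hK) => //; first apply: (geom_boundedV hK) => //.
  - exact: unitC_nil.
  - by apply: (small) => //; move: (j) (l) (p) jl; clear; nia.
  apply: (geom_boundedM hK) => //; apply: (small) => //.
  by move: (j) (l) (m) (p) jl ml; clear; nia.
have E1 : cst (p * m + p * j.+1)%:R - A - C = cst (p * (m + j.+1))%:R * Z.
  rewrite /Z mulrBr mulr1 mulrA coefC_comp mulfV ?(natr_neq0 p_pr hK) // coefC1 mul1r.
  by rewrite mulnDr opprD addrA.
rewrite [transfer j.+1 m]/= E E1 /invC.
rewrite -!mulrA (mulrA Z) -(coefC_comm _ Z) -!mulrA.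
rewrite /cst.
do 2 rewrite [coefC _ * (coefC _ * (Z * Y))]mulrA coefC_comp.
rewrite mulrA -coefC_comm -mulrA; congr (coefC _ * _).
apply: (mulfI (scalar_neq0 j)); rewrite mulrA !mulrA mulfV ?mul1r ?scalar_neq0 //.
rewrite -!natrM; congr (_%:R); rewrite -!mulnA; congr (p * _)%N.
by rewrite addnS mul_bin_diag.
Qed.

End Transfer.

(** * The interpolating sequence X_n *)

Section Interpolation.
Variables (p : nat) (K : fieldType) (abs : K -> rat).
Hypothesis p_pr : prime p.
Hypothesis hK : is_padic_field p abs.
Notation R := (ncseries bool K).
Notation Q := (ncseries bool (powser K)).
Notation A := (monom K [:: lA]).
Notation tends := (tends abs).
Notation ser := (ser abs).
Notation Hat := (Hat abs).
Variables (C : R) (G : Q).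
Hypothesis C_nil : C [::] = 0.
Hypothesis G_over : forall u, overconvergent abs (G u).
Hypothesis G_horizontal :
  frobenius_horizontal p (coefC p%:R^-1 * A) (coefC p%:R^-1 * C) G.
Hypothesis G_z0 : forall u, value_at_z0 abs (G u) ((u == [::])%:R).
Let absM x y : abs (x * y) = abs x * abs y. Proof. exact: padicM hK x y. Qed.
Let abs_ge0 x : 0 <= abs x. Proof. exact: padic_ge0 hK x. Qed.
Let p_gt0 : (0 < p)%N. Proof. exact: prime_gt0. Qed.
Let cst (x : K) : R := coefC x.

(** The coefficient of (1-z)^(-k) in G. *)
Definition wcoef k : R := fun u => (-1) ^+ k * G u (nseq k tt).

Lemma wcoef_bound u : exists r M, 1 < r /\ forall k, abs (wcoef k u) <= M * r ^- k.
Proof.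
have [r [M [r1 h]]] := G_over u; exists r, M; split=> // k.
have r0 : 0 < r ^+ k by rewrite exprn_gt0 // (lt_trans ltr01).
by rewrite /wcoef absM (abs_sign hK) mul1r ler_pdivlMr.
Qed.

(** Overconvergence is used here: its geometric decay beats the polynomial growth allowed by
    [transfer_bound]. *)
Lemma wcoef_dom u c d : exists v, vanish v /\
  forall k, abs (wcoef k u) * (c * k.+1%:R ^+ d) <= v k.
Proof.
have [r [M [r1 h]]] := wcoef_bound u.
exists (fun k => M * r ^- k * (`|c| * k.+1%:R ^+ d)); split.
  exact: poly_geometric_vanish.
move=> k; apply: le_trans (_ : abs (wcoef k u) * (`|c| * k.+1%:R ^+ d) <= _).
  by rewrite ler_wpM2l // ler_wpM2r ?exprn_ge0 // ler_norm.
by rewrite ler_wpM2r ?h // mulr_ge0 // exprn_ge0.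
Qed.

Lemma wcoef_null u : tends (fun k => wcoef k u) 0.
Proof.
have [v [hv h]] := wcoef_dom u 1 0; apply: tends_dom hv _ => k.
by have := h k; rewrite expr0 !mulr1.
Qed.

Lemma G_null : null_series abs G.
Proof.
move=> u; have h := tends0_le1 hK (c := fun k => (-1) ^+ k) _ (wcoef_null u).
apply: eq_tends (h _) => k; last by rewrite (abs_sign hK).
by rewrite /wcoef mulrA -expr2 sqrr_sign mul1r.
Qed.

Lemma G_at0 : coefz 0 (Hat G) = 1.
Proof.
apply: ncP => u; rewrite nc1; apply: (serE hK).
apply: eq_tends (G_z0 u) => n; rewrite /psum; apply: eq_bigr => i _.
by rewrite /zterm multiset_n0 mul1r mulrC.
Qed.

Definition serR (h : nat -> R) : R := fun u => ser (fun k => h k u).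
Definition nullR (h : nat -> R) := forall u, tends (fun k => h k u) 0.

Lemma serR_mul h f : nullR h ->
  serR (fun k => h k * f) = serR h * f /\ nullR (fun k => h k * f).
Proof.
move=> hh; have nt u i : tends (fun k => h k (take i u) * f (drop i u)) 0.
  by apply: eq_tends (tends0Z hK (f (drop i u)) (hh (take i u))) => k; rewrite mulrC.
split; last first.
  by move=> u; exact: (ser_sum hK _ (fun i => nt u (nat_of_ord i))).2.
apply: ncP => u; rewrite ncE /serR.
rewrite (ser_sum hK _ (fun i : 'I_(size u).+1 => nt u (nat_of_ord i))).1.
apply: eq_bigr => i _; rewrite mulrC -(serZ hK) //; apply: eq_ser => k.
by rewrite mulrC.
Qed.

Lemma serR_sum I (r : seq I) (h : I -> nat -> R) : (forall i, nullR (h i)) ->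
  serR (fun k => \sum_(i <- r) h i k) = \sum_(i <- r) serR (h i).
Proof.
move=> hh; apply: ncP => u; rewrite nc_sum /serR.
rewrite -(ser_sum hK _ (fun i => hh i u)).1; apply: eq_ser => k.
by rewrite nc_sum.
Qed.

Lemma nullR_wcoef (m : nat -> nat) : nullR (fun k => cst (m k)%:R * wcoef k).
Proof.
move=> u; apply: eq_tends (tends0_le1 hK (c := fun k => (m k)%:R) _ (wcoef_null u)).
  by move=> k; rewrite coefCM.
by move=> k; exact: (abs_nat_le1 hK).
Qed.

Lemma Hat_sum N : \sum_(i < N.+1) coefz i (Hat G) =
  serR (fun k => cst (multiset k.+1 N)%:R * wcoef k).
Proof.
have E i : coefz i (Hat G) = serR (fun k => cst (multiset k i)%:R * wcoef k).
  apply: ncP => u; rewrite /coefz /Hat /hat size_nseq; apply: eq_ser => k.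
  by rewrite coefCM.
under eq_bigr do rewrite E.
rewrite -serR_sum => [|i]; last exact: nullR_wcoef.
apply: ncP => u; apply: eq_ser => k; by rewrite -mulr_suml /cst -coefC_sum -natr_sum.
Qed.

Let p1 : (p.-1 < p)%N. Proof. by rewrite prednK. Qed.

Definition section_coef k : nat -> K := projT1 (cid (multiset_section hK k p1)).

Lemma section_coef_le1 k l : abs (section_coef k l) <= 1.
Proof. by rewrite /section_coef; case: cid => c /= [h _]. Qed.

Lemma section_coefE k m : (multiset k.+1 (p * m + p.-1))%:R =
  \sum_(l < k.+1) section_coef k l * (multiset l.+1 m)%:R.
Proof. by rewrite /section_coef; case: cid => c /= [_ h]. Qed.

Definition transfer_comb k n : R :=
  \sum_(l < k.+1) cst (section_coef k l) * transfer p C l n.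

(* X_n, the value at n of an analytic function, such that the product of the
   factors 1 - (m - A)^(-1) B over m < p (n + 1) is X_n times the Frobenius
   transform of the product over m <= n, modulo A on the right. *)
Definition interpol n : R := serR (fun k => wcoef k * transfer_comb k n).

Lemma vanish_sum I (r : seq I) (F : I -> nat -> nat -> K) :
    (forall i, exists v, vanish v /\ forall n k, abs (F i n k) <= v k) ->
  exists v, vanish v /\ forall n k, abs (\sum_(i <- r) F i n k) <= v k.
Proof.
move=> hF; elim: r => [|i r [v [hv h]]].
  exists (fun=> 0); split=> [e e0|n k]; first by exists 0%N.
  by rewrite big_nil (abs0 hK).
have [w [hw h']] := hF i; exists (fun k => Num.max (w k) (v k)); split=> [e e0|n k].
  have [N hN] := hw e e0; have [N' hN'] := hv e e0; exists (maxn N N') => n.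
  by rewrite geq_max gt_max => /andP[/hN -> /hN' ->].
by rewrite big_cons; apply: (absD_le hK); rewrite le_max ?h' ?h ?orbT.
Qed.

Lemma interpol_dom u : exists v, vanish v /\
  forall n k, abs ((wcoef k * transfer_comb k n) u) <= v k.
Proof.
apply: (vanish_sum (index_enum 'I_(size u).+1)
  (F := fun i n k => wcoef k (take i u) * transfer_comb k n (drop i u))) => i.
have [M M1 hM] := transfer_bound p_pr hK C_nil (size u).
have [v [hv h]] := wcoef_dom (take i u) (M ^+ size u) (size u).
exists v; split=> // n k; apply: le_trans (h k).
rewrite absM ler_wpM2l // /transfer_comb nc_sum; apply: (abs_sum_le hK).
  by rewrite mulr_ge0 ?exprn_ge0 // (le_trans ler01).
move=> l _; rewrite coefCM absM -exprMn.
have hs : (size (drop i u) <= size u)%N by rewrite size_drop leq_subr.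
apply: le_trans (ler_piMl (abs_ge0 _) (section_coef_le1 _ _)) _.
apply: le_trans (hM l n _ hs) _.
have M0 : 0 <= M := le_trans ler01 M1.
by apply: lerXn2r; rewrite ?nnegrE ?mulr_ge0 // ler_wpM2l // ler_nat ltn_ord.
Qed.

Lemma interpol_null n : nullR (fun k => wcoef k * transfer_comb k n).
Proof.
by move=> u; have [v [hv h]] := interpol_dom u; apply: tends_dom hv _.
Qed.

Lemma vanish_bounded (v : nat -> rat) : vanish v -> exists M, forall k, v k <= M.
Proof.
move=> /(_ 1 ltr01)[N hN].
have [M hM] : exists M, forall k, (k < N)%N -> v k <= M.
  elim: (N) => [|n [M hM]]; first by exists 0.
  exists (Num.max M (v n)) => k; rewrite ltnS leq_eqVlt le_max => /orP[/eqP->|/hM ->//].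
  by rewrite lexx orbT.
exists (Num.max M 1) => k; rewrite le_max.
by case: (ltnP k N) => [/hM ->//|/hN/ltW ->]; rewrite orbT.
Qed.

Lemma interpol_bounded : bounded_ncs abs interpol.
Proof.
move=> u; have [v [hv h]] := interpol_dom u; have [M hM] := vanish_bounded hv.
exists M => n; apply: (ser_le hK) => [|k]; first exact: interpol_null.
exact: le_trans (h _ _) (hM _).
Qed.

Lemma tends_pX n : tends (fun r => (n + p ^ r)%:R) n%:R.
Proof.
move=> e /(pXV_small p_pr)[N hN]; exists N => r /hN; rewrite natrD addrAC subrr add0r.
by rewrite (abs_pX hK).
Qed.

Lemma interpol_tends n u : tends (fun r => interpol (n + p ^ r) u) (interpol n u).
Proof.
have [v [hv h]] := interpol_dom u.
apply: (ser_dominated hK hv) => [r k|k]; first exact: h.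
apply: (tends_sum hK) => i _; apply: (tendsM hK); first exact: (tends_cst hK).
rewrite /transfer_comb nc_sum.
apply: eq_tends (_ : tends (fun r => \sum_(l < k.+1)
   (cst (section_coef k l) * transfer p C l (n + p ^ r)) (drop i u)) _) => [r|].
  by rewrite nc_sum.
apply: (tends_sum hK) => l _; rewrite coefCM.
apply: eq_tends (fun r => esym (coefCM _ _ _)) _.
apply: (tendsM hK); first exact: (tends_cst hK).
by apply: (tends_transfer hK); exact: tends_pX.
Qed.

(** Sectioning the coefficients of (1-z)^(-k-1) turns the convolution over j into iterated sums of
    [frob_term]. By [iterated_sum_transfer] these have the common right factor [frob_product], with
    cofactors polynomial in n. *)
Lemma interpolP n :
  eqmodA (interpol n * frob_product p C n) (harmonic_product K (p * n + p.-1)).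
Proof.
apply: (@eqmodA_trans _ (coefz (p * n + p.-1) (partial_sums p abs C G))); last first.
  exact: (partial_sums_harmonic p_pr hK G_null G_horizontal G_at0).
rewrite coefz_partial_sums_block //.
rewrite -(serR_mul _ (interpol_null n)).1.
under eq_bigr => j _ do rewrite Hat_sum -(serR_mul _ (nullR_wcoef _)).1.
rewrite -serR_sum => [|j]; last exact: (serR_mul _ (nullR_wcoef _)).2.
move=> u hu; apply: eq_ser => k.
have -> : \sum_(j < n.+1) cst (multiset k.+1 (p * (n - j) + p.-1))%:R * wcoef k * frob_term p C j =
    wcoef k * \sum_(l < k.+1) cst (section_coef k l) * iterated_sum p C l.+1 n.
  under eq_bigr do rewrite section_coefE coefC_comm -mulrA.
  rewrite -mulr_sumr; congr (_ * _).
  under [RHS]eq_bigr do rewrite iterated_sumE mulr_sumr.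
  rewrite exchange_big; apply: eq_bigr => j _.
  by rewrite /cst coefC_sum mulr_suml; apply: eq_bigr => l _; rewrite mulrA coefC_comp.
rewrite -mulrA; apply: eqmodA_mul hu => {}u hu.
rewrite /transfer_comb mulr_suml !nc_sum; apply: eq_bigr => l _; rewrite -mulrA.
by apply: eqmodA_mul hu; apply: eqmodA_sym; exact: (iterated_sum_transfer p_pr hK).
Qed.

End Interpolation.

(** * The recursion for the Frobenius matrix *)

Lemma ncM_letter (T : choiceType) (S : nzRingType) (f h : ncseries T S) a :
  (f * h) [:: a] = f [::] * h [:: a] + f [:: a] * h [::].
Proof. by rewrite ncM_cons ncM_nil. Qed.

Section Blocks.
Variable K : fieldType.
Notation R := (ncseries bool K).
Notation B := (monom K [:: lB]).

Definition factor (x : K) : R := 1 - resolvent x * B.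

Fixpoint block m j : R :=
  if j is j'.+1 then factor (m + j')%:R * block m j' else 1.

Lemma harmonic_product_block n j :
  harmonic_product K (n + j) = block n.+1 j * harmonic_product K n.
Proof.
elim: j => [|j IH]; first by rewrite addn0 mul1r.
by rewrite addnS /= IH mulrA addSn.
Qed.

(** The subalgebra of series that are a constant plus a left multiple of B, on which [pi_y] becomes
    multiplicative. *)
Definition noA (f : R) := forall u, f (rcons u lA) = 0.

Lemma noA_M f h : noA f -> noA h -> noA (f * h).
Proof.
move=> hf hh u; rewrite ncM_rcons hf mul0r addr0.
by apply: ncM_eq0 => i _; right; exact: hh.
Qed.

Lemma noA_1 : noA 1.
Proof. by move=> u; rewrite nc1 -size_eq0 size_rcons. Qed.

Lemma noA_MB f : noA (f * B).
Proof. by move=> u; rewrite Mlet_rcons. Qed.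

Lemma noA_factor x : noA (factor x).
Proof. by move=> u; rewrite /factor ncB noA_1 noA_MB subrr. Qed.

Lemma noA_block m j : noA (block m j).
Proof. by elim: j => [|j IH]; [exact: noA_1 | apply: noA_M => //; exact: noA_factor]. Qed.

Lemma factor_nil x : factor x [::] = 1.
Proof. by rewrite /factor ncB Mlet_nil subr0. Qed.

Lemma block_nil m j : block m j [::] = 1.
Proof. by elim: j => //= j IH; rewrite ncM_nil factor_nil IH mulr1. Qed.

Lemma factor_B x : factor x [:: lB] = - x^-1.
Proof.
rewrite /factor ncB -[[:: lB]]/(rcons [::] lB) Mlet_rcons eqxx nc1 sub0r.
by rewrite /resolvent /= expr1.
Qed.

Lemma block_B m j : block m j [:: lB] = - \sum_(i < j) (m + i)%:R^-1.
Proof.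
elim: j => [|j IH]; first by rewrite big_ord0 oppr0.
by rewrite /= ncM_letter factor_nil block_nil factor_B IH big_ord_recr /= opprD mul1r mulr1.
Qed.

End Blocks.

Section FrobeniusEquation.
Variables (p : nat) (K : fieldType) (abs : K -> rat).
Hypothesis p_pr : prime p.
Hypothesis hK : is_padic_field p abs.
Notation R := (ncseries bool K).
Notation B := (monom K [:: lB]).
Notation tends := (tends abs).
Notation bounded := (bounded abs).
Variables (C : R) (X : nat -> R).
Hypothesis C_nil : C [::] = 0.
Hypothesis C_B : C [:: lB] = 1.
Hypothesis X_tends : forall n u, tends (fun r => X (n + p ^ r) u) (X n u).
Hypothesis X_P : forall n,
  eqmodA (X n * frob_product p C n) (harmonic_product K (p * n + p.-1)).
Let p_gt0 : (0 < p)%N. Proof. exact: prime_gt0. Qed.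
Let absM x y : abs (x * y) = abs x * abs y. Proof. exact: padicM hK x y. Qed.
Let abs_ge0 x : 0 <= abs x. Proof. exact: padic_ge0 hK x. Qed.

Definition tendsR (F : nat -> R) (f : R) := forall u, tends (fun r => F r u) (f u).

Lemma tendsR_M F F' f f' : tendsR F f -> tendsR F' f' ->
  tendsR (fun r => F r * F' r) (f * f').
Proof. by move=> h h' u; apply: (tends_sum hK) => i _; exact: (tendsM hK). Qed.

Lemma tendsR_cst f : tendsR (fun=> f) f.
Proof. by move=> u; exact: (tends_cst hK). Qed.

Lemma tendsR_B F F' f f' : tendsR F f -> tendsR F' f' ->
  tendsR (fun r => F r - F' r) (f - f').
Proof. by move=> h h' u; apply: (tendsD hK) => //; exact: (tendsN hK). Qed.

Lemma tendsR_resolvent (s : nat -> K) l : l != 0 -> tends s l ->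
  tendsR (fun r => resolvent (s r)) (resolvent l).
Proof.
move=> l0 hs u; rewrite /resolvent; case: ifP => _; last exact: (tends_cst hK).
elim: (_.+1) => [|k IH]; first exact: (tends_cst hK).
rewrite exprS; apply: eq_tends (tendsM hK (tendsV hK l0 hs) IH) => r.
by rewrite exprS.
Qed.

Lemma tends_pnX n j : tends (fun r => (p * (n + p ^ r) + j)%:R) (p * n + j)%:R.
Proof.
rewrite natrD natrM; apply: eq_tends (_ : tends (fun r => p%:R * (n + p ^ r)%:R + j%:R) _).
  by move=> r; rewrite [in RHS]natrD natrM.
apply: (tendsD hK); last exact: (tends_cst hK).
by apply: (tendsM hK); [exact: (tends_cst hK) | exact: (tends_pX p_pr hK)].
Qed.

Let pn_neq0 n j : (p * n.+1 + j)%:R != 0 :> K.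
Proof. by apply: (natr_neq0 p_pr hK); rewrite addn_gt0 muln_gt0 p_gt0. Qed.

Lemma tendsR_block n j :
  tendsR (fun r => block K (p * (n.+1 + p ^ r)) j) (block K (p * n.+1) j).
Proof.
elim: j => [|j IH] /=; first exact: tendsR_cst.
apply: tendsR_M => //; apply: tendsR_B; first exact: tendsR_cst.
apply: tendsR_M; last exact: tendsR_cst.
by apply: tendsR_resolvent => //; exact: tends_pnX.
Qed.

Definition frob_factor n : R := 1 - resolvent (p * n)%:R * C.

Let Z n := X n.+1 * frob_factor n.+1 - block K (p * n.+1) p * X n.

Lemma Z_tends n : tendsR (fun r => Z (n + p ^ r)) (Z n).
Proof.
apply: tendsR_B; apply: tendsR_M => //.
- by move=> u; apply: eq_tends (X_tends n.+1 u) => r; rewrite addSn.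
- apply: tendsR_B; first exact: tendsR_cst.
  apply: tendsR_M; last exact: tendsR_cst.
  rewrite -[(p * n.+1)%N]addn0; apply: tendsR_resolvent => //.
  by apply: eq_tends (tends_pnX n.+1 0) => r; rewrite addn0 addSn.
- by move=> u; apply: eq_tends (tendsR_block n p u) => r; rewrite addSn.
Qed.

Lemma frob_product_nil n : frob_product p C n [::] = 1.
Proof.
elim: n => //= n IH; rewrite ncM_nil IH mulr1 ncB nc1 ncM_nil C_nil mulr0 subr0.
by [].
Qed.

Lemma frob_product_B n :
  frob_product p C n [:: lB] = - (p%:R^-1 * \sum_(i < n) i.+1%:R^-1).
Proof.
elim: n => [|n IH]; first by rewrite big_ord0 mulr0 oppr0.
rewrite /= ncM_letter frob_product_nil IH big_ord_recr /= !ncB !ncM_letter ncM_nil.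
rewrite C_nil C_B /resolvent /= !nc1 expr1 natrM invfM.
by rewrite !mulr0 subr0 !addr0 !mulr1 mul1r sub0r mulrDr opprD.
Qed.

Lemma Z_frob n : eqmodA (Z n * frob_product p C n) 0.
Proof.
rewrite /Z mulrBl -!mulrA -[frob_factor _ * _]/(frob_product p C n.+1).
rewrite -[0](subrr (harmonic_product K (p * n.+1 + p.-1))).
apply: eqmodA_add => //; apply: eqmodA_opp.
have -> : (p * n.+1 + p.-1 = (p * n + p.-1) + p)%N by rewrite mulnS; lia.
rewrite harmonic_product_block.
have -> : ((p * n + p.-1).+1 = p * n.+1)%N by rewrite mulnS -addnS prednK // addnC.
exact: eqmodA_mul.
Qed.

(* The harmonic numbers H_(n + p^r) are unbounded while Z_(n + p^r) converges. *)
Lemma Z_eq0 n : Z n = 0.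
Proof.
apply: ncP => u; rewrite nc0; have [m] := ubnP (size u).
elim: m n u => // m IH n u um.
(* The coefficient of [Z_frob] at u B. As [Z k] vanishes on words shorter than u, only the
   splittings after u and after u B contribute. *)
have rel k : Z k u * \sum_(i < k) i.+1%:R^-1 = p%:R * Z k (rcons u lB).
  have := Z_frob k (u := rcons u lB); rewrite last_rcons => /(_ isT).
  rewrite ncM_rcons ncM_small => [|v hv]; last by apply: IH; exact: leq_trans hv _.
  rewrite frob_product_nil mulr1 /rder /= frob_product_B mulrN => /eqP.
  rewrite addrC subr_eq0 => /eqP ->; rewrite mulrCA mulVKf //.
  exact: (natr_neq0 p_pr hK).
have [N hN] := tends_bounded hK (Z_tends n (rcons u lB)).
set M := abs (Z n (rcons u lB)) + 1 in hN.
have key r : (maxn N n < r)%N -> abs (Z (n + p ^ r) u) * p%:R ^+ r <= M.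
  rewrite gtn_max => /andP[/ltnW/hN h nr].
  have := congr1 abs (rel (n + p ^ r)%N); rewrite !absM (padic_p hK).
  rewrite (_ : (n + p ^ r = n.+1 + p ^ r - 1)%N); last by rewrite addSn subn1.
  rewrite (harmonic_abs p_pr hK); last first.
    by rewrite ltnS /= (leq_trans nr) // ltnW // ltn_expl // prime_gt1.
  rewrite addSn subn1 => ->; apply: le_trans h.
  by rewrite ler_piMl // invf_le1 ?ler1n // ltr0n.
apply: (tends_uniq hK (Z_tends n u)) => e e0.
have M0 : 0 < M by apply: lt_le_trans ltr01 _; rewrite lerDr.
have [N' hN'] := pX_unbounded p_pr (M / e).
exists (maxn N' (maxn N n).+1) => r; rewrite geq_max => /andP[/hN' h1 /key h2].
have pr0 : 0 < p%:R ^+ r :> rat by rewrite exprn_gt0 // ltr0n.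
rewrite subr0 -(ltr_pM2r pr0); apply: le_lt_trans h2 _.
by rewrite mulrC -ltr_pdivrMr.
Qed.

Lemma X_step n : X n.+1 * frob_factor n.+1 = block K (p * n.+1) p * X n.
Proof. by apply/eqP; rewrite -subr_eq0; apply/eqP; exact: Z_eq0. Qed.

Lemma X_nil n : X n [::] = 1.
Proof.
have := X_P n (u := [::]) isT; rewrite ncM_nil frob_product_nil mulr1 => ->.
elim: (_ + _)%N => //= k IH; rewrite ncM_nil IH mulr1.
by rewrite ncB Mlet_nil subr0.
Qed.

Section Associator.
Variable Phi : R.
Hypothesis Phi_nil : Phi [::] = 1.
Hypothesis C_def : C = ncinv Phi * B * Phi.
Hypothesis X_bounded : bounded_ncs abs X.

Definition Ycoef n : R := X n * ncinv Phi.
Definition bcoef n : R := 1 - Phi * resolvent (p * n)%:R * ncinv Phi * B.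

Lemma Y_step n : Ycoef n.+1 * bcoef n.+1 = block K (p * n.+1) p * Ycoef n.
Proof.
rewrite /Ycoef [RHS]mulrA -X_step -!mulrA; congr (_ * _).
rewrite /frob_factor /bcoef C_def mulrBr mulr1 mulrBl mul1r; congr (_ - _).
by rewrite !mulrA ncmulVf // mul1r -!mulrA ncmulV // mulr1.
Qed.

Lemma Y_bounded : bounded_ncs abs Ycoef.
Proof. by apply: (bounded_ncsM hK) => // u; exact: bounded_cst. Qed.

(** For u of minimal length the coefficient c at u A does not depend on n, since blocks have
    constant term 1. At B u A the increments are then - c times a sum of p consecutive inverses, one
    of which is unbounded for suitable n; as Y_n is bounded, c = 0. *)
Lemma Y_noA n : noA (Ycoef n).
Proof.
have step k u : Ycoef k.+1 (rcons u lA) = (block K (p * k.+1) p * rder lA (Ycoef k)) u.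
  have := congr1 (fun f : R => f (rcons u lA)) (Y_step k).
  rewrite /bcoef mulrBr mulr1 mulrA ncB noA_MB subr0 => ->.
  by rewrite ncM_rcons noA_block mul0r addr0.
move=> u; have [m] := ubnP (size u); elim: m n u => // m IH n u um.
have cst k : Ycoef k (rcons u lA) = Ycoef 0 (rcons u lA).
  elim: k => // k <-; rewrite step ncM_small_r ?block_nil ?mul1r // => v hv.
  by apply: IH; exact: leq_trans hv _.
have stepB k : Ycoef k.+1 (rcons (lB :: u) lA) = Ycoef k (rcons (lB :: u) lA)
    - Ycoef 0 (rcons u lA) * \sum_(i < p) (p * k.+1 + i)%:R^-1.
  rewrite step ncM_cons block_nil mul1r; congr (_ + _).
  rewrite ncM_small_r => [|v hv]; last by apply: IH; exact: leq_trans hv _.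
  by rewrite /lder block_B /rder cst mulNr mulrC.
rewrite cst; set c := Ycoef 0 _ in cst stepB *.
(* At k + 1 = p^r the term i = 0 of the block contributes c/(p p^r), the value of this polynomial at
   1/p^r. The other terms are inverses of integers prime to p. *)
suff : (size ((c / p%:R) *: 'X : {poly K})%R <= 1)%N.
  have [->//|c0] := eqVneq c 0.
  rewrite size_scale ?size_polyX // mulf_neq0 // invr_eq0.
  exact: (natr_neq0 p_pr hK).
apply: (poly_bounded p_pr hK).
have hb : bounded (fun k => Ycoef k (rcons (lB :: u) lA)) by exact: Y_bounded.
have hr : bounded (fun r => \sum_(i < p.-1) (p * p ^ r + i.+1)%:R^-1).
  apply: (bounded_sum hK) => i _; exists 1 => r; rewrite (absV hK) (abs_coprime p_pr hK) ?invr1 //.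
  rewrite /coprime mulnC gcdnMDl -/(coprime _ _) prime_coprime // gtnNdvd //.
  by rewrite -[in X in (_ < X)%N](prednK p_gt0) ltnS ltn_ord.
have [M hM] := hb; have [M' hM'] := boundedM hK (bounded_cst abs c) hr.
exists (Num.max M M') => r; rewrite hornerZ hornerX.
have pr1 : (0 < p ^ r)%N by rewrite expn_gt0 p_gt0.
have := stepB (p ^ r).-1; rewrite prednK //.
rewrite (_ : \sum_(i < p) _ = (p * p ^ r)%:R^-1 + \sum_(i < p.-1) (p * p ^ r + i.+1)%:R^-1).
  rewrite mulrDr natrM invfM => E.
  have -> : c / p%:R * (p ^ r)%:R^-1 = Ycoef (p ^ r).-1 (rcons (lB :: u) lA)
      - Ycoef (p ^ r) (rcons (lB :: u) lA) - c * \sum_(i < p.-1) (p * p ^ r + i.+1)%:R^-1.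
    by rewrite E; ring.
  apply: (absB_le hK); last by rewrite le_max hM' orbT.
  by apply: (absB_le hK); rewrite le_max hM.
have aux q (F : nat -> K) : (0 < q)%N ->
    \sum_(i < q) F i = F 0%N + \sum_(i < q.-1) F i.+1.
  by case: q => // q _; rewrite big_ord_recl.
by rewrite (aux p (fun i => (p * p ^ r + i)%:R^-1)) // addn0.
Qed.

End Associator.

End FrobeniusEquation.

(** * Deligne's associator *)

Section SignAndProjection.
Variable K : fieldType.
Notation R := (ncseries bool K).
Implicit Types f g : R.

Lemma negBM f g : negB (f * g) = negB f * negB g.
Proof.
apply: ncP => u; rewrite /negB !ncE mulr_sumr; apply: eq_bigr => i _.
rewrite -{1}(cat_take_drop i u) count_cat exprD.
by move: (_ ^+ _) (_ ^+ _) => x y; ring.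
Qed.

Lemma negB1 : negB (1 : R) = 1.
Proof. by apply: ncP => -[|a u]; rewrite /negB nc1 ?mulr1 ?mulr0. Qed.

Lemma noA_negB f : noA f -> noA (negB f).
Proof. by move=> h u; rewrite /negB h mulr0. Qed.

Lemma wordAB_cons k w : wordAB (k :: w) = nseq k lA ++ lB :: wordAB w.
Proof. by rewrite /wordAB /= cat_rcons. Qed.

Lemma last_wordAB w : last true (wordAB w).
Proof.
have H (b : bool) : b -> last b (wordAB w).
  elim: w b => // k w IH b hb; rewrite wordAB_cons last_cat /=; exact: IH.
exact: H.
Qed.

(** A splitting in the interior of a block A^(n-1) B leaves a left part ending in A, where [f]
    vanishes. Only splittings between blocks count, and these are the splittings of the word in the
    y_n. *)
Lemma pi_yM f g : noA f -> pi_y (f * g) = pi_y f * pi_y g.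
Proof.
move=> hf; apply: ncP => w; rewrite /pi_y.
elim: w f hf => [|k w IH] f hf; first by rewrite !ncM_nil.
have step (h : R) : noA h -> forall k : nat, (h * g) (nseq k lA ++ lB :: wordAB w) =
    h [::] * g (nseq k lA ++ lB :: wordAB w)
    + (((fun u => h (nseq k lA ++ lB :: u)) : R) * g) (wordAB w).
  move=> hh l; elim: l h hh => [|l IHl] h hh /=; first by rewrite ncM_cons.
  rewrite ncM_cons IHl; last by move=> u; rewrite /lder -rcons_cons hh.
  by rewrite [lder lA h [::]](hh [::]) mul0r add0r.
rewrite wordAB_cons step // IH; last first.
  by move=> u; rewrite -[_ ++ _]/(nseq k lA ++ rcons (lB :: u) lA) -rcons_cat hf.
rewrite ncM_cons; congr (_ + _); first by rewrite wordAB_cons.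
by apply: ncM_agree => // v _; rewrite /lder wordAB_cons.
Qed.

Lemma pi_y_eqmodA f g : eqmodA f g -> pi_y (negB f) = pi_y (negB g).
Proof.
by move=> h; apply: ncP => w; rewrite /pi_y /negB h // last_wordAB.
Qed.

Lemma pi_y1 : pi_y (1 : R) = 1.
Proof.
apply: ncP => -[|k w] //; rewrite /pi_y wordAB_cons !nc1.
by case: k.
Qed.

Lemma wordAB_eqB w : (wordAB w == [:: lB]) = (w == [:: 0%N]).
Proof.
case: w => [|[|k] [|l w]] //; rewrite !wordAB_cons //=.
by rewrite eqseq_cons /=; case: l.
Qed.

Lemma resolvent_B (x : K) u v : resolvent x (u ++ lB :: v) = 0.
Proof.
rewrite /resolvent; case: eqP => // /(congr1 (fun w => lB \in w)).
by rewrite mem_cat in_cons eqxx orbT mem_nseq andbF.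
Qed.

Lemma factor_rconsB (x : K) u : factor x (rcons u lB) = - resolvent x u.
Proof. by rewrite /factor ncB Mlet_rcons eqxx nc1 -size_eq0 size_rcons sub0r. Qed.

Lemma pi_y_factor (x : K) a w : pi_y (negB (factor x)) (a :: w) =
  x^-1 ^+ a.+1 * (1 : ncseries nat K) w.
Proof.
rewrite /pi_y /negB nc1; case: w => [|b w].
  rewrite /wordAB /= cats0 factor_rconsB -cats1 count_cat /= addn0 addn1.
  have -> : count_mem lB (nseq a lA) = 0%N by rewrite count_nseq.
  by rewrite /resolvent size_nseq eqxx mulr1 expr1 mulN1r opprK.
rewrite wordAB_cons mulr0; have [z ->] : exists z, wordAB (b :: w) = rcons z lB.
  have := last_wordAB (b :: w); case/lastP: (wordAB (b :: w)) (wordAB_cons b w) => [|z c _].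
    by case: b.
  by rewrite last_rcons => ->; exists z.
by rewrite -rcons_cons -rcons_cat factor_rconsB resolvent_B oppr0 mulr0.
Qed.

(** The image is the sum of y_n t^n over n >= 0 with t = 1/x, and the definition of the coproduct on
    the y_n says that this generating series is group-like. *)
Lemma factor_group (x : K) :
  Deltast (pi_y (negB (factor x))) = tens (pi_y (negB (factor x))) (pi_y (negB (factor x))).
Proof.
set e := pi_y _.
have e0 : e [::] = 1 by rewrite /e /pi_y /negB factor_nil mulr1.
have el a : lder a e = coefC (x^-1 ^+ a.+1) * 1.
  by apply: ncP => w; rewrite coefCM /lder /e pi_y_factor.
apply: ncP => -[|a u]; first by apply: ncP => v; rewrite Deltast_nl /tens e0 mul1r.
apply: ncP => -[|b v]; first by rewrite Deltast_ln /tens e0 mulr1.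
rewrite Deltast_cc !el !DeltastZ Deltast1 /tens /e !pi_y_factor !nc1.
have z c w : ((w == [::])%:R : ncseries nat K) (c :: v) = 0 by case: (w == [::]).
rewrite z [((a :: u) == [::])]/= mulr0n -[(0 : ncseries nat K) v]/(0 : K).
rewrite !mulr0 !add0r.
have -> : (a + b).+2 = (a.+1 + b.+1)%N by lia.
rewrite exprD mulrACA; congr (_ * _).
by case: (u == [::]); rewrite ?mul1r ?mul0r ?mulr1n ?nc1.
Qed.

Lemma block_group m j : Deltast (pi_y (negB (block K m j))) =
  tens (pi_y (negB (block K m j))) (pi_y (negB (block K m j))).
Proof.
elim: j => [|j IH] /=; first by rewrite negB1 pi_y1 Deltast1 tens1.
rewrite negBM pi_yM; last by apply: noA_negB; exact: noA_factor.
by rewrite DeltastM IH factor_group tensM.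
Qed.

(** The shuffle coproduct preserves the number of letters B, which makes the sign in [negB]
    compatible with it. *)
Lemma shuffle_count (w u v : seq bool) :
    count_mem lB w <> (count_mem lB u + count_mem lB v)%N ->
  (\prod_(l <- w) (tens (monom K [:: l]) 1 + tens 1 (monom K [:: l]))) u v = 0.
Proof.
elim: w u v => [|l w IH] u v.
  rewrite big_nil nc1; case: u => [|a u] //.
  by rewrite eqxx mulr1n nc1; case: v.
rewrite big_cons tens1l tens_letter coefC1 mulr1 mulrDl ncD ncD coefCM.
set F := \prod_(_ <- _) _ in IH *; move=> h.
rewrite [X in X + _](_ : _ = 0) ?add0r.
  case: v h => [|b v] h; first by rewrite letM_nil.
  rewrite letM_cons; case: eqP => // E; apply: IH => E'; apply: h; subst.
  by rewrite /= E' addnCA.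
case: u h => [|a u] h; first by rewrite letM_nil.
rewrite letM_cons; case: eqP => // E; apply: IH => E'; apply: h; subst.
by rewrite /= E' addnA.
Qed.

Lemma DeltaAB_negB f : DeltaAB f = tens f f -> DeltaAB (negB f) = tens (negB f) (negB f).
Proof.
move=> hf; apply: ncP => u; apply: ncP => v.
have := congr1 (fun F : ncseries bool (ncseries bool K) => F u v) hf.
rewrite /tens /DeltaAB /coproduct /negB => E.
transitivity ((-1) ^+ (count_mem lB u + count_mem lB v) * (f u * f v)).
  rewrite -E mulr_fsumr; apply: eq_fsbigr => w _.
  have [Ew|/eqP Ew] := eqVneq (count_mem lB w) (count_mem lB u + count_mem lB v)%N.
    by rewrite -Ew mulrA.
  by rewrite shuffle_count // !mulr0.
by rewrite exprD mulrACA.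
Qed.

End SignAndProjection.

(** * The double shuffle relations for Phi *)

Section Main.
Variables (p : nat) (K : fieldType) (abs : K -> rat).
Hypothesis p_pr : prime p.
Hypothesis hK : is_padic_field p abs.
Notation R := (ncseries bool K).
Notation Q := (ncseries bool (powser K)).
Notation A := (monom K [:: lA]).
Notation B := (monom K [:: lB]).
Notation pc := (@polyC_nc K).
Variables (Phi : R) (G : Q).
Hypothesis Phi_nil : Phi [::] = 1.
Hypothesis Phi_B : forall n, Phi (nseq n.+1 lB) = 0.
Let C := ncinv Phi * B * Phi.
Hypothesis G_over : forall u, overconvergent abs (G u).
Hypothesis G_z0 : forall u, value_at_z0 abs (G u) ((u == [::])%:R).
Hypothesis G_horizontal :
  frobenius_horizontal p (coefC p%:R^-1 * A) (coefC p%:R^-1 * C) G.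
Let p_gt0 : (0 < p)%N. Proof. exact: prime_gt0. Qed.
Let p_neq0 : p%:R != 0 :> K. Proof. exact: (natr_neq0 p_pr hK). Qed.

Lemma C_nil : C [::] = 0.
Proof. by rewrite /C !ncM_nil [monom _ _ _](_ : _ = 0) // mulr0 mul0r. Qed.

Lemma C_letter a : C [:: a] = (a == lB)%:R.
Proof.
rewrite /C ncM_letter ncM_nil [monom _ _ [::]](_ : _ = 0) // mulr0 mul0r add0r.
rewrite Phi_nil mulr1 ncM_letter ncinv_nil // mul1r [monom _ _ [::]](_ : _ = 0) //.
by rewrite mulr0 addr0 /monom eqseq_cons andbT.
Qed.

Let X := interpol p_pr hK C G.

(** [formden] is w times a polynomial with constant term 1. *)
Lemma formden_inj (f : powser K) : powser_of_poly (formden p K) * f = 0 -> f = 0.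
Proof.
move=> hf; apply: powserP => n; elim/ltn_ind: n => n IH.
have := congr1 (fun f : powser K => f (nseq n.+1 tt)) hf.
have d0 : (formden p K)`_0 = 0.
  by rewrite /formden -mulrA coefXM.
have d1 : (formden p K)`_1 = 1.
  rewrite /formden -mulrA coefXM /= coef0M /frobQ coefB coefXn coefD coefX coef1 add0r mul1r.
  have -> : (0 == p)%N = false by move: p_gt0; case: (p).
  by rewrite subr0 -horner_coef0 horner_exp !hornerE //= expr1n.
rewrite powserM 2!big_ord_recl /powser_of_poly /= d0 mul0r add0r subn1 /= d1 mul1r.
rewrite big1 ?addr0 // => i _; rewrite IH ?mulr0 //.
by rewrite /bump /=; have := ltn_ord i; lia.
Qed.

Lemma frob_rhs_nil : (pc (Fform0 p K) * extend_scalars (coefC p%:R^-1 * A)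
    + pc (Fform1 p K) * extend_scalars (coefC p%:R^-1 * C)) [::] = 0.
Proof.
rewrite ncD !pcE /extend_scalars !coefCM C_nil [monom _ _ _](_ : _ = 0) //.
by rewrite !mulr0 !coefC0 !mulr0 addr0.
Qed.

Lemma ddw_G_nil : ddw (G [::]) = 0.
Proof.
apply: formden_inj; have := congr1 (fun F : Q => F [::]) G_horizontal.
rewrite pcE => ->; rewrite ncB mulrDl ncD -!mulrA !pcE !letM_nil !mulr0 add0r.
by rewrite ncM_nil frob_rhs_nil mulr0 subr0.
Qed.

(** The pull-back multiplies dz/z by p and the inverse Frobenius divides A by p, so the two
    contributions cancel. *)
Lemma ddw_G_A : ddw (G [:: lA]) = 0.
Proof.
apply: formden_inj; have := congr1 (fun F : Q => F [:: lA]) G_horizontal.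
rewrite pcE => ->; rewrite ncB mulrDl ncD -!mulrA !pcE !letM_cons /= mulr0 addr0.
rewrite ncM_letter frob_rhs_nil mulr0 addr0 ncD !pcE /extend_scalars !coefCM.
rewrite C_letter /monom eqxx mulr0 coefC0 mulr0 addr0 mulr1 powserC.
have -> : Fform0 p K = p%:R%:P * form0 p K.
  by rewrite /Fform0 /form0 mulrN polyC_natr.
rewrite popM popC [coefC _ * _]powserC -mulrA coefC_comp mulfV // coefC1 mulr1.
by rewrite powserC subrr.
Qed.

Lemma wcoef0 u k : ddw (G u) = 0 -> wcoef G k.+1 u = 0.
Proof.
move=> /(congr1 (fun f : powser K => f (nseq k tt))).
rewrite /ddw size_nseq => /eqP; rewrite mulf_eq0 (negbTE (natS_neq0 p_pr hK _)) /= => /eqP E.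
by rewrite /wcoef /= E mulr0.
Qed.

Lemma wcoef0_A : wcoef G 0 [:: lA] = 0.
Proof.
have : coefz 0 (Hat abs G) [:: lA] = 0 by rewrite (G_at0 hK G_z0) nc1.
rewrite /coefz /Hat /hat /= => <-; rewrite (ser_recl hK).
  rewrite /zterm multiset_n0 mul1r [X in _ + X](_ : _ = 0) ?addr0 //.
  rewrite -[RHS](ser0 hK); apply: eq_ser => k.
  by have := wcoef0 k ddw_G_A; rewrite /wcoef => ->; rewrite mulr0.
exact: (zterm_tends hK _ (G_null hK G_over _)).
Qed.

Lemma X_A n : X n [:: lA] = 0.
Proof.
rewrite /X /interpol /serR -[RHS](ser0 hK); apply: eq_ser => -[|k].
  rewrite ncM_letter wcoef0_A mul0r addr0 /transfer_comb big_ord1 mulr1.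
  by rewrite /coefC /= mulr0n mulr0.
by rewrite ncM_letter !wcoef0 ?ddw_G_nil ?ddw_G_A // !mul0r addr0.
Qed.

Let X_bounded := interpol_bounded p_pr hK C_nil G_over.
Let X_tends := interpol_tends p_pr hK C_nil G_over.
Let X_P := interpolP p_pr hK C_nil G_over G_horizontal G_z0.
Let C_B : C [:: lB] = 1. Proof. by rewrite C_letter. Qed.

Let Xn_nil n : X n [::] = 1. Proof. exact: (X_nil C_nil X_P). Qed.

Let Y n := Ycoef X Phi n.
Let b n := bcoef p Phi n.

Lemma Y_noA' n : noA (Y n).
Proof. exact: (Y_noA p_pr hK C_nil C_B X_tends X_P Phi_nil erefl X_bounded). Qed.

Lemma Y_nil n : Y n [::] = 1.
Proof.
by rewrite /Y /Ycoef ncM_nil Xn_nil ncinv_nil // mulr1.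
Qed.

(** Neither Y_0 = X_0 Phi^(-1) nor X_0 has a term in A, the latter by the initial value of G at z =
    0. *)
Lemma Phi_A : Phi [:: lA] = 0.
Proof.
have := Y_noA' 0 [::]; rewrite /Y /Ycoef ncM_letter Xn_nil X_A mul0r.
rewrite addr0 mul1r => h.
have := congr1 (fun f : R => f [:: lA]) (ncmulV Phi_nil).
by rewrite ncM_letter h mulr0 add0r ncinv_nil // mulr1 nc1.
Qed.

Lemma b_nil n : b n [::] = 1.
Proof. by rewrite /b /bcoef ncB Mlet_nil subr0. Qed.

Definition polar_ncs (F : nat -> R) (f0 f1 : R) :=
  forall u, polar p (fun n => F n u) (f0 u) (f1 u).

Lemma polar_ncsM F F' f0 f1 f0' f1' : polar_ncs F f0 f1 -> polar_ncs F' f0' f1' ->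
  polar_ncs (fun n => F n * F' n) (f0 * f0') (f0 * f1' + f1 * f0').
Proof.
move=> h h' u; rewrite ncD !ncE -big_split /=.
by apply: polar_sum => i _; exact: polarM.
Qed.

Lemma polar_ncs_cst f : polar_ncs (fun=> f) f 0.
Proof. by move=> u; exact: polar_cst. Qed.

Lemma polar_resolvent : polar_ncs (fun n => resolvent (p * n)%:R) 0 1.
Proof.
move=> w; rewrite nc1 /resolvent; case: eqP => [_|nw]; last first.
  have -> : (w == [::]) = false by case: (w) nw.
  exact: polar_cst.
exists 'X^((size w).+1); rewrite !coefXn -size_eq0.
by split=> [||n _]; rewrite ?hornerXn // eq_sym.
Qed.

(** To first order (pn - A)^(-1) is the scalar 1/(pn), on which conjugation by Phi has no effect. *)
Lemma polar_b : polar_ncs b 1 (- B).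
Proof.
have := polar_ncsM (polar_ncsM (polar_ncsM (polar_ncs_cst Phi) polar_resolvent)
  (polar_ncs_cst (ncinv Phi))) (polar_ncs_cst B).
rewrite !mulr0 !mul0r !add0r !mulr1 addr0 ncmulV // mul1r => hB u.
have := polarD (polar_cst p ((1 : R) u)) (polarM (polar_cst p (-1)) (hB u)).
rewrite mulr0 mul0r add0r addr0 mulN1r addr0 ncN; apply: eq_polar => n.
by rewrite mulN1r /b /bcoef ncB.
Qed.

Let Phi_pi := pi_y (negB Phi).

Lemma Phi_coproduct : exists W,
  W * Deltast Phi_pi = tens Phi_pi Phi_pi /\
  forall u w, (u != nseq (size u) 0%N) || (w != nseq (size w) 0%N) -> W u w = 0.
Proof.
apply: (@twisted_coproduct p K abs p_pr hK (fun n => pi_y (negB (Y n)))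
  (fun n => pi_y (negB (b n))) (fun n => pi_y (negB (block K (p * n) p)))).
- by move=> n; rewrite /pi_y /negB Y_nil mulr1.
- move=> u; apply: (boundedM hK); first exact: bounded_cst.
  exact: (Y_bounded hK Phi X_bounded).
(* The sign in [negB] turns the first-order term - B into y_1. *)
- move=> u; have := polarM (polar_cst p ((-1) ^+ count_mem lB (wordAB u))) (polar_b (wordAB u)).
  rewrite mul0r addr0; congr polar.
    have := congr1 (fun f : ncseries nat K => f u) (pi_y1 K).
    by rewrite -{1}(negB1 K).
  rewrite ncN /monom -wordAB_eqB; case: eqP => [->|_]; last by rewrite oppr0 mulr0.
  by rewrite /= expr1 mulN1r opprK.
- by move=> n; rewrite /pi_y /negB b_nil mulr1.
- move=> n; have hY := noA_negB (Y_noA' n.+1).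
  have hE := noA_negB (noA_block K (p * n.+1) p).
  rewrite -(pi_yM _ hY) -(pi_yM _ hE) -!negBM.
  by rewrite (Y_step p_pr hK C_nil C_B X_tends X_P Phi_nil erefl).
- by move=> n; exact: block_group.
- rewrite -pi_yM; last by apply: noA_negB; exact: Y_noA'.
  rewrite -negBM /Y /Ycoef -mulrA ncmulVf // mulr1.
  (* At n = 0 the Frobenius product is empty, so X_0 itself agrees with the harmonic product of
     index p - 1 modulo A. *)
  have := X_P 0; rewrite mulr1 muln0 (harmonic_product_block _ 0) mulr1.
  by move=> /pi_y_eqmodA ->; exact: block_group.
Qed.

Lemma gstar_Phi_group :
  Deltast (gstar (negB Phi)) = tens (gstar (negB Phi)) (gstar (negB Phi)).
Proof.
have [W [W_pi W_supp]] := Phi_coproduct.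
apply: (@gstar_group K (natS_neq0 p_pr hK) (negB Phi) W) => //.
- by rewrite /negB Phi_nil mulr1.
- by move=> n; rewrite /negB Phi_B mulr0.
Qed.

End Main.

Theorem theorem7p1 (p : nat) (K : fieldType) (abs : K -> rat)
    (Phi : ncseries bool K) :
  prime p -> is_padic_field p abs -> is_PhiDe p abs Phi -> DMR0 (negB Phi).
Proof.
move=> p_pr hK [Phi_nil Phi_group Phi_B [G [G_over G_z0]]].
rewrite (_ : _ * _ * Phi = coefC p%:R^-1 * (ncinv Phi * monom K [:: lB] * Phi)).
  move=> G_hor.
  have Phi_B' n : Phi (nseq n.+1 lB) = 0 by exact: Phi_B.
  split; last exact: (gstar_Phi_group p_pr hK Phi_nil Phi_B' G_over G_z0 G_hor).
    split; rewrite /negB; first by rewrite Phi_nil mulr1.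
      by rewrite (Phi_A p_pr hK Phi_nil G_over G_z0 G_hor) mulr0.
    by rewrite (Phi_B' 0%N) mulr0.
  exact: DeltaAB_negB.
by rewrite !mulrA coefC_comm.
Qed.
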